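(* Let $r\ge2$, let $\Delta$ be a degree of tropical curves in $\mathbb{R}^r$ (i.e. a multiset of elements of $\mathbb{Z}^r\setminus\{0\}$ that sum up to $0$), and let $n>0$ be such that $r+n+\#\Delta-3=nr$. Then the number of rational tropical curves of degree $\Delta$ in $\mathbb{R}^r$ through $n$ points in general position (counted with multiplicities) does not depend on the position of the points. That is, there is a fan $Y_0$ in $\mathbb{R}^{nr}$ of dimension smaller than $nr$ such that for $(P_1,\dots,P_n)\in(\mathbb{R}^r)^n\setminus|Y_0|$ the number of (unlabeled) $n$-marked tropical curves $C=(\Gamma,x_1,\dots,x_N,h)$ in $\mathcal{M}_{0,n,\mathrm{trop}}(\mathbb{R}^r,\Delta)$ with $h(x_i)=P_i$ for all $i=1,\dots,n$, each counted with the multiplicity $\operatorname{mult}_C\operatorname{ev}$, does not depend on $(P_1,\dots,P_n)$.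
   Context: Put $N:=n+\#\Delta$ and write $\Delta=(v_{n+1},\dots,v_N)$ after choosing an ordering. Abstract curves. A (rational, abstract) tropical curve is a finite connected metric graph $\Gamma$ of genus $0$ (a tree) all of whose vertices have valence at least $3$; its edges are either bounded, with a length $l(E)\in\mathbb{R}_{>0}$, or unbounded (ends), isometric to $[0,\infty)$. $\mathcal{M}_{0,N,\mathrm{trop}}$ is the set of isomorphism classes of tuples $(\Gamma,x_1,\dots,x_N)$ with $\Gamma$ a tropical curve with exactly $N$ ends, and $x_1,\dots,x_N$ its distinct ends (isomorphisms: homeomorphisms mapping the $i$-th end to the $i$-th end and each edge isometrically onto an edge). Curves in $\mathbb{R}^r$. $\mathcal{M}^{\mathrm{lab}}_{0,n,\mathrm{trop}}(\mathbb{R}^r,\Delta)$ is the set of isomorphism classes of tuples $C=(\Gamma,x_1,\dots,x_N,h)$ with $\Gamma$ a (rational, abstract) tropical curve with exactly $N$ ends, $x_1,\dots,x_N$ its distinct ends, and $h:\Gamma\to\mathbb{R}^r$ continuous such that: on each edge $E$ starting at a vertex $W$, parametrized by arc length $t$ from $W$, $h(t)=h(W)+t\,v(E,W)$ with $v(E,W)\in\mathbb{Z}^r$ (for an end $x_i$ this vector is written $v(x_i)$); at each vertex $W$ the directions of the adjacent edges (bounded or unbounded) sum to zero; $v(x_i)=0$ for $i\le n$ and $v(x_i)=v_i$ for $i=n+1,\dots,N$. Isomorphisms are isomorphisms of abstract curves compatible with the maps $h$. Let $G$ be the group of permutations $\sigma$ of $\{n+1,\dots,N\}$ with $v_{\sigma(i)}=v_i$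 for all $i$; it acts by relabeling the non-contracted ends, and $\mathcal{M}_{0,n,\mathrm{trop}}(\mathbb{R}^r,\Delta):=\mathcal{M}^{\mathrm{lab}}_{0,n,\mathrm{trop}}(\mathbb{R}^r,\Delta)/G$ is the space of unlabeled curves. Let $\operatorname{ev}(C):=(h(x_1),\dots,h(x_n))\in\mathbb{R}^{nr}$. Fan structure. A fan in $V=\Lambda\otimes\mathbb{R}$ ($\Lambda$ a lattice) is a finite set of cones, each given by finitely many linear equalities and non-strict inequalities with coefficients in $\Lambda^\vee$, closed under faces and pairwise intersecting in common faces; $|X|$ denotes the union of the cones of a fan $X$. Let $\operatorname{dist}_N:\mathcal{M}_{0,N,\mathrm{trop}}\to\mathbb{R}^{\binom N2}$ be the vector of distances between ends (sum of lengths of bounded edges on the path between $x_i$ and $x_j$), $\Phi_N:\mathbb{R}^N\to\mathbb{R}^{\binom N2}$, $a\mapsto(a_i+a_j)_{\{i,j\}}$, $Q_N:=\mathbb{R}^{\binom N2}/\operatorname{Im}\Phi_N$, and $\varphi_N$ the composition of $\operatorname{dist}_N$ with the projection to $Q_N$; $\varphi_N$ is injective with image a simplicial fan of pure dimension $N-3$ whose cones correspond to combinatorial types. For $I\subset\{1,\dots,N\}$ with $1<|I|<N-1$, $v_I\in Q_N$ denotes the image of the tree with one bounded edge, of length 1, separating the ends in $I$ from the others, and $\Lambda_N:=\langle v_I\rangle_{\mathbb{Z}}$. The map $C\mapsto(\varphi_N(\Gamma,x_1,\dots,x_N),h(x_1))$ identifies $\mathcal{M}^{\mathrm{lab}}_{0,n,\mathrm{trop}}(\mathbb{R}^r,\Delta)$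 with the fan $\varphi_N(\mathcal{M}_{0,N,\mathrm{trop}})\times\mathbb{R}^r$ in $Q_N\times\mathbb{R}^r$ with lattice $\Lambda_N\times\mathbb{Z}^r$, of pure dimension $r+N-3=nr$. A maximal cone $\sigma=\sigma_0\times\mathbb{R}^r$ has weight $\omega(\sigma):=|\Lambda_{\sigma_0}/\tilde\Lambda_{\sigma_0}|$, where $\Lambda_{\sigma_0}=\Lambda_N\cap\operatorname{span}(\sigma_0)$ and $\tilde\Lambda_{\sigma_0}$ is generated by the vectors $v_I$ spanning $\sigma_0$. Under this identification $\operatorname{ev}$ is the restriction of a linear map sending $\Lambda_N\times\mathbb{Z}^r$ to $\mathbb{Z}^{nr}$. Multiplicity. For a labeled curve $C$ in the relative interior of a maximal cone $\sigma_C$, $\operatorname{mult}_C\operatorname{ev}:=\omega(\sigma_C)\cdot|\mathbb{Z}^{nr}/\operatorname{ev}(\Lambda_{\sigma_C})|$, where $\Lambda_{\sigma_C}$ consists of the lattice points in the linear span of $\sigma_C$. This is invariant under relabeling; the multiplicity of an unlabeled curve is that of any of its labelings (equivalently, for points in general position the number of unlabeled curves is the number of labeled curves, counted with multiplicity, divided by $|G|$). ''General position'' means that $Y_0$ may be chosen so that all relevant curves lie in the relative interiors of maximal cones. *)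

(* Defs.v *)
From HB Require Import structures.
From mathcomp Require Import all_boot all_order perm all_algebra finmap.
From mathcomp Require Import all_classical reals.

Set Implicit Arguments.
Unset Strict Implicit.
Unset Printing Implicit Defensive.

Import Order.TTheory GRing.Theory Num.Theory.
Local Open Scope ring_scope.
Local Open Scope classical_set_scope.

(* The lattice Z^d in R^d. *)
Definition zlattice (R : realType) (d : nat) : set 'rV[R]_d :=
  [set map_mx intr z | z in [set: 'rV[int]_d]].

Definition linspan (R : realType) (d : nat) (A : set 'rV[R]_d) : set 'rV[R]_d :=
  [set x | exists (k : nat) (c : 'I_k -> R) (a : 'I_k -> 'rV[R]_d),
     (forall i, A (a i)) /\ x = \sum_i c i *: a i].

Definition zspan (R : realType) (d : nat) (A : set 'rV[R]_d) : set 'rV[R]_d :=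
  [set x | exists (k : nat) (c : 'I_k -> int) (a : 'I_k -> 'rV[R]_d),
     (forall i, A (a i)) /\ x = \sum_i a i *~ c i].

(* The dimension of the linear span of A: the largest number of linearly
   independent vectors in A. *)
Definition setdim (R : realType) (d : nat) (A : set 'rV[R]_d) : nat :=
  (\max_(k < d.+1 | `[< exists B : 'M[R]_(k, d),
     row_free B /\ forall i, A (row i B) >]) k)%N.

(* |L / L'| for a subgroup L' of L: the number of cosets x + L' with x in L.
   fset_set is empty on infinite sets, so an infinite index has value 0. *)
Definition subgroup_index (U : zmodType) (L L' : set U) : nat :=
  #|` fset_set [set [set y | L' (y - x)] | x in L] |.

(* The columns of F and G are integral linear forms; those of F give the
   equalities and those of G the non-strict inequalities. *)
Definition cone_of (R : realType) (d p q : nat)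
    (F : 'M[int]_(d, p)) (G : 'M[int]_(d, q)) : set 'rV[R]_d :=
  [set x | x *m map_mx intr F = 0 /\
           forall j, 0 <= (x *m map_mx intr G) 0 j].

Definition is_cone (R : realType) (d : nat) (sigma : set 'rV[R]_d) : Prop :=
  exists (p q : nat) (F : 'M[int]_(d, p)) (G : 'M[int]_(d, q)),
    sigma = cone_of F G.

(* tau arises from sigma by turning some of the inequalities of a presentation
   of sigma into equalities. *)
Definition is_face (R : realType) (d : nat) (tau sigma : set 'rV[R]_d) : Prop :=
  exists (p q : nat) (F : 'M[int]_(d, p)) (G : 'M[int]_(d, q)) (S : {set 'I_q}),
    sigma = cone_of F G /\
    tau = sigma `&` [set x | forall j, j \in S -> (x *m map_mx intr G) 0 j = 0].

Definition is_fan (R : realType) (d : nat) (X : set (set 'rV[R]_d)) : Prop :=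
  [/\ finite_set X,
      forall sigma, X sigma -> is_cone sigma,
      forall sigma tau, X sigma -> is_face tau sigma -> X tau &
      forall sigma tau, X sigma -> X tau ->
        is_face (sigma `&` tau) sigma /\ is_face (sigma `&` tau) tau].

Definition fan_support (R : realType) (d : nat) (X : set (set 'rV[R]_d)) :
  set 'rV[R]_d := \bigcup_(sigma in X) sigma.

(* Since a tree has neither loops nor multiple edges, a bounded edge is
   given by the set of its two vertices.  The unbounded edges are the N labeled
   ends; [foot i] is the vertex at which the i-th end starts. *)
Record mgraph (N : nat) := MGraph {
  vert : finType;
  edges : {set {set vert}};
  foot : 'I_N -> vert }.

Definition adj (N : nat) (T : mgraph N) : rel (vert T) :=
  [rel a b | [set a; b]%SET \in edges T].

Definition valence (N : nat) (T : mgraph N) (W : vert T) : nat :=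
  (#|[set E in edges T | W \in E]%SET| + #|[set i | foot T i == W]%SET|)%N.

(* T is the underlying graph (the combinatorial type) of a rational tropical
   curve: a tree, all of whose vertices have valence at least 3. *)
Definition is_tree (N : nat) (T : mgraph N) : Prop :=
  [/\ forall E, E \in edges T -> #|E| = 2%N,
      forall a b, connect (adj (T := T)) a b,
      forall c : seq (vert T), ucycle (adj (T := T)) c -> (size c < 3)%N &
      forall W : vert T, (3 <= valence W)%N].

(* The simple path from a to b, without its starting vertex a. *)
Definition tree_path (N : nat) (T : mgraph N) (a b : vert T) : seq (vert T) :=
  xget [::] [set p | [/\ path (adj (T := T)) a p, last a p = b & uniq (a :: p)]].

Definition path_length (R : realType) (N : nat) (T : mgraph N)
    (l : {set vert T} -> R) (a : vert T) (p : seq (vert T)) : R :=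
  \sum_(E <- pairmap (fun u w => [set u; w]%SET) a p) l E.

Definition end_dist (R : realType) (N : nat) (T : mgraph N)
    (l : {set vert T} -> R) (i j : 'I_N) : R :=
  path_length l (foot T i) (tree_path (foot T i) (foot T j)).

(* The unordered pairs {i,j}, represented with i < j. *)
Definition upair (N : nat) : finType := {p : 'I_N * 'I_N | (p.1 < p.2)%N}.

Definition npairs (N : nat) : nat := #|upair N|.

Definition pfst (N : nat) (k : 'I_(npairs N)) : 'I_N := (val (enum_val k)).1.
Definition psnd (N : nat) (k : 'I_(npairs N)) : 'I_N := (val (enum_val k)).2.

Definition dist_vec (R : realType) (N : nat) (T : mgraph N)
    (l : {set vert T} -> R) : 'rV[R]_(npairs N) :=
  \row_k end_dist l (pfst k) (psnd k).

Definition Phi (R : realType) (N : nat) (a : 'rV[R]_N) : 'rV[R]_(npairs N) :=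
  \row_k (a 0 (pfst k) + a 0 (psnd k)).

(* Q_N = R^(N choose 2) / Im Phi is realized as the row space of this matrix:
   right multiplication by the cokernel matrix of Phi has kernel Im Phi. *)
Definition Qproj (R : realType) (N : nat) : 'M[R]_(npairs N) :=
  cokermx (lin1_mx (@Phi R N)).

Definition phi (R : realType) (N : nat) (T : mgraph N)
    (l : {set vert T} -> R) : 'rV[R]_(npairs N) :=
  dist_vec l *m Qproj R N.

(* The tree with one bounded edge, which separates the ends in I from the
   others. *)
Definition split_tree (N : nat) (I : {set 'I_N}) : mgraph N :=
  @MGraph N bool [set [set: bool]]%SET (fun i => i \in I).

Definition vI (R : realType) (N : nat) (I : {set 'I_N}) : 'rV[R]_(npairs N) :=
  @phi R N (split_tree I) (fun=> 1).

Definition LambdaN (R : realType) (N : nat) : set 'rV[R]_(npairs N) :=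
  zspan [set @vI R N I | I in [set I : {set 'I_N} | (1 < #|I| < N.-1)%N]].

(* The ends lying on the same side of the bounded edge E as the vertex W. *)
Definition side (N : nat) (T : mgraph N) (E : {set vert T}) (W : vert T) :
    {set 'I_N} :=
  [set i | connect [rel a b | [set a; b] \in edges T :\ E] W (foot T i)]%SET.

(* The (closed) cone sigma_0 of the combinatorial type T; edges of length 0
   give the curves in its boundary. *)
Definition type_cone (R : realType) (N : nat) (T : mgraph N) :
    set 'rV[R]_(npairs N) :=
  [set phi l | l in [set l : {set vert T} -> R |
                       forall E, E \in edges T -> 0 <= l E]].

(* The lattice generated by the v_I spanning sigma_0, i.e. by those belonging to
   the bounded edges of T; both sides I of an edge give the same v_I. *)
Definition type_raylattice (R : realType) (N : nat) (T : mgraph N) :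
    set 'rV[R]_(npairs N) :=
  zspan [set x | exists (E : {set vert T}) (W : vert T),
           [/\ E \in edges T, W \in E & x = @vI R N (side E W)]].

Definition type_weight (R : realType) (N : nat) (T : mgraph N) : nat :=
  subgroup_index (@LambdaN R N `&` linspan (@type_cone R N T))
    (@type_raylattice R N T).

(* The n + size Delta ends: first the n contracted ones (the marked points),
   then those with the directions listed in Delta. *)
Definition end_dir (r n : nat) (Delta : seq 'rV[int]_r)
    (i : 'I_(n + size Delta)) : 'rV[int]_r :=
  match fintype.split i with
  | inl _ => 0
  | inr j => Delta`_j
  end.

(* The map Gamma -> R^r is affine on each edge, with prescribed direction on the
   ends, so it is given by its values h at the vertices; v E W is the direction
   v(E,W) of the bounded edge E starting at W. *)
Definition is_tropical_map (R : realType) (r n : nat) (Delta : seq 'rV[int]_r)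
    (T : mgraph (n + size Delta)) (l : {set vert T} -> R)
    (h : vert T -> 'rV[R]_r) : Prop :=
  exists v : {set vert T} -> vert T -> 'rV[int]_r,
    (forall W W', [set W; W']%SET \in edges T ->
       h W' = h W + l [set W; W']%SET *: map_mx intr (v [set W; W']%SET W)) /\
    (forall W, \sum_(E in edges T | W \in E) v E W
               + \sum_(i | foot T i == W) end_dir i = 0).

Record curve (R : realType) (r n : nat) (Delta : seq 'rV[int]_r) := Curve {
  graph :> mgraph (n + size Delta);
  len : {set vert graph} -> R;
  pos : vert graph -> 'rV[R]_r;
  curve_tree : is_tree graph;
  len_gt0 : forall E, E \in edges graph -> 0 < len E;
  curve_map : is_tropical_map len pos }.

(* C and C' become isomorphic labeled curves when the ends of C are relabeled
   by s. *)
Definition iso_upto (R : realType) (r n : nat) (Delta : seq 'rV[int]_r)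
    (s : {perm 'I_(n + size Delta)}) (C C' : curve R n Delta) : Prop :=
  exists2 f : vert C -> vert C', bijective f &
    [/\ forall E : {set vert C}, ((f @: E)%SET \in edges C') = (E \in edges C),
        forall E : {set vert C}, E \in edges C -> len (f @: E)%SET = len E,
        forall i, foot C' (s i) = f (foot C i) &
        forall W, pos (f W) = pos W].

Definition relabelings (r n : nat) (Delta : seq 'rV[int]_r) :
    {set {perm 'I_(n + size Delta)}} :=
  [set s : {perm 'I_(n + size Delta)} |
     [forall i : 'I_n, s (lshift _ i) == lshift _ i] &&
     [forall i, end_dir (s i) == end_dir i]]%SET.

(* Equality of the unlabeled curves defined by C and C'. *)
Definition unlabeled_iso (R : realType) (r n : nat) (Delta : seq 'rV[int]_r)
    (C C' : curve R n Delta) : Prop :=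
  exists2 s, s \in relabelings n Delta & iso_upto s C C'.

(* h(x_i) for the i-th marked point. *)
Definition marked_pos (R : realType) (r n : nat) (Delta : seq 'rV[int]_r)
    (C : curve R n Delta) (i : 'I_n) : 'rV[R]_r :=
  pos (foot C (lshift (size Delta) i)).

(* (R^r)^n is 'M_(n, r), identified with R^(nr) by mxvec. *)
Definition ev (R : realType) (r n : nat) (Delta : seq 'rV[int]_r)
    (C : curve R n Delta) : 'M[R]_(n, r) :=
  \matrix_(i < n) marked_pos C i.

(* The point of Q_N x R^r corresponding to C. *)
Definition coords (R : realType) (r n : nat) (n_gt0 : (0 < n)%N)
    (Delta : seq 'rV[int]_r) (C : curve R n Delta) :
    'rV[R]_(npairs (n + size Delta) + r) :=
  row_mx (phi (len (c := C))) (marked_pos C (Ordinal n_gt0)).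

(* The linear map Q_N x R^r -> R^(nr) restricting to ev.  The matrix is only
   determined on Q_N x R^r, which is spanned by the points [coords n_gt0 C]. *)
Definition ev_mx (R : realType) (r n : nat) (n_gt0 : (0 < n)%N)
    (Delta : seq 'rV[int]_r) :
    'M[R]_(npairs (n + size Delta) + r, n * r) :=
  xget 0 [set L | forall C : curve R n Delta,
                    coords n_gt0 C *m L = mxvec (ev C)].

Definition fan_lattice (R : realType) (N r : nat) :
    set 'rV[R]_(npairs N + r) :=
  [set row_mx q x | q in @LambdaN R N & x in @zlattice R r].

(* The cone sigma_C = sigma_0 x R^r having C in its relative interior. *)
Definition curve_cone (R : realType) (r n : nat) (Delta : seq 'rV[int]_r)
    (C : curve R n Delta) : set 'rV[R]_(npairs (n + size Delta) + r) :=
  [set row_mx q x | q in @type_cone R _ C & x in [set: 'rV[R]_r]].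

(* The fan is of pure dimension r + N - 3, so its maximal cones are those of
   this dimension. *)
Definition in_maximal_cone (R : realType) (r n : nat) (Delta : seq 'rV[int]_r)
    (C : curve R n Delta) : Prop :=
  setdim (curve_cone C) = (r + (n + size Delta) - 3)%N.

Definition mult_ev (R : realType) (r n : nat) (n_gt0 : (0 < n)%N)
    (Delta : seq 'rV[int]_r) (C : curve R n Delta) : nat :=
  (@type_weight R _ C *
   subgroup_index (@zlattice R (n * r))
     [set (x *m ev_mx R n_gt0 Delta)%R
     | x in @fan_lattice R _ r `&` linspan (curve_cone C)])%N.

(* There are finitely many unlabeled curves C with h(x_i) = P_i for all i, all
   in the relative interior of a maximal cone, and d is their number counted
   with multiplicity; Cs lists one labeling of each of them. *)
Definition curve_count (R : realType) (r n : nat) (n_gt0 : (0 < n)%N)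
    (Delta : seq 'rV[int]_r) (P : 'M[R]_(n, r)) (d : nat) : Prop :=
  (forall C : curve R n Delta, ev C = P -> in_maximal_cone C) /\
  exists (k : nat) (Cs : 'I_k -> curve R n Delta),
    [/\ forall a, ev (Cs a) = P,
        forall a b, unlabeled_iso (Cs a) (Cs b) -> a = b,
        forall C : curve R n Delta, ev C = P ->
          exists a, unlabeled_iso C (Cs a) &
        d = (\sum_a mult_ev n_gt0 (Cs a))%N].

(* Main.v *)
From HB Require Import structures.
Require Import Defs.
From mathcomp Require Import all_boot all_order all_algebra fingroup perm action.
From mathcomp Require Import all_classical reals.
From mathcomp Require Import finmap.
From mathcomp Require Import path fintype finset.
From mathcomp Require Import ring lra zify.

Set Implicit Arguments.
Unset Strict Implicit.
Unset Printing Implicit Defensive.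

Import Order.TTheory GRing.Theory Num.Theory.
Local Open Scope ring_scope.
Local Open Scope classical_set_scope.

(** Take the first marked end as root.  A bounded edge of a rational curve splits
    the ends in two; recording the part away from the root turns the tree into a
    laminar family F of sets of ends, and a curve is the same thing as such a
    family, a length l_I > 0 for each I in F and a position p of the root
    ([realization], [tree_iso]).  Let e_I be the sum of the directions of the ends
    in I.  By balancing, the edge of I points in direction e_I, so evaluation is

      ev = sum_(I in F) l_I u_I + (p, ..., p),

    where u_I has the block e_I at the marked points in I and 0 at the others
    ([ev_solves]).  The u_I and the r diagonal vectors form a list of at most nr
    integer vectors, of exactly nr when the tree is trivalent.  The weight and the
    index that make up the multiplicity of a curve are the two steps of a chain of
    lattices that ends in the lattice generated by this list, so the multiplicity
    is the absolute value of the determinant of the list ([mult_ev_det]).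

    The labeled curves through P are thus the families of nonzero determinant for
    which Cramer's rule yields positive lengths.  Their number, weighted by
    |determinant|, can only jump at the hyperplanes spanned by the diagonal
    vectors and the u_I with I in T, where T is a family F with one set removed.
    Removing a set merges two vertices into one of valence four.  If A, B and C
    are the sets of ends on its branches away from the root, then T has exactly
    three trivalent completions, by A :|: B, A :|: C and B :|: C
    ([trivalent_resolutions]), and

      u_(AB) + u_(AC) + u_(BC) = u_A + u_B + u_C + u_(ABC)

    ([evu_resolutions]).  The vector u_I vanishes when I is a single end or
    consists of all ends but the root, so the right hand side is a combination of
    vectors of the wall, and the determinants obtained by adding one of the three
    completing vectors to the wall add up to 0 ([evu_balanced]).  The sign of such
    a determinant tells on which side of the wall the completed family carries a
    curve.  Hence the jumps cancel, and moving along a segment that meets the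
    walls one at a time shows that the weighted number is constant off the walls
    ([weighted_count_const]).

    Relabeling equal ends acts freely on the families of nonzero determinant
    ([nondeg_relab_free]), so the number of unlabeled curves is the labeled number
    divided by the order of the group ([count_curves]).  Finally, Y0 consists of
    the faces of an arrangement of hyperplanes: all the walls, and for every
    family of determinant 0 one hyperplane containing all values of ev on it, so
    that off |Y0| only families of nonzero determinant occur. *)

(** * Laminar families *)
Section Laminar.
Local Open Scope nat_scope.
Local Open Scope set_scope.
Local Open Scope bool_scope.
Variable S : finType.
Implicit Types (A B C I J K W : {set S}) (F : {set {set S}}).

Definition nested I J := [|| I \subset J, J \subset I | [disjoint I & J]].

Definition laminar F := [forall I in F, [forall J in F, nested I J]].

Lemma laminarP F :
  reflect (forall I J, I \in F -> J \in F -> nested I J) (laminar F).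
Proof.
apply: (iffP 'forall_in_forall_inP) => h I J; first by move=> IF JF; apply: h.
by move=> JF IF; apply: h.
Qed.

Lemma nestedC I J : nested I J = nested J I.
Proof. by rewrite /nested disjoint_sym orbCA. Qed.

Lemma nestedxx I : nested I I.
Proof. by rewrite /nested subxx. Qed.

Lemma nested1 x J : nested [set x] J.
Proof. by rewrite /nested disjoints1 sub1set; case: (x \in J); rewrite ?orbT. Qed.

Lemma nested_meet I J x : nested I J -> x \in I -> x \in J ->
  (I \subset J) || (J \subset I).
Proof.
case/or3P=> [->|->|/pred0P/(_ x)/= + xI xJ] //; first by rewrite orbT.
by rewrite xI xJ.
Qed.

Lemma disjoint_setD A B : [disjoint A & B :\: A].
Proof. by rewrite -setI_eq0 setIDA setIC -setIDA setDv setI0. Qed.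

(** By induction: in a minimal member choose two distinct elements x and y, and
    delete x everywhere.  By minimality every other member that contains x or y
    contains both, so the remaining members stay distinct and of size at least 2,
    while the minimal member is left out and W loses a point. *)
Lemma laminar_card F W : W != set0 -> laminar F ->
  (forall I, I \in F -> (I \subset W) && (1 < #|I|)) -> #|F| < #|W|.
Proof.
have [n] := ubnP #|F|; elim: n => // n IH in F W * => ltFn W0 /laminarP lamF szF.
have [->|[J0 J0F]] := set_0Vmem F; first by rewrite cards0 card_gt0.
have [I] := @arg_minnP _ J0 (mem F) (fun I => #|I|) J0F.
move=> IF' minI; have IF : I \in F := IF'.
have {}minI J x : J \in F -> x \in J -> x \in I -> I \subset J.
  move=> JF xJ xI; have /orP[//|sJI] := nested_meet (lamF _ _ IF JF) xI xJ.
  by have /eqP<- : J == I by rewrite eqEcard sJI; apply: minI.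
have /andP[sIW /card_gt1P[x [y [xI yI neq_xy]]]] := szF I IF.
have xW := subsetP sIW x xI; have yW := subsetP sIW y yI.
(* Injective on F, since membership of y records membership of x. *)
pose h J := J :\ x.
have hinj : {in F &, injective h}.
  move=> J K JF KF /setP eJK; apply/setP=> z.
  have [->|zx] := eqVneq z x; last by have := eJK z; rewrite !inE zx.
  have := eJK y; rewrite !inE eq_sym neq_xy /= => eyJK.
  apply/idP/idP=> xL.
    by apply: (subsetP (minI K y KF _ yI)) => //; rewrite -eyJK (subsetP (minI J x JF xL xI)).
  by apply: (subsetP (minI J y JF _ yI)) => //; rewrite eyJK (subsetP (minI K x KF xL xI)).
have cF : #|F| = #|h @: (F :\ I)|.+1.
  rewrite card_in_imset; first by rewrite (cardsD1 I F) IF.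
  by move=> J K; rewrite !inE => /andP[_ JF] /andP[_ KF]; apply: hinj.
rewrite cF (cardsD1 x W) xW ltnS; apply: IH.
- by move: ltFn; rewrite cF.
- by apply/set0Pn; exists y; rewrite !inE eq_sym neq_xy.
- apply/laminarP=> _ _ /imsetP[J /setD1P[_ JF] ->] /imsetP[K /setD1P[_ KF] ->].
  case/or3P: (lamF J K JF KF) => [sJK|sKJ|dJK]; rewrite /nested /h.
  + by rewrite setSD.
  + by rewrite (setSD _ sKJ) orbT.
  + by rewrite (disjointW _ _ dJK) ?orbT ?subsetDl.
move=> _ /imsetP[J /setD1P[neJI JF] ->]; have /andP[sJW cJ] := szF J JF.
rewrite setSD //=; have [xJ|xJ] := boolP (x \in J); last first.
  by rewrite /h (setDidPl _) // disjoint_sym disjoints1.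
have := minI J x JF xJ xI => sIJ.
have : #|I| < #|J| by rewrite proper_card // properEneq eq_sym neJI.
rewrite (cardsD1 x J) xJ add1n ltnS; apply: leq_trans.
by apply/card_gt1P; exists x, y.
Qed.

(** The families of the sets of ends beyond the bounded edges of a rooted tree,
    where W is the set of all ends but the root. *)
Definition tree_family W F :=
  laminar F && [forall I in F, [&& I \subset W, 1 < #|I| & I != W]].

Lemma tree_familyP W F : tree_family W F ->
  (forall I J, I \in F -> J \in F -> nested I J) /\
  (forall I, I \in F -> [/\ I \subset W, 1 < #|I| & I != W]).
Proof.
by case/andP=> /laminarP lamF /forall_inP h; split=> // I /h/and3P[].
Qed.

Lemma tree_family_sub W F F' : F' \subset F -> tree_family W F -> tree_family W F'.
Proof.
move=> /subsetP sF /tree_familyP[lamF h]; apply/andP; split.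
  by apply/laminarP=> I J /sF IF /sF JF; apply: lamF.
by apply/forall_inP=> I /sF/h[-> -> ->].
Qed.

Lemma tree_familyU1 W F K : tree_family W F ->
  [/\ K \subset W, 1 < #|K| & K != W] -> (forall I, I \in F -> nested K I) ->
  tree_family W (K |: F).
Proof.
move=> /tree_familyP[lamF h] hK nK; apply/andP; split.
  apply/laminarP=> I J /setU1P[->|IF] /setU1P[->|JF]; rewrite ?nestedxx //.
  - exact: nK.
  - by rewrite nestedC; apply: nK.
  - exact: lamF.
by apply/forall_inP=> I /setU1P[->|/h[]*]; [case: hK => -> -> -> | apply/and3P].
Qed.

Lemma tree_family_card W F : 1 < #|W| -> tree_family W F -> #|F| + 2 <= #|W|.
Proof.
move=> W1 /tree_familyP[lamF h].
have WF : W \notin F by apply/negP=> /h[_ _]; rewrite eqxx.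
have -> : #|F| + 2 = (#|W |: F|).+1 by rewrite cardsU1 WF addn2.
apply: laminar_card.
- by rewrite -card_gt0 ltnW.
- apply/laminarP=> I J /setU1P[->|IF] /setU1P[->|JF]; rewrite ?nestedxx //.
  + by rewrite /nested; case: (h J JF) => ->; rewrite orbT.
  + by rewrite /nested; case: (h I IF) => ->.
  + exact: lamF.
by move=> I /setU1P[->|/h[-> -> //]]; rewrite subxx.
Qed.

(** The sets of leaves beyond any edge, bounded or not; W itself lies beyond the
    edge of the root. *)
Definition cluster W F I := [|| I \in F, I == W | (#|I| == 1) && (I \subset W)].

(** A tree with |W| + 1 ends is trivalent if and only if it has |W| - 2 bounded
    edges, the largest number possible. *)
Definition trivalent W F := tree_family W F && (#|F| + 2 == #|W|).

(** A trivalent family attains the bound of [tree_family_card], so it cannot be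
    enlarged. *)
Lemma trivalent_maximal W F K : trivalent W F -> K \subset W -> K != set0 ->
  (forall I, I \in F -> nested K I) -> cluster W F K.
Proof.
move=> /andP[tF /eqP cF] sKW K0 nK; rewrite /cluster; have [//|KF] := boolP (K \in F).
have [//|neKW] := eqVneq K W; rewrite sKW andbT /=; apply: contraT => K1.
have c1 : 1 < #|K| by move: K0 K1; rewrite -card_gt0; case: #|K| => [|[|]].
have /tree_family_card : tree_family W (K |: F) by apply: tree_familyU1.
have W1 : 1 < #|W| by apply: leq_trans c1 (subset_leq_card sKW).
by move=> /(_ W1); rewrite -cF cardsU1 KF addSn ltnn.
Qed.

Lemma cluster_sub W F I : tree_family W F -> cluster W F I -> I \subset W.
Proof.
by move=> /tree_familyP[_ h] /or3P[/h[]//|/eqP->//|/andP[]].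
Qed.

Lemma cluster_neq0 W F I : W != set0 -> tree_family W F -> cluster W F I -> I != set0.
Proof.
move=> W0 /tree_familyP[_ h] /or3P[/h[_ ? _]|/eqP->//|/andP[/eqP]].
  by rewrite -card_gt0 ltnW.
by rewrite -card_gt0 => ->.
Qed.

Lemma cluster_nested W F I K : cluster W F I -> K \subset W ->
  (forall J, J \in F -> nested K J) -> nested K I.
Proof.
move=> /or3P[IF _ nK|/eqP-> sKW _|/andP[/cards1P[x ->] _] _ _]; first exact: nK.
  by rewrite /nested sKW.
by rewrite nestedC nested1.
Qed.

(** Two branches leave a trivalent vertex downwards: for a largest cluster A
    strictly inside I, the complement of A in I is nested with every member, hence
    a cluster by maximality of the family. *)
Lemma cluster_split W F I : trivalent W F -> I \in F ->
  exists2 A, cluster W F A && (A \proper I) & cluster W F (I :\: A).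
Proof.
move=> tF IF; have /andP[/[dup] fF /tree_familyP[lamF h] _] := tF.
have [sIW /card_gt1P[x [y [xI yI neq_xy]]] _] := h I IF.
have x1 : cluster W F [set x] && ([set x] \proper I).
  rewrite /cluster cards1 sub1set (subsetP sIW) // orbT orbT /= properEneq sub1set xI andbT.
  by apply: contra_neq neq_xy => /setP/(_ y); rewrite inE yI => /eqP.
(* A singleton of an element of I is a cluster strictly inside I. *)
have [A /andP[cA pA] maxA] := @arg_maxnP _ [set x]
  (fun A => cluster W F A && (A \proper I)) (fun A => #|A|) x1.
exists A; first by rewrite cA.
apply: trivalent_maximal => //.
- by apply: subset_trans sIW; apply: subsetDl.
- by case/properP: pA => _ [z zI zA]; apply/set0Pn; exists z; rewrite inE zA.
move=> K KF; rewrite nestedC.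
have KA : nested K A by apply: cluster_nested cA _ (lamF K ^~ KF); case: (h K KF).
case/or3P: (lamF K I KF IF) => [sKI|sIK|dKI].
- case/or3P: KA => [sKA|sAK|dKA].
  + apply/or3P; apply: Or33; exact: disjointWl sKA (disjoint_setD _ _).
  + have [->|neKI] := eqVneq K I; first by rewrite /nested subsetDl orbT.
    have /maxA cKA : cluster W F K && (K \proper I) by rewrite /cluster KF properEneq neKI.
    have -> : K = A by apply/eqP; rewrite eq_sym eqEcard sAK.
    by apply/or3P; apply: Or33; apply: disjoint_setD.
  + by rewrite /nested subsetD sKI dKA.
- by rewrite /nested (subset_trans (subsetDl _ _) sIK) orbT.
- by apply/or3P; apply: Or33; apply: disjointWr dKI; apply: subsetDl.
Qed.

(** The smallest cluster J strictly containing I belongs to the edge above I; as in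
    [cluster_split], the rest of J is a cluster, the sister of I. *)
Lemma cluster_parent W F I : trivalent W F -> I \in F ->
  exists J, [/\ cluster W F J, I \proper J, cluster W F (J :\: I) &
    forall K, K \in F -> I \proper K -> K \subset J -> K = J].
Proof.
move=> tF IF; have /andP[/[dup] fF /tree_familyP[lamF h] _] := tF.
have [sIW I1 neIW] := h I IF.
have pW : (W \in W |: F) && (I \proper W) by rewrite setU11 properEneq neIW.
have [J /andP[JF pJ] minJ] := @arg_minnP _ W
  (fun J => (J \in W |: F) && (I \proper J)) (fun J => #|J|) pW.
have cJ : cluster W F J by case/setU1P: JF => [->|JF]; rewrite /cluster ?eqxx ?orbT ?JF.
have {}minJ K : K \in F -> I \proper K -> K \subset J -> K = J.
  move=> KF pK sKJ; apply/eqP; rewrite eqEcard sKJ; apply: minJ.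
  by rewrite pK andbT; apply/setU1P; right.
have sJW := cluster_sub fF cJ.
exists J; split=> //; apply: trivalent_maximal => //.
- by apply: subset_trans sJW; apply: subsetDl.
- by case/properP: pJ => _ [z zI zA]; apply/set0Pn; exists z; rewrite inE zA.
move=> K KF; rewrite nestedC.
have KJ : nested K J by apply: cluster_nested cJ _ (lamF K ^~ KF); case: (h K KF).
case/or3P: KJ => [sKJ|sJK|dKJ].
- case/or3P: (lamF K I KF IF) => [sKI|sIK|dKI].
  + by apply/or3P; apply: Or33; apply: disjointWl sKI _; exact: disjoint_setD.
  + have [->|neKI] := eqVneq K I.
      by apply/or3P; apply: Or33; apply: disjoint_setD.
    rewrite (minJ K KF _ sKJ) ?properEneq ?sIK 1?eq_sym ?neKI //.
    by rewrite /nested subsetDl orbT.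
  + by rewrite /nested subsetD sKJ dKI.
- by rewrite /nested (subset_trans (subsetDl _ _) sJK) orbT.
- by apply/or3P; apply: Or33; apply: disjointWr dKJ; apply: subsetDl.
Qed.

(** A member other than I that is contained in J avoids I or lies in one of its
    halves A and B, so exchanging B for the sister of I preserves laminarity. *)
Lemma resolution_tree_family W F I A B J : trivalent W F -> I \in F ->
    A :|: B = I -> [disjoint A & B] -> A != set0 -> B != set0 ->
    cluster W F A -> cluster W F B ->
    I \proper J -> J \subset W ->
    (forall K, K \in F -> nested K J) ->
    (forall K, K \in F -> I \proper K -> K \subset J -> K = J) ->
  let K := A :|: (J :\: I) in K \notin F /\ tree_family W (K |: F :\ I).
Proof.
move=> tF IF eI dAB /set0Pn[a aA] /set0Pn[b bB] cA cB pIJ sJW nJ minJ K.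
have /andP[/[dup] fF /tree_familyP[lamF h] _] := tF.
have sAI : A \subset I by rewrite -eI subsetUl.
have sBI : B \subset I by rewrite -eI subsetUr.
have [sIJ [c cJ cI]] := properP pIJ.
have bA : b \in A = false by have /setDidPl/setP/(_ b) := dAB; rewrite !inE bB; case: (b \in A).
have nKI : ~~ nested K I.
  rewrite /nested !negb_or; apply/and3P; split.
  - by apply/subsetPn; exists c; rewrite // !inE cI cJ orbT.
  - by apply/subsetPn; exists b; rewrite ?(subsetP sBI) // !inE (subsetP sBI) // bA.
  - by apply/pred0Pn; exists a; rewrite /= !inE aA (subsetP sAI).
have sKJ : K \subset J by rewrite subUset (subset_trans sAI sIJ) subsetDl.
split; first by apply/negP=> KF; case/negP: nKI; apply: lamF.
apply: tree_familyU1; first by apply: tree_family_sub fF; apply: subsetDl.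
  split; first exact: subset_trans sKJ sJW.
  - apply/card_gt1P; exists a, c; rewrite !inE aA cJ cI orbT; split=> //.
    by apply: contraNneq cI => <-; apply: (subsetP sAI).
  - have bI := subsetP sBI b bB; have : b \notin K by rewrite !inE bA bI.
    by apply: contraNneq => ->; rewrite (subsetP sJW) // (subsetP sIJ).
move=> L /setD1P[neLI LF].
have [sLW _ _] := h L LF.
case/or3P: (nJ L LF) => [sLJ|sJL|dLJ]; last 2 first.
- by rewrite /nested (subset_trans sKJ sJL).
- by rewrite nestedC; apply/or3P; apply: Or33; apply: disjointWr dLJ.
case/or3P: (lamF L I LF IF) => [sLI|sIL|dLI]; last 2 first.
- by rewrite (minJ L LF _ sLJ) ?properEneq 1?eq_sym ?neLI // /nested sKJ.
- by rewrite /nested [X in _ || (X || _)](_ : _ = true) ?orbT // subsetU // [X in _ || X]subsetD sLJ dLI orbT.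
have nLA : nested L A by apply: cluster_nested cA _ (lamF L ^~ LF).
have nLB : nested L B by apply: cluster_nested cB _ (lamF L ^~ LF).
have LAB z : z \in L -> (z \in A) || (z \in B).
  by move=> zL; rewrite -in_setU eI (subsetP sLI).
case/or3P: nLA => [sLA|sAL|dLA].
- by rewrite /nested [X in _ || (X || _)](_ : _ = true) ?orbT // subsetU // sLA.
- case/or3P: nLB => [sLB|sBL|dLB].
  + by have := subsetP sLB a (subsetP sAL a aA); have /setDidPl/setP/(_ a) := dAB; rewrite !inE aA andbT => /negbTE->.
  + by case/eqP: neLI; apply/eqP; rewrite eqEsubset sLI -eI subUset sAL.
  + rewrite /nested [X in _ || (X || _)](_ : _ = true) ?orbT // subsetU //; apply/orP; left.
    apply/subsetP=> z zL; have /orP[//|zB] := LAB z zL.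
    by have /pred0P/(_ z) := dLB; rewrite /= zL zB.
- rewrite nestedC; apply/or3P; apply: Or33; apply/pred0P=> z /=; apply/negP=> /andP[zL].
  rewrite !inE (subsetP sLI z zL) /= orbF => zA.
  by have /pred0P/(_ z) := dLA; rewrite /= zL zA.
Qed.

(** Contracting the edge of I yields a vertex of valence 4 with downward branches
    A, B (the halves of I) and C (the sister of I).  A further set K compatible
    with the rest but not with I is nested with each branch, hence a union of
    branches, and K is neither one branch nor all three. *)
Lemma trivalent_resolutions W F I : trivalent W F -> I \in F ->
  exists A B C, let T := F :\ I in
  [/\ [/\ cluster W T A, cluster W T B, cluster W T C & cluster W T (A :|: B :|: C)],
      [/\ [disjoint A & B], [disjoint A & C] & [disjoint B & C]],
      uniq [:: A :|: B; A :|: C; B :|: C] &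
      forall K, (K \notin T) && tree_family W (K |: T) =
                (K \in [:: A :|: B; A :|: C; B :|: C])].
Proof.
move=> tF IF; have /andP[/[dup] fF /tree_familyP[lamF h] _] := tF.
have [sIW I1 neIW] := h I IF.
have W0 : W != set0.
  by rewrite -card_gt0; apply: leq_trans (subset_leq_card sIW); apply: ltnW.
have [A /andP[cA pA] cB] := cluster_split tF IF.
set B := I :\: A in cB.
have [J [cJ pJ cC minJ]] := cluster_parent tF IF.
set C := J :\: I in cC.
have A0 := cluster_neq0 W0 fF cA; have B0 := cluster_neq0 W0 fF cB.
have C0 := cluster_neq0 W0 fF cC.
have [[sAI _] [sIJ _]] := (properP pA, properP pJ).
have eI : A :|: B = I by rewrite -[RHS](setID I A) (setIidPr sAI).
have eJ : A :|: B :|: C = J by rewrite eI -[RHS](setID J I) (setIidPr sIJ).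
have dAB : [disjoint A & B] by apply: disjoint_setD.
have dIC : [disjoint I & C] by apply: disjoint_setD.
have dAC : [disjoint A & C] by apply: disjointWl dIC.
have dBC : [disjoint B & C] by apply: disjointWl dIC; apply: subsetDl.
have cT L : cluster W F L -> L != I -> cluster W (F :\ I) L.
  by rewrite /cluster !inE => + ->.
have sJW := cluster_sub fF cJ.
have nJ K : K \in F -> nested K J.
  by move=> KF; apply: cluster_nested cJ _ (lamF K ^~ KF); case: (h K KF).
have [a aA] := set0Pn _ A0; have [b bB] := set0Pn _ B0; have [c cC'] := set0Pn _ C0.
have bA : b \notin A by case/setDP: bB.
have aB : a \notin B by rewrite inE aA.
have aC : a \notin C by rewrite inE (subsetP sAI).
have bC : b \notin C by rewrite inE -eI inE bB orbT.
have cA' : c \notin A by apply: contraTN cC' => cA'; rewrite inE (subsetP sAI).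
have cB' : c \notin B by apply: contraTN cC' => cB'; rewrite inE -eI inE cB' orbT.
have [defC sBI] : C = J :\: I /\ B \subset I by split; rewrite // subsetDl.
clearbody B C; exists A, B, C; split; [split|by []|..].
- by apply: cT => //; apply: contraTneq pA => ->; rewrite properxx.
- apply: cT => //; apply: contraTneq aA => eBI; apply: contra aB => aA.
  by rewrite eBI (subsetP sAI).
- apply: cT => //; apply: contraTneq cC' => eCI; apply: contra cA'.
  by rewrite eCI -eI inE (negPf cB') orbF.
- by rewrite eJ; apply: cT => //; apply: contraTneq pJ => ->; rewrite properxx.
- rewrite /= !inE !negb_or !andbT; apply/andP; split; first (apply/andP; split).
  + by apply/eqP=> /setP/(_ c); rewrite !inE cC' (negPf cA') (negPf cB') orbT.
  + by apply/eqP=> /setP/(_ c); rewrite !inE cC' (negPf cA') (negPf cB') orbT.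
  + by apply/eqP=> /setP/(_ a); rewrite !inE aA (negPf aB) (negPf aC).
move=> K; apply/idP/idP.
  case/andP=> KT /tree_familyP[lamK hK].
  rewrite !inE eI; have [//|neKI] := eqVneq K I; rewrite /=.
  have [sKW K1 neKW] := hK K (setU11 _ _).
  have KF : K \notin F by move: KT; rewrite !inE neKI.
  have nK L : L \in F :\ I -> nested K L.
    by move=> LT; apply: lamK; rewrite !inE ?eqxx //; move: LT; rewrite !inE => ->; rewrite orbT.
  have nKI : ~~ nested K I.
    apply/negP=> nKI; case/negP: KF.
    have : cluster W F K.
      apply: trivalent_maximal => //; first by rewrite -card_gt0 ltnW.
      by move=> L LF; have [->//|neLI] := eqVneq L I; apply: nK; rewrite !inE neLI.
    by rewrite /cluster (negPf neKW) gtn_eqF //= orbF.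
  have nKcl L : cluster W F L -> L != I -> nested K L.
    by move=> cL neL; apply: cluster_nested (cT L cL neL) sKW nK.
  move: nKI; rewrite /nested !negb_or => /and3P[nsKI nsIK mKI].
  have sKJ : K \subset J.
    have : nested K J by apply: nKcl => //; apply: contraTneq pJ => ->; rewrite properxx.
    case/or3P=> // [sJK|dKJ]; first by rewrite (subset_trans sIJ) in nsIK.
    by rewrite (disjointWr sIJ) in mKI.
  have KU z : z \in K -> [|| z \in A, z \in B | z \in C].
    by move=> /(subsetP sKJ); rewrite -eJ !inE orbA.
  have caseA : A \subset K \/ [disjoint K & A].
    have : nested K A by apply: nKcl => //; apply: contraTneq pA => ->; rewrite properxx.
    by case/or3P; [move=> /subset_trans/(_ sAI); rewrite (negPf nsKI)|left|right].
  have caseB : B \subset K \/ [disjoint K & B].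
    have : nested K B.
      apply: nKcl => //; apply: contraTneq aA => eBI; apply: contra aB => aA.
      by rewrite eBI (subsetP sAI).
    case/or3P; [|by left|by right].
    by move=> /subset_trans/(_ sBI); rewrite (negPf nsKI).
  have caseC : C \subset K \/ [disjoint K & C].
    have : nested K C.
      apply: nKcl => //; apply: contraTneq cC' => eCI; apply: contra cA'.
      by rewrite eCI -eI inE (negPf cB') orbF.
    case/or3P; [|by left|by right].
    by move=> sKC; rewrite disjoint_sym (disjointWr sKC) in mKI.
  have dE L : [disjoint K & L] -> forall z, z \in K -> z \in L = false.
    by move=> /pred0P dKL z zK; have := dKL z; rewrite /= zK.
  case: caseA caseB caseC => [sAK|/dE dKA] [sBK|/dE dKB] [sCK|/dE dKC].
  - by rewrite -eI subUset sAK sBK in nsIK.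
  - by rewrite -eI subUset sAK sBK in nsIK.
  - apply/orP; left; rewrite eqEsubset subUset sAK sCK !andbT.
    by apply/subsetP=> z zK; have := KU z zK; rewrite !inE dKB.
  - case/negP: nsKI; apply/subsetP=> z zK; have := KU z zK.
    by rewrite dKB // dKC // !orbF; apply: (subsetP sAI).
  - apply/orP; right; rewrite eqEsubset subUset sBK sCK !andbT.
    by apply/subsetP=> z zK; have := KU z zK; rewrite !inE dKA.
  - case/negP: nsKI; apply/subsetP=> z zK; have := KU z zK.
    by rewrite dKA // dKC // orFb orbF -eI => zB; rewrite inE zB orbT.
  - case/negP: mKI; apply/pred0P=> z /=; apply/negP=> /andP[zK].
    by rewrite -eI inE dKA // dKB.
  - case/negP: mKI; apply/pred0P=> z /=; apply/negP=> /andP[zK].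
    by rewrite -eI inE dKA // dKB.
rewrite !inE => /or3P[] /eqP->.
- by rewrite eI eqxx setD1K.
- have [nF tK] : A :|: C \notin F /\ tree_family W ((A :|: C) |: F :\ I).
    by rewrite defC; apply: (resolution_tree_family tF IF eI dAB A0 B0 cA cB pJ sJW nJ minJ).
  by rewrite tK (negPf nF) andbF.
- have [nF tK] : B :|: C \notin F /\ tree_family W ((B :|: C) |: F :\ I).
    rewrite defC; apply: (resolution_tree_family tF IF _ _ B0 A0 cB cA pJ sJW nJ minJ).
    + by rewrite setUC.
    + by rewrite disjoint_sym.
  by rewrite tK (negPf nF) andbF.
Qed.

End Laminar.

(** * Determinants of sequences of rows *)
Section RowSequences.
Variables (m : nat) (m_gt0 : (0 < m)%N).
Implicit Types s : seq 'rV[int]_m.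

(** The rows beyond the end of s are 0, so a sequence that is too short has
    determinant 0. *)
Definition seq_mx s : 'M[int]_m := \matrix_k s`_k.

Definition sdet s : int := \det (seq_mx s).

Definition first_row : 'I_m := Ordinal m_gt0.

(** Expansion along the first row: the integer linear form x |-> sdet (x :: s). *)
Definition detform s : 'cV[int]_m := \col_j cofactor (seq_mx (0 :: s)) first_row j.

Lemma detformE x s : (x *m detform s) 0 0 = sdet (x :: s).
Proof.
rewrite /sdet (expand_det_row _ first_row) mxE; apply: eq_bigr => j _.
rewrite !mxE /=; congr (_ * (_ * \det _)); apply/matrixP=> i k; rewrite !mxE /=.
by case: (bump 0 i) (erefl (bump 0 i)).
Qed.

Lemma sdet_mem x s : x \in s -> (size s < m)%N -> sdet (x :: s) = 0.
Proof.
move=> xs ltsm; have ltim : ((index x s).+1 < m)%N.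
  by apply: leq_ltn_trans ltsm; rewrite index_mem.
apply: (determinant_alternate (i1 := first_row) (i2 := Ordinal ltim)) => // j.
by rewrite !mxE /= nth_index.
Qed.

Lemma sdet_short s : (size s < m)%N -> sdet s = 0.
Proof.
move=> lts; rewrite /sdet (expand_det_row _ (Ordinal lts)) big1 // => j _.
by rewrite !mxE /= nth_default // mxE mul0r.
Qed.

Lemma sdet_perm s s' : size s = m -> perm_eq s s' -> `|sdet s|%N = `|sdet s'|%N.
Proof.
move=> szs ps; have szs' : size s' == m by rewrite -(perm_size ps) szs.
have szs1 : size s == m by rewrite szs.
have /tuple_permP[p ep] : perm_eq s (Tuple szs') by [].
suff e : seq_mx s = row_perm p (seq_mx s').
  by rewrite /sdet e row_permE det_mulmx det_perm abszM abszX abszN absz1 exp1n mul1n.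
apply/matrixP=> i j; rewrite !mxE; congr (fun_of_matrix _ _ _).
rewrite ep -tnth_nth tnth_mktuple (tnth_nth 0) //.
Qed.

End RowSequences.

(** * Points off finitely many hyperplanes *)
Section Density.
Variables (R : realFieldType) (m : nat).
Implicit Types (P Q x : 'rV[R]_m) (f g h : 'cV[R]_m).

Definition dot f x : R := (x *m f) 0 0.

Lemma dotD f x y : dot f (x + y) = dot f x + dot f y.
Proof. by rewrite /dot mulmxDl mxE. Qed.

Lemma dotZ f a x : dot f (a *: x) = a * dot f x.
Proof. by rewrite /dot -scalemxAl mxE. Qed.

Lemma dotB f x y : dot f (x - y) = dot f x - dot f y.
Proof. by rewrite /dot mulmxBl !mxE. Qed.

Lemma dotZl a f x : dot (a *: f) x = a * dot f x.
Proof. by rewrite /dot -scalemxAr mxE. Qed.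

Lemma dotNl f x : dot (- f) x = - dot f x.
Proof. by rewrite -scaleN1r dotZl mulN1r. Qed.

Lemma dotBl f g x : dot (f - g) x = dot f x - dot g x.
Proof. by rewrite /dot mulmxBr !mxE. Qed.

Lemma dot_sum I (r : seq I) (p : pred I) f (F : I -> 'rV[R]_m) :
  dot f (\sum_(i <- r | p i) F i) = \sum_(i <- r | p i) dot f (F i).
Proof. by rewrite /dot mulmx_suml summxE. Qed.

Lemma dot_neq0 f : f != 0 -> exists x, dot f x != 0.
Proof.
move=> f0; have [i fi|fi] := @pickP _ (fun i => f i 0 != 0).
  by exists (delta_mx 0 i); rewrite /dot -rowE mxE.
by case/eqP: f0; apply/colP=> i; rewrite mxE; apply/eqP; rewrite -[_ == _]negbK fi.
Qed.

Lemma small_scale (I : eqType) (s : seq I) (a b : I -> R) : (forall i, i \in s -> 0 < a i) ->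
  exists2 e, 0 < e & forall i, i \in s -> 0 < a i + e * b i.
Proof.
elim: s => [|i s IH] a_gt0; first by exists 1.
have [|e e0 he] := IH; first by move=> j js; apply: a_gt0; rewrite inE js orbT.
have ai : 0 < a i by apply: a_gt0; rewrite mem_head.
have b1 : 0 < `|b i| + 1 by rewrite ltr_wpDl.
pose e1 := Num.min e (a i / (`|b i| + 1)).
have e1_gt0 : 0 < e1 by rewrite lt_min e0 divr_gt0.
exists e1 => // j; rewrite inE => /predU1P[->|js].
  have : e1 * (`|b i| + 1) <= a i by rewrite -ler_pdivlMr // ge_min lexx orbT.
  rewrite mulrDr mulr1; have := ler_norm (- (e1 * b i)).
  by rewrite normrN normrM (gtr0_norm e1_gt0); lra.
have aj : 0 < a j by apply: a_gt0; rewrite inE js orbT.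
have [bj|bj] := lerP 0 (b j); first by rewrite ltr_pwDl // mulr_ge0 // ltW.
apply: lt_le_trans (he j js) _; rewrite lerD2l ler_nM2r //.
by rewrite ge_min lexx.
Qed.

(** One form h at a time: if h vanishes at P, move P slightly in a direction where
    h does not, and then protect the sign of h as well. *)
Lemma perturb (hs gs : seq 'cV[R]_m) P :
  (forall g, g \in gs -> dot g P != 0) -> (forall h, h \in hs -> h != 0) ->
  exists P', (forall g, g \in gs -> 0 < dot g P * dot g P') /\
             (forall h, h \in hs -> dot h P' != 0).
Proof.
elim: hs gs P => [|h hs IH] gs P gP hN0.
  by exists P; split=> // g /gP gP0; rewrite -expr2 exprn_even_gt0.
have [P1 [gP1 hP1]] : exists P1, (forall g, g \in gs -> 0 < dot g P * dot g P1) /\ dot h P1 != 0.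
  have [hP|hP] := eqVneq (dot h P) 0; last first.
    by exists P; split=> // g /gP gP0; rewrite -expr2 exprn_even_gt0.
  have [x hx] := dot_neq0 (hN0 h (mem_head _ _)).
  have [g gs_|e e0 he] := @small_scale _ gs (fun g => dot g P ^+ 2) (fun g => dot g P * dot g x).
    by rewrite exprn_even_gt0 // gP.
  exists (P + e *: x); rewrite dotD dotZ hP add0r (mulf_neq0 (lt0r_neq0 e0) hx); split=> // g /he.
  by rewrite dotD dotZ mulrDr -expr2 mulrCA.
have [|h1 h1s|P' [gP' hP']] := IH (h :: gs) P1.
- move=> g; rewrite inE => /predU1P[->//|/gP1]; by rewrite lt0r mulf_eq0 negb_or => /andP[/andP[]].
- by apply: hN0; rewrite inE h1s orbT.
have hh := gP' h (mem_head _ _).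
exists P'; split=> [g gs_|h1]; last first.
  rewrite inE => /predU1P[->|/hP' //].
  by move: hh; rewrite lt0r mulf_eq0 negb_or => /andP[/andP[]].
have g1 := gP1 g gs_; have : 0 < dot g P1 * dot g P' by apply: gP'; rewrite inE gs_ orbT.
move=> g2; have := mulr_gt0 g1 g2.
have -> : dot g P * dot g P1 * (dot g P1 * dot g P') = (dot g P * dot g P') * dot g P1 ^+ 2 by ring.
by rewrite pmulr_lgt0 // exprn_even_gt0 //; apply: contraTneq g1 => ->; rewrite mulr0 ltxx.
Qed.

End Density.

(** * Wall crossing

    The vectors [u K] of the members K of a family and the vectors of [base]
    replace the evaluation map; the combinatorics of trees only enters through the
    hypothesis [balanced]. *)
Section WallCrossing.
Variables (R : realFieldType) (S : finType) (m : nat) (m_gt0 : (0 < m)%N).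
Variables (base : seq 'rV[int]_m) (u : S -> 'rV[int]_m) (fam : pred {set S}).
Implicit Types (F T : {set S}) (I J K : S) (X P Q : 'rV[R]_m).

Definition gens T := [seq u K | K <- enum T] ++ base.

Definition toR (x : 'rV[int]_m) : 'rV[R]_m := map_mx intr x.

Definition wallform T : 'cV[R]_m := map_mx intr (detform m_gt0 (gens T)).

Notation wallv T := (dot (wallform T)).
Notation split P Q T := (wallv T P * wallv T Q < 0).

Definition wall_det T J : int := sdet (u J :: gens T).

Definition nondeg F := fam F && (sdet (gens F) != 0).

(** The point X is the value of ev on the family F with lengths c and root
    position p. *)
Definition solves F (c : S -> R) (p : 'I_(size base) -> R) X :=
  X = \sum_(K in F) c K *: toR (u K) + \sum_k p k *: toR base`_k.

(** Cramer's rule for the length of I in the solution for X. *)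
Definition coord F I X := wallv (F :\ I) X / (wall_det (F :\ I) I)%:~R.

Definition contribution F X : nat := (`|sdet (gens F)|%N * [forall I in F, (0 < coord F I X)%R])%N.

Definition weighted_count X : nat := (\sum_(F | nondeg F) contribution F X)%N.

Hypothesis fam_size : forall F, fam F -> (#|F| + size base <= m)%N.

Lemma size_gens T : size (gens T) = (#|T| + size base)%N.
Proof. by rewrite size_cat size_map -cardE. Qed.

Lemma wallform_int T x : wallv T (toR x) = (sdet (x :: gens T))%:~R.
Proof. by rewrite /dot -map_mxM mxE detformE. Qed.

Lemma wallform_u T J : wallv T (toR (u J)) = (wall_det T J)%:~R.
Proof. exact: wallform_int. Qed.

Lemma wallform_gens T x : x \in gens T -> (#|T| + size base < m)%N ->
  wallv T (toR x) = 0.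
Proof.
by move=> xT szT; rewrite wallform_int sdet_mem // size_gens.
Qed.

Lemma mem_gens T K : K \in T -> u K \in gens T.
Proof. by move=> KT; rewrite mem_cat map_f // mem_enum. Qed.

Lemma nondeg_size F : nondeg F -> (#|F| + size base)%N = m.
Proof.
case/andP=> /fam_size le nd; apply/eqP; rewrite eqn_leq le leqNgt /=.
by apply: contra nd => lt; rewrite sdet_short // size_gens.
Qed.

Lemma abs_wall_det T J : J \notin T -> (#|J |: T| + size base)%N = m ->
  `|wall_det T J|%N = `|sdet (gens (J |: T))|%N.
Proof.
move=> JT sz; symmetry; apply: sdet_perm; first by rewrite size_gens.
rewrite /gens -cat_cons perm_cat2r -map_cons; apply: perm_map.
apply: uniq_perm; rewrite ?enum_uniq //= ?mem_enum ?JT ?enum_uniq //.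
by move=> K; rewrite inE !mem_enum !inE.
Qed.

Lemma nondeg_wall_det F I : nondeg F -> I \in F -> wall_det (F :\ I) I != 0.
Proof.
move=> nd IF; have /andP[_] := nd; rewrite -!absz_eq0 abs_wall_det ?setD1K //.
  by rewrite !inE eqxx.
exact: nondeg_size.
Qed.

Lemma card_wall F I : nondeg F -> I \in F -> (#|F :\ I| + size base < m)%N.
Proof.
move=> nd IF; apply: leq_trans (eq_leq (nondeg_size nd)).
by rewrite (cardsD1 I F) IF.
Qed.

Lemma dot_solves F I c p X : nondeg F -> I \in F -> solves F c p X ->
  wallv (F :\ I) X = c I * (wall_det (F :\ I) I)%:~R.
Proof.
move=> nd IF ->; have sz := card_wall nd IF.
rewrite dotD !dot_sum [X in _ + X]big1 ?addr0; last first.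
  move=> k _; rewrite dotZ wallform_gens ?mulr0 //.
  by rewrite mem_cat mem_nth ?orbT.
rewrite (bigD1 I) //= dotZ wallform_u big1 ?addr0 // => K /andP[KF neKI].
by rewrite dotZ wallform_gens ?mulr0 // mem_gens // !inE neKI.
Qed.

Lemma coordE F I c p X : nondeg F -> I \in F -> solves F c p X -> coord F I X = c I.
Proof.
move=> nd IF sX; rewrite /coord (dot_solves nd IF sX) mulfK //.
by rewrite intr_eq0 nondeg_wall_det.
Qed.

Definition row_entry (y : 'rV[R]_m) i : R := if insub i is Some k then y 0 k else 0.

Lemma mul_gens (y : 'rV[R]_m) T : (#|T| + size base)%N = m ->
  solves T (fun K => row_entry y (index K (enum T))) (fun k => row_entry y (#|T| + k))
    (y *m map_mx intr (seq_mx (gens T))).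
Proof.
move=> sz; rewrite /solves.
have -> : y *m map_mx intr (seq_mx (gens T)) = \sum_(0 <= i < m) row_entry y i *: toR (gens T)`_i.
  rewrite mulmx_sum_row big_mkord; apply: eq_bigr => i _.
  by rewrite /row_entry valK; congr (_ *: _); apply/rowP=> j; rewrite !mxE.
have leTm : (#|T| <= m)%N by apply: leq_trans (eq_leq sz); apply: leq_addr.
have em : (m - #|T|)%N = size base by rewrite -[X in (X - _)%N]sz addKn.
rewrite (@big_cat_nat _ _ _ #|T|) //=; congr (_ + _); last first.
  rewrite -{1}[#|T|]add0n big_addn em big_mkord; apply: eq_bigr => k _.
  by rewrite addnC nth_cat size_map -cardE ltnNge leq_addr /= addKn.
rewrite -big_enum /=; case: (pickP (fun K => K \in T)) => [K0 K0T|T0]; last first.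
  by rewrite (eq_card0 T0) big_geq // big1_seq // => K; rewrite mem_enum /= => KT; have := T0 K; rewrite /= KT.
rewrite (big_nth K0) -cardE; apply: eq_big_nat => i /andP[_ lti].
rewrite nth_cat size_map -cardE lti (nth_map K0) -?cardE //.
by rewrite index_uniq ?enum_uniq -?cardE.
Qed.

Lemma nondeg_solve F X : nondeg F -> exists c p, solves F c p X.
Proof.
move=> nd; have /andP[_ d0] := nd.
pose M : 'M[R]_m := map_mx intr (seq_mx (gens F)).
have uM : M \in unitmx by rewrite unitmxE det_map_mx unitfE intr_eq0.
by have := mul_gens (X *m invmx M) (nondeg_size nd); rewrite mulmxKV // => sX; do 2 eexists; apply: sX.
Qed.

Definition off_walls X := forall T, wallform T != 0 -> wallv T X != 0.

Lemma wallform_neq0 F I : nondeg F -> I \in F -> wallform (F :\ I) != 0.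
Proof.
move=> nd IF; apply: contraTneq (nondeg_wall_det nd IF) => e.
by move: (wallform_u (F :\ I) I); rewrite e /dot mulmx0 mxE negbK => /esym/eqP; rewrite intr_eq0.
Qed.

(** A family with a chosen member is a wall together with one of the sets that
    complete it. *)
Lemma sum_walls (V : nmodType) (g : {set S} -> S -> V) :
  \sum_(F : {set S}) \sum_(I in F) g (F :\ I) I =
  \sum_(T : {set S}) \sum_(J : S | J \notin T) g T J.
Proof.
rewrite !pair_big_dep /= (reindex_onto (fun p => (p.2 |: p.1, p.2)) (fun p => (p.1 :\ p.2, p.2))) /=.
  apply: eq_big => [[T J]|[T J] /andP[_ /eqP e]] /=; last by case: e => ->.
  rewrite setU11 /= xpair_eqE eqxx andbT; apply/eqP/idP=> [<-|JT].
    by rewrite !inE eqxx.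
  by rewrite setU1K.
by move=> [F I] /= IF; rewrite setD1K.
Qed.

Hypothesis balanced : forall F I, nondeg F -> I \in F ->
  \sum_(J | (J \notin F :\ I) && fam (J |: F :\ I)) wall_det (F :\ I) J = 0.

Section Crossing.
(** All walls separating P from Q are the same hyperplane, which the segment meets
    at the point X. *)
Variables (P Q : 'rV[R]_m) (t : R).
Let X := P + t *: (Q - P).
Let splits T := split P Q T.
Hypotheses (gP : off_walls P) (gQ : off_walls Q) (t01 : 0 < t < 1).
Hypothesis splitsX : forall T, splits T -> wallv T X = 0.
Hypothesis splits_prop : forall T T', splits T -> splits T' ->
  forall x, wallv T x = 0 -> wallv T' x = 0.

Let dotX T : wallv T X =
  (1 - t) * wallv T P + t * wallv T Q.
Proof. by rewrite /X dotD dotZ dotB; ring. Qed.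

Let nsplits T : wallform T != 0 -> ~~ splits T ->
  0 < wallv T P * wallv T X /\
  0 < wallv T Q * wallv T X.
Proof.
move=> T0; rewrite /splits -leNgt => pq.
have {}pq : 0 < wallv T P * wallv T Q.
  by rewrite lt_def pq mulf_neq0 ?gP ?gQ.
have p2 : 0 < wallv T P ^+ 2 by rewrite exprn_even_gt0 ?gP.
have q2 : 0 < wallv T Q ^+ 2 by rewrite exprn_even_gt0 ?gQ.
case/andP: t01 => t0 t1; rewrite dotX.
by split; move: p2 q2 pq t0 t1; set p := dot _ P; set q := dot _ Q; nra.
Qed.

Let coord_sign F I : nondeg F -> I \in F -> ~~ splits (F :\ I) ->
  (0 < coord F I P) = (0 < coord F I X) /\ (0 < coord F I Q) = (0 < coord F I X).
Proof.
move=> nd IF ns; have [hp hq] := nsplits (wallform_neq0 nd IF) ns.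
have w0 : (wall_det (F :\ I) I)%:~R != 0 :> R by rewrite intr_eq0 nondeg_wall_det.
have key (a b c : R) : c != 0 -> 0 < a * b -> (0 < a / c) = (0 < b / c) :> bool.
  move=> c0 ab; have : 0 < (a / c) * (b / c).
    have c2 : 0 < c^-1 ^+ 2 by rewrite exprn_even_gt0 ?invr_eq0.
    by rewrite mulrACA -expr2 mulr_gt0.
  by move=> h; apply/idP/idP => k; move: h; rewrite ?(pmulr_rgt0 _ k) ?(pmulr_lgt0 _ k).
by rewrite /coord !(key _ _ _ w0 hp) !(key _ _ _ w0 hq).
Qed.

Let coordX_split F I : splits (F :\ I) -> coord F I X = 0.
Proof. by move=> /splitsX e; rewrite /coord e mul0r. Qed.

(** For a nondegenerate family the hyperplanes opposite to two different members
    are different, so only one length changes its sign. *)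
Let splits_uniq F I K : nondeg F -> I \in F -> K \in F -> K != I ->
  splits (F :\ I) -> ~~ splits (F :\ K).
Proof.
move=> nd IF KF neKI sI; apply/negP=> sK.
have : wallv (F :\ K) (toR (u I)) = 0.
  apply: wallform_gens; last exact: card_wall.
  by apply: mem_gens; rewrite !inE eq_sym neKI.
move=> /(splits_prop sK sI)/eqP; rewrite wallform_u intr_eq0.
by apply/negP/nondeg_wall_det.
Qed.

Let crosses F I := (coord F I X == 0) && [forall K in F :\ I, 0 < coord F K X].

Let jump T J : int := if nondeg (J |: T) && crosses (J |: T) J
  then `|wall_det T J| * ((0 < coord (J |: T) J P)%R%:Z - (0 < coord (J |: T) J Q)%R%:Z) else 0.

Let jumpE F I : nondeg F -> I \in F -> jump (F :\ I) I = if crosses F I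
  then `|sdet (gens F)|%N%:Z * ((0 < coord F I P)%R%:Z - (0 < coord F I Q)%R%:Z) else 0.
Proof.
move=> nd IF; rewrite /jump setD1K // nd /= -abszE abs_wall_det ?setD1K //.
  by rewrite !inE eqxx.
exact: nondeg_size.
Qed.

Let contribution_same F Y Z : nondeg F -> (forall I, I \in F -> ~~ crosses F I) ->
  (forall I, I \in F -> ~~ splits (F :\ I) ->
     (0 < coord F I Y) = (0 < coord F I X) /\ (0 < coord F I Z) = (0 < coord F I X)) ->
  [forall I in F, 0 < coord F I Y] -> [forall I in F, 0 < coord F I Z].
Proof.
move=> nd nc sgn /forall_inP posY; apply/forall_inP=> I IF.
have [sI|nsI] := boolP (splits (F :\ I)); last first.
  by have [e1 e2] := sgn I IF nsI; rewrite e2 -e1 posY.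
case/negP: (nc I IF); rewrite /crosses coordX_split // eqxx.
apply/forall_inP=> K; rewrite !inE => /andP[neKI KF].
by have [<- _] := sgn K KF (splits_uniq nd IF KF neKI sI); apply: posY.
Qed.

Let contribution_jump F : nondeg F ->
  (contribution F P)%:Z - (contribution F Q)%:Z = \sum_(I in F) jump (F :\ I) I.
Proof.
move=> nd; rewrite (eq_bigr _ (fun I => @jumpE F I nd)).
have [/exists_inP[I IF cI]|nc] := boolP [exists I in F, crosses F I]; last first.
  rewrite negb_exists_in in nc; move/forall_inP: nc => nc.
  rewrite big1 => [|I IF]; last by rewrite (negPf (nc I IF)).
  rewrite /contribution; suff -> : [forall I in F, 0 < coord F I P] = [forall I in F, 0 < coord F I Q].
    by rewrite subrr.
  apply/idP/idP; apply: contribution_same => // I IF ns; first exact: coord_sign.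
  by have [] := coord_sign nd IF ns.
have /andP[/eqP cI0 /forall_inP pos] := cI.
rewrite (bigD1 I) //= cI big1 ?addr0 => [|K /andP[KF neKI]]; last first.
  case: ifP => // /andP[_ /forall_inP/(_ I)].
  by rewrite cI0 ltxx !inE eq_sym neKI IF => /(_ isT).
have forallE Y : (forall K, K \in F -> ~~ splits (F :\ K) ->
    (0 < coord F K Y) = (0 < coord F K X)) ->
    [forall K in F, 0 < coord F K Y] = (0 < coord F I Y).
  move=> sgn; apply/forall_inP/idP=> [/(_ I IF) //|pI K KF].
  have [->//|neKI] := eqVneq K I; have pK : 0 < coord F K X by apply: pos; rewrite !inE neKI.
  rewrite sgn //; apply: contraTN pK => /coordX_split->; by rewrite ltxx.
rewrite /contribution !forallE => [||K KF ns]; last 2 first.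
- by move=> K KF ns; have [_ ->] := coord_sign nd KF ns.
- by have [-> _] := coord_sign nd KF ns.
by rewrite !PoszM mulrBr.
Qed.

(** On the wall all completions have the same solution, that of T, whence positivity
    of the remaining lengths does not depend on the completion. *)
Let crosses_wall_det T J J' : J \notin T -> nondeg (J |: T) -> crosses (J |: T) J ->
    J' \notin T -> fam (J' |: T) ->
  nondeg (J' |: T) && crosses (J' |: T) J' = (wall_det T J' != 0).
Proof.
move=> JT nd /andP[/eqP c0 /forall_inP pos] J'T fJ'.
have szJ := nondeg_size nd.
have szJ' : (#|J' |: T| + size base)%N = m by rewrite -[RHS]szJ !cardsU1 JT J'T.
have ndE : nondeg (J' |: T) = (wall_det T J' != 0).
  by rewrite /nondeg fJ' -!absz_eq0 abs_wall_det.
rewrite ndE; have [//|w0] := eqVneq; rewrite /=; have nd' : nondeg (J' |: T) by rewrite ndE.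
have [c [p sX]] := nondeg_solve X nd.
have cE K : K \in J |: T -> coord (J |: T) K X = c K by move=> KT; apply: coordE sX.
have cJ : c J = 0 by rewrite -cE ?setU11.
(* The coefficient of J vanishes, so J can be exchanged for J' with coefficient 0. *)
pose c' K := if K == J' then 0 else c K.
have sX' : solves (J' |: T) c' p X.
  rewrite /solves big_setU1 //= {1}/c' eqxx scale0r add0r [LHS]sX big_setU1 //= cJ scale0r add0r.
  congr (_ + _); apply: eq_bigr => K KT; rewrite /c'.
  by case: eqP KT J'T => // -> ->.
have c'E K : K \in J' |: T -> coord (J' |: T) K X = c' K by move=> KT; apply: coordE sX'.
rewrite /crosses c'E ?setU11 // {1}/c' eqxx eqxx; apply/forall_inP=> K.
rewrite !inE => /andP[neKJ']; rewrite (negPf neKJ') /= => KT.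
rewrite c'E ?inE ?KT ?orbT // /c' (negPf neKJ') -cE ?inE ?KT ?orbT //.
by apply: pos; rewrite !inE KT orbT andbT; apply: contraNneq JT => <-.
Qed.

Let bdiff : (true%:Z - false%:Z = 1) * (false%:Z - true%:Z = -1).
Proof. by []. Qed.

(** The length of J in the completion of T by J is f_T / det (u_J, T) for the form
    f_T of the wall.  So J contributes |det| times the change of sign of f_T / det
    from Q to P, which is det up to a sign common to all J. *)
Let sum_jump T : \sum_(J | J \notin T) jump T J = 0.
Proof.
have [/existsP[J /and3P[JT nd cr]]|none] :=
  boolP [exists J, [&& J \notin T, nondeg (J |: T) & crosses (J |: T) J]]; last first.
  apply: big1 => J JT; rewrite /jump; case: ifP => // /andP[nd cr].
  by case/existsP: none; exists J; rewrite JT nd cr.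
have TE : (J |: T) :\ J = T by rewrite setU1K.
have T0 : wallform T != 0 by rewrite -TE; apply: wallform_neq0; rewrite ?setU11.
have X0 : wallv T X = 0.
  have /andP[/eqP + _] := cr; rewrite /coord TE => /eqP.
  rewrite mulf_eq0 invr_eq0 intr_eq0 => /orP[/eqP//|].
  by have := nondeg_wall_det nd (setU11 _ _); rewrite TE => /negPf->.
have spl : splits T.
  apply: contraTT isT => /(nsplits T0)[]; by rewrite X0 mulr0 ltxx.
have : \sum_(J' | J' \notin T) jump T J' =
    (if 0 < wallv T P then 1 else -1) *
    \sum_(J' | (J' \notin T) && fam (J' |: T)) wall_det T J'.
  rewrite mulr_sumr [RHS]big_mkcondr; apply: eq_bigr => J' J'T.
  case: ifP => [fJ'|/negP nfJ']; last first.
    by rewrite /jump; case: ifP => // /andP[/andP[]].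
  rewrite /jump (crosses_wall_det JT nd cr) // /coord setU1K //.
  case: eqVneq => [->|w0]; first by rewrite mulr0.
  move: spl; rewrite /splits /=.
  set p := dot _ P; set q := dot _ Q => pq.
  have [[p0 q0]|[p0 q0]] : (0 < p /\ q < 0) \/ (p < 0 /\ 0 < q).
    case: (ltrgtP p 0) pq => [p0|p0|->]; last by rewrite mul0r ltxx.
      by rewrite nmulr_rlt0 //; right.
    by rewrite pmulr_rlt0 //; left.
    have [w_gt0|w_lt0] : 0 < wall_det T J' \/ wall_det T J' < 0 by apply/orP; rewrite orbC -neq_lt.
      by rewrite (gtr0_norm w_gt0) !pmulr_lgt0 ?invr_gt0 ?ltr0z // p0 (lt_gtF q0) !bdiff; ring.
    by rewrite (ltr0_norm w_lt0) !nmulr_lgt0 ?invr_lt0 ?ltrz0 // q0 p0 (lt_gtF p0) !bdiff; ring.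
  have [w_gt0|w_lt0] : 0 < wall_det T J' \/ wall_det T J' < 0 by apply/orP; rewrite orbC -neq_lt.
    by rewrite (gtr0_norm w_gt0) !pmulr_lgt0 ?invr_gt0 ?ltr0z // q0 (lt_gtF p0) !bdiff; ring.
  by rewrite (ltr0_norm w_lt0) !nmulr_lgt0 ?invr_lt0 ?ltrz0 // p0 (lt_gtF q0) (lt_gtF p0) !bdiff; ring.
move=> ->; have := balanced nd (setU11 _ _); rewrite TE => ->.
by rewrite mulr0.
Qed.

Lemma weighted_count_crossing : weighted_count P = weighted_count Q.
Proof.
apply/eqP; rewrite -eqz_nat /weighted_count -subr_eq0 !(big_morph _ PoszD (erefl _)) -sumrB.
rewrite (eq_bigr _ contribution_jump) big_mkcond /=.
rewrite (eq_bigr (fun F => \sum_(I in F) jump (F :\ I) I)) => [|F _]; last first.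
  case: ifP => // /negbT nd; rewrite big1 // => I IF; rewrite /jump setD1K //.
  by rewrite (negPf nd).
by rewrite sum_walls big1 // => T _; apply: sum_jump.
Qed.

End Crossing.

(** The segment from P to Q meets walls with different hyperplanes at different
    points. *)
Definition generic P Q := forall T T',
  wallv T' Q *: wallform T != wallv T Q *: wallform T' ->
  wallv T P * wallv T' Q != wallv T' P * wallv T Q.

(** Induction on the number of separating walls: stop at a point P2 shortly after
    the first wall met on the way from P to Q. *)
Lemma weighted_count_generic P Q : off_walls P -> off_walls Q -> generic P Q -> weighted_count P = weighted_count Q.
Proof.
pose D P Q := [set T | split P Q T]%SET.
have [n] := ubnP #|D P Q|; elim: n P => // n IH P; rewrite ltnS => leDn gP gQ gen.
have [D0|[T1 T1D]] := set_0Vmem (D P Q).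
  have nD T : split P Q T -> False.
    by move=> h; have := in_set0 T; rewrite -D0 inE h.
  (* No wall separates P and Q, so any point of the segment will do. *)
  apply: (@weighted_count_crossing P Q 2^-1) => //.
  - by apply/andP; split; lra.
  - by move=> T /nD.
  - by move=> T T' /nD.
(* The parameter at which the segment from P to Q meets the wall of T. *)
pose tau T := wallv T P / (wallv T P - wallv T Q).
have tauE T s : split P Q T ->
    wallv T (P + s *: (Q - P)) =
    (wallv T P - wallv T Q) * (tau T - s).
  move=> pq; rewrite dotD dotZ dotB [RHS]mulrBr /tau [in RHS]mulrCA mulfV ?mulr1; first by ring.
  by apply: contraTneq pq => /subr0_eq ->; rewrite -leNgt sqr_ge0.
have [T0 T0D minT0] := @arg_minP _ _ _ T1 (fun T => T \in D P Q) tau T1D.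
have tau01 T : split P Q T -> 0 < tau T < 1.
  rewrite /tau; set p := dot _ P; set q := dot _ Q => pq.
  case: (ltrgtP p 0) pq => [p0|p0|->]; last by rewrite mul0r ltxx.
    rewrite nmulr_rlt0 // => q0; have pq : p - q < 0 by rewrite subr_lt0 (lt_trans p0).
    by rewrite nmulr_lgt0 ?invr_lt0 // p0 ltr_ndivrMr // mul1r; move: q0; lra.
  rewrite pmulr_rlt0 // => q0; have pq : 0 < p - q by rewrite subr_gt0 (lt_trans q0).
  by rewrite divr_gt0 //= ltr_pdivrMr // mul1r; move: q0; lra.
set t0 := tau T0 in minT0.
have /andP[t0_gt0 t0_lt1] : 0 < t0 < 1 by apply: tau01; move: T0D; rewrite inE.
have [x|e e0 he] := @small_scale R _ (1 - t0 :: [seq tau T - t0 | T <- enum [set T | t0 < tau T]%SET])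
  id (fun _ => -1).
  rewrite inE => /predU1P[->|/mapP[T]]; first by rewrite subr_gt0.
  by rewrite mem_enum inE => + ->; rewrite subr_gt0.
(* Just after the first wall, before the next one. *)
pose t1 := t0 + e; pose P2 := P + t1 *: (Q - P).
have t01 : t0 < t1 by rewrite /t1 ltrDl.
have t1_lt1 : t1 < 1 by have := he _ (mem_head _ _); rewrite /t1; lra.
have t1_gt0 : 0 < t1 by apply: lt_trans t01.
have tauD T : split P Q T -> tau T = t0 \/ t1 < tau T.
  move=> TD; have : t0 <= tau T by apply: minT0; rewrite inE.
  rewrite le_eqVlt => /predU1P[->|tT]; [by left|right].
  have /he : tau T - t0 \in 1 - t0 :: [seq tau T - t0 | T <- enum [set T | t0 < tau T]%SET].
    by rewrite inE (map_f (fun T => tau T - t0)) ?orbT // mem_enum inE.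
  by rewrite /t1 /=; lra.
have dP2 T : wallv T P2 = (1 - t1) * wallv T P + t1 * wallv T Q.
  by rewrite /P2 dotD dotZ dotB; ring.
have D_pos T : ~~ (split P Q T) ->
    0 <= wallv T P * wallv T P2 /\ 0 <= wallv T P2 * wallv T Q.
  rewrite -leNgt dP2; set p := dot _ P; set q := dot _ Q => pq.
  have -> : p * ((1 - t1) * p + t1 * q) = (1 - t1) * p ^+ 2 + t1 * (p * q) by ring.
  have -> : ((1 - t1) * p + t1 * q) * q = (1 - t1) * (p * q) + t1 * q ^+ 2 by ring.
  by split; rewrite addr_ge0 // mulr_ge0 ?sqr_ge0 ?subr_ge0 // ltW.
have pq_neq T : split P Q T ->
    wallv T P - wallv T Q != 0.
  by apply: contraTneq => /subr0_eq ->; rewrite -leNgt sqr_ge0.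
have gP2 : off_walls P2.
  move=> T wT; have [TD|nTD] := boolP (split P Q T).
    rewrite tauE // mulf_neq0 ?pq_neq // subr_eq0.
    by case: (tauD T TD) => [->|]; [rewrite lt_eqF|move=> h; rewrite gt_eqF].
  move: nTD; rewrite dP2 -leNgt; have := gP T wT; have := gQ T wT.
  set p := dot _ P; set q := dot _ Q => q0 p0 pq.
  have {}pq : 0 < p * q by rewrite lt_def pq mulf_neq0.
  have h : 0 < p * ((1 - t1) * p + t1 * q).
    have -> : p * ((1 - t1) * p + t1 * q) = (1 - t1) * p ^+ 2 + t1 * (p * q) by ring.
    by rewrite addr_gt0 // mulr_gt0 ?subr_gt0 ?exprn_even_gt0.
  by apply: contraTneq h => ->; rewrite mulr0 ltxx.
have D1 T : split P P2 T ->
    split P Q T /\ tau T = t0.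
  move=> TD1; have TD : split P Q T.
    by apply: contraTT TD1 => /D_pos[]; rewrite leNgt.
  split=> //; case: (tauD T TD) => // lt; move: TD1; rewrite tauE //.
  have pp : 0 < wallv T P * (wallv T P - wallv T Q).
    by rewrite mulrBr -expr2 subr_gt0 (lt_le_trans TD) // sqr_ge0.
  by rewrite mulrA pmulr_rlt0 // subr_lt0 ltNge ltW.
transitivity (weighted_count P2).
  have tq : t0 / t1 *: (P2 - P) = t0 *: (Q - P).
    by rewrite /P2 addrAC subrr add0r scalerA divfK // gt_eqF.
  apply: (@weighted_count_crossing P P2 (t0 / t1)) => //.
  - by rewrite divr_gt0 // ltr_pdivrMr // mul1r.
  - by move=> T /D1[TD eT]; rewrite tq tauE // eT subrr mulr0.
  move=> T T' /D1[TD eT] /D1[TD' eT'] x Tx.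
  have /eqP e1 : wallv T P * wallv T' Q == wallv T' P * wallv T Q.
    have := eT; rewrite -eT' /tau => /eqP; rewrite eqr_div ?pq_neq //.
    move=> /eqP; rewrite !mulrBr (mulrC (dot _ P) (dot _ P)) => /addrI/oppr_inj e1.
    by rewrite e1.
  have : wallv T' Q *: wallform T == wallv T Q *: wallform T'.
    by apply: contra_eqT e1 => /gen.
  move=> /eqP/(congr1 (fun f => dot f x)); rewrite !dotZl Tx mulr0 => /esym/eqP; rewrite mulf_eq0 => /orP[/eqP Q0|/eqP//].
  by move: TD; rewrite Q0 mulr0 ltxx.
apply: IH => //.
- apply: leq_trans leDn; apply: proper_card; apply/properP; split.
    apply/subsetP=> T; rewrite !inE; apply: contraTT => /D_pos[_].
    by rewrite leNgt.
  exists T0 => //; have TD : wallv T0 P * wallv T0 Q < 0 by move: T0D; rewrite inE.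
  rewrite inE tauE // -/t0 -leNgt.
  rewrite mulrAC mulr_le0 // ?subr_le0 ?ltW //.
  by rewrite mulrBl -expr2 subr_lt0 (lt_le_trans TD) // sqr_ge0.
- move=> T T' /gen; apply: contra_neq => e1.
  have t1n : 1 - t1 != 0 by rewrite subr_eq0 gt_eqF.
  apply: (mulfI t1n); move: e1; rewrite !dP2.
  set p := dot _ P; set q := dot _ Q; set p' := dot _ P; set q' := dot _ Q => e1.
  have -> : (1 - t1) * (p * q') = ((1 - t1) * p + t1 * q) * q' - t1 * q * q' by ring.
  by rewrite e1; ring.
Qed.

(** P can be made generic with respect to Q without crossing a wall: being generic
    means that P avoids the hyperplanes f_T'(Q) f_T - f_T(Q) f_T' = 0. *)
Lemma weighted_count_const P Q : off_walls P -> off_walls Q -> weighted_count P = weighted_count Q.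
Proof.
move=> gP gQ.
pose gs := [seq wallform T | T <- enum {set S} & wallform T != 0].
pose h T T' := wallv T' Q *: wallform T - wallv T Q *: wallform T'.
pose hs := [seq f <- [seq h T T' | T <- enum {set S}, T' <- enum {set S}] | f != 0].
have [g|f|P' [gP' hP']] := @perturb R m hs gs P.
- by case/mapP=> T; rewrite mem_filter => /andP[T0 _] ->; apply: gP.
- by rewrite mem_filter => /andP[].
have sgP T : wallform T != 0 -> 0 < wallv T P * wallv T P'.
  by move=> T0; apply: gP'; apply: map_f; rewrite mem_filter T0 mem_enum.
have gdP' : off_walls P'.
  by move=> T /sgP; rewrite lt0r mulf_eq0 negb_or => /andP[/andP[]].
transitivity (weighted_count P').
  have nD T : split P P' T -> False.
    have [e|/sgP/lt_gtF->//] := eqVneq (wallform T) 0.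
    by rewrite e /dot !mulmx0 mxE mul0r ltxx.
  apply: (@weighted_count_crossing P P' 2^-1) => //.
  - by apply/andP; split; lra.
  - by move=> T /nD.
  - by move=> T T' /nD.
apply: weighted_count_generic => // T T' ne.
have /hP' : h T T' \in hs.
  rewrite mem_filter subr_eq0 ne; apply/allpairsP; exists (T, T').
  by rewrite !mem_enum.
rewrite /h dotBl !dotZl subr_eq0; apply: contra_neq.
by rewrite mulrC => ->; rewrite mulrC.
Qed.

End WallCrossing.

(** * Edges of a tree as separations of its vertices *)
Section Trees.
Local Open Scope set_scope.
Variables (N : nat) (T : mgraph N) (treeT : is_tree T) (rho : vert T).
Implicit Types (E : {set vert T}) (W a b c : vert T).

Definition joined E : rel (vert T) := [rel a b | ([set a; b] \in edges T :\ E)].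

(** Removing E disconnects the tree; W is far if E separates it from the root
    [rho]. *)
Definition far E W := ~~ connect (joined E) rho W.

Lemma edge_card E : E \in edges T -> #|E| = 2%N.
Proof. by case: treeT => h _ _ _; apply: h. Qed.

Lemma edge_neq a b : [set a; b] \in edges T -> a != b.
Proof. by move=> /edge_card; rewrite cards2; case: (a != b). Qed.

Lemma edgeP E : E \in edges T -> exists a b, a != b /\ E = [set a; b].
Proof. by move=> /edge_card/eqP/cards2P[a [b [ne ->]]]; exists a, b. Qed.

Lemma set2C (S : finType) (a b : S) : [set a; b] = [set b; a].
Proof. exact: setUC. Qed.

Lemma joined_sym E : symmetric (joined E).
Proof. by move=> a b; rewrite /joined /= set2C. Qed.

Lemma joinedC E a b : connect (joined E) a b = connect (joined E) b a.
Proof. exact: sym_connect_sym (joined_sym E) a b. Qed.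

Lemma const_along_edges (S : eqType) (f : vert T -> S) :
  (forall a b, [set a; b] \in edges T -> f a = f b) -> forall a b, f a = f b.
Proof.
move=> fE a b; case: treeT => _ /(_ a b)/connectP[p + ->] _ _.
by elim: p a => //= c p IH a /andP[/fE-> /IH].
Qed.

Lemma far_root E : far E rho = false.
Proof. by rewrite /far connect0. Qed.

Lemma far_same E a b : [set a; b] \in edges T -> [set a; b] != E -> far E a = far E b.
Proof.
move=> ab ne; have jab : joined E a b by rewrite /joined /= in_setD1 ne ab.
congr negb; apply/idP/idP=> h; apply: connect_trans h (connect1 _) => //.
by rewrite joined_sym.
Qed.

(** A detour from a to b would close up with the edge to a cycle. *)
Lemma bridge a b : [set a; b] \in edges T -> ~~ connect (joined [set a; b]) a b.
Proof.
move=> ab; apply/negP=> /connectP[p0 pp0 eb]; have ne := edge_neq ab.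
have [p [pp up eb']] : exists p, [/\ path (joined [set a; b]) a p, uniq (a :: p) & b = last a p].
  by case/shortenP: pp0 eb => p pp up _ eb; exists p.
case: treeT => _ _ /(_ (a :: p)) cyc _.
have {cyc} : (size (a :: p) < 3)%N.
  apply: cyc; rewrite /ucycle up andbT /cycle rcons_path; apply/andP; split.
    by apply: sub_path pp => x y; rewrite /joined /= in_setD1 => /andP[].
  by rewrite /adj /= -eb' set2C.
case: p pp eb' {up} => [|c [|//]] /=; first by move=> _ e; rewrite e eqxx in ne.
by rewrite /joined /= => + e; rewrite -e in_setD1 eqxx.
Qed.

Lemma far_diff a b : [set a; b] \in edges T ->
  far [set a; b] a = ~~ far [set a; b] b.
Proof.
set E := [set a; b] => Eab; rewrite /far negbK.
have [ca|nca] := boolP (connect (joined E) rho a); rewrite /=.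
  symmetry; apply/negP=> cb; case/negP: (bridge Eab).
  by apply: connect_trans cb; rewrite joinedC.
symmetry; apply/negPn/negP=> ncb; case/negP: (nca).
have nc W : W \in E -> connect (joined E) rho W = false.
  by rewrite !inE => /orP[] /eqP->; apply/negbTE.
suff -> : connect (joined E) rho a = connect (joined E) rho rho by exact: connect0.
apply: (const_along_edges (f := connect (joined E) rho)) => x y xy.
have [exy|ne] := eqVneq [set x; y] E; last exact: negb_inj (far_same xy ne).
by rewrite !nc // -exy !inE eqxx ?orbT.
Qed.

Lemma far_xor E a b : [set a; b] \in edges T ->
  far E a (+) far E b = ([set a; b] == E).
Proof.
move=> ab; have [<-|ne] := eqVneq [set a; b] E; first by rewrite far_diff // addNb addbb.
by rewrite (far_same ab ne) addbb.
Qed.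

(** Since the graph is connected, a function is determined by its value at the root
    and its changes along edges.  This is how [far] is computed in all examples. *)
Lemma far_unique E (chi : vert T -> bool) : chi rho = false ->
  (forall a b, [set a; b] \in edges T -> chi a (+) chi b = ([set a; b] == E)) ->
  far E =1 chi.
Proof.
move=> chi0 chiE W.
have : far E W (+) chi W = far E rho (+) chi rho.
  apply: (const_along_edges (f := fun W => far E W (+) chi W)) => a b ab.
  have := far_xor E ab; rewrite -(chiE a b ab).
  by case: (far E a) (far E b) (chi a) (chi b) => [] [] [] [].
by rewrite far_root chi0; case: (far E W) (chi W) => [] [].
Qed.

Definition path_edges a (p : seq (vert T)) := pairmap (fun u w => [set u; w]) a p.

Lemma path_edges_mem a p E : E \in path_edges a p -> forall x, x \in E -> x \in a :: p.
Proof.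
elim: p a => //= b p IH a; rewrite inE => /predU1P[-> x|/IH h x /h xb].
  by rewrite in_set2 => /orP[] /eqP->; rewrite !inE eqxx ?orbT.
by rewrite inE xb orbT.
Qed.

Lemma path_edges_uniq a p : uniq (a :: p) -> uniq (path_edges a p).
Proof.
elim: p a => //= b p IH a /andP[nab /[dup] ub /IH ->]; rewrite andbT.
apply: contra nab => /path_edges_mem; apply; by rewrite !inE eqxx.
Qed.

(** A simple path uses E exactly if E separates its ends; each edge of the path
    switches one of the indicators [far E]. *)
Lemma far_path E a p : E \in edges T -> path (adj (T := T)) a p -> uniq (a :: p) ->
  (E \in path_edges a p) = far E a (+) far E (last a p).
Proof.
move=> EE; elim: p a => [|b p IH] a /=; first by rewrite addbb.
case/andP=> ab pp /andP[nab ub]; rewrite inE IH // eq_sym -(far_xor E ab).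
have : ~~ ((E == [set a; b]) && (E \in path_edges b p)).
  apply/negP=> /andP[/eqP-> /path_edges_mem h]; case/negP: nab; apply: h.
  by rewrite !inE eqxx.
rewrite IH // eq_sym -(far_xor E ab).
by case: (far E a) (far E b) (far E (last b p)) => [] [] [].
Qed.

Lemma path_edges_sub a p E : path (adj (T := T)) a p -> E \in path_edges a p -> E \in edges T.
Proof.
by elim: p a => //= b p IH a /andP[ab pp]; rewrite inE => /predU1P[->|/(IH _ pp)].
Qed.

Lemma simple_path a b : exists p, [/\ path (adj (T := T)) a p, last a p = b & uniq (a :: p)].
Proof.
case: treeT => _ /(_ a b)/connectP[p pp eb] _ _.
by case/shortenP: pp eb => p' pp up _ eb; exists p'.
Qed.

Lemma path_length_far (R : realType) (l : {set vert T} -> R) a p :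
  path (adj (T := T)) a p -> uniq (a :: p) ->
  path_length l a p = \sum_(E in edges T | far E a (+) far E (last a p)) l E.
Proof.
move=> pp up; rewrite /path_length -/(path_edges a p) big_uniq ?path_edges_uniq //=.
apply: eq_bigl => E; have [EE|nE] := boolP (E \in edges T); first by rewrite far_path.
by apply: contraNF nE; apply: path_edges_sub.
Qed.

Lemma tree_path_length (R : realType) (l : {set vert T} -> R) a b :
  path_length l a (tree_path a b) = \sum_(E in edges T | far E a (+) far E b) l E.
Proof.
have [pp eb up] := xgetPex [::] (simple_path a b).
by rewrite path_length_far // eb.
Qed.

Lemma far_inj a b : (forall E, E \in edges T -> far E a = far E b) -> a = b.
Proof.
move=> eqab; have [[|c p] [pp eb up]] := simple_path a b; first by [].
have := far_path (E := [set a; c]) _ pp up; rewrite eb /= inE eqxx /=.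
by case/andP: pp => ac _ /(_ ac); rewrite eqab // addbb.
Qed.

(** The simple path from a to b contains only E. *)
Lemma edge_far E a b : E \in edges T ->
  (forall E', E' \in edges T -> far E' a (+) far E' b = (E' == E)) -> [set a; b] = E.
Proof.
move=> EE eqab; have [p [pp eb up]] := simple_path a b.
have memE E' : E' \in path_edges a p -> E' = E.
  move=> E'p; apply/eqP; have E'E := path_edges_sub pp E'p.
  by rewrite -(eqab _ E'E) -eb -far_path.
have : E \in path_edges a p by rewrite far_path // eb eqab // eqxx.
case: p pp eb up memE => [|c [|d p]] //= _ eb; first by move=> _ _; rewrite -eb inE => /eqP.
move=> up memE _.
have e1 : [set a; c] = E by apply: memE; rewrite inE eqxx.
have e2 : [set c; d] = E by apply: memE; rewrite !inE eqxx orbT.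
by have := path_edges_uniq up; rewrite /= e1 e2 inE eqxx.
Qed.

Lemma far_on_edge E E' a b : E \in edges T -> E != E' -> a \in E -> b \in E -> far E' a = far E' b.
Proof.
move=> EE neE; have [x [y [_ eE]]] := edgeP EE.
have e : far E' x = far E' y by apply: far_same; rewrite -eE.
by rewrite eE !in_set2 => /orP[] /eqP-> /orP[] /eqP->.
Qed.

Lemma far_bottom E : E \in edges T -> exists2 W, W \in E & far E W.
Proof.
move=> EE; have [x [y [_ eE]]] := edgeP EE.
have := far_xor E (a := x) (b := y); rewrite -eE EE eqxx => /(_ isT).
have [fx _|_ fy] := boolP (far E x); first by exists x; rewrite // eE !inE eqxx.
by exists y; rewrite // eE !inE eqxx orbT.
Qed.

Lemma far_top E : E \in edges T -> exists2 W, W \in E & ~~ far E W.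
Proof.
move=> EE; have [x [y [_ eE]]] := edgeP EE.
have := far_xor E (a := x) (b := y); rewrite -eE EE eqxx => /(_ isT).
have [_ /= fy|fx _] := boolP (far E x); last by exists x; rewrite // eE !inE eqxx.
by exists y; rewrite // eE !inE eqxx orbT.
Qed.

(** The pair ([far E], [far E']) can only change along E and E'; an operation that
    does not see these two changes is constant. *)
Lemma far_op (op : bool -> bool -> bool) E E' : E \in edges T -> E' \in edges T -> E != E' ->
  (forall a b, a \in E -> b \in E -> op (far E a) (far E' a) = op (far E b) (far E' b)) ->
  (forall a b, a \in E' -> b \in E' -> op (far E a) (far E' a) = op (far E b) (far E' b)) ->
  forall W, op (far E W) (far E' W) = op false false.
Proof.
move=> EE EE' neE h h' W; transitivity (op (far E rho) (far E' rho)); last by rewrite !far_root.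
apply: (const_along_edges (f := fun W => op (far E W) (far E' W))) => a b ab.
have [e|ne] := eqVneq [set a; b] E; first by apply: h; rewrite -e !inE eqxx ?orbT.
have [e|ne'] := eqVneq [set a; b] E'; first by apply: h'; rewrite -e !inE eqxx ?orbT.
by rewrite (far_same ab ne) (far_same ab ne').
Qed.

(** Both ends of E are beyond E', and then so is all that lies beyond E.  If the ends
    of E' were beyond E, neither edge could be nearest to the root. *)
Lemma far_in E E' a : E \in edges T -> E' \in edges T -> E != E' -> a \in E -> far E' a ->
  forall W, far E W -> far E' W.
Proof.
move=> EE EE' neE aE fa W; have [c cE' _] := far_bottom EE'.
have gE x : x \in E -> far E' x by move=> xE; rewrite (far_on_edge EE neE xE aE).
have fE' x : x \in E' -> far E x = far E c.
  by move=> xE'; apply: far_on_edge EE' _ xE' cE'; rewrite eq_sym.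
case fc: (far E c) in fE'.
  (* Each end of E is beyond E' and each end of E' beyond E: this fails at the root. *)
  have h := far_op (op := orb) EE EE' neE _ _ a; rewrite /= in h.
  have : far E a || far E' a = false.
    by apply: h => x y; [move=> /gE-> /gE->; rewrite !orbT|move=> /fE'-> /fE'->].
  by rewrite fa orbT.
have := far_op (op := fun x y => x && ~~ y) EE EE' neE _ _ W => /= h fW.
have : far E W && ~~ far E' W = false.
  by apply: h => x y; [move=> /gE-> /gE->; rewrite !andbF|move=> /fE'-> /fE'->].
by rewrite fW => /negbFE.
Qed.

(** E is on the root side of E'; then either E' is beyond E, or the far sides are
    disjoint. *)
Lemma far_out E E' a : E \in edges T -> E' \in edges T -> E != E' -> a \in E -> ~~ far E' a ->
  (forall W, far E' W -> far E W) \/ (forall W, far E W -> ~~ far E' W).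
Proof.
move=> EE EE' neE aE fa; have [c cE' _] := far_bottom EE'.
have gE x : x \in E -> far E' x = false.
  by move=> xE; rewrite (far_on_edge EE neE xE aE); apply/negbTE.
have fE' x : x \in E' -> far E x = far E c.
  by move=> xE'; apply: far_on_edge EE' _ xE' cE'; rewrite eq_sym.
case fc: (far E c) in fE'; [left|right] => W fW.
  have := far_op (op := fun x y => y && ~~ x) EE EE' neE _ _ W => /= h.
  have : far E' W && ~~ far E W = false.
    by apply: h => x y; [move=> /gE-> /gE->|move=> /fE'-> /fE'->; rewrite !andbF].
  by rewrite fW => /negbFE.
have := far_op (op := andb) EE EE' neE _ _ W => /= h.
have : far E W && far E' W = false.
  by apply: h => x y; [move=> /gE-> /gE->; rewrite !andbF|move=> /fE'-> /fE'->].
by rewrite fW => /negbT.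
Qed.

Lemma far_nested E E' : E \in edges T -> E' \in edges T ->
  [\/ forall W, far E W -> far E' W, forall W, far E' W -> far E W |
      forall W, far E W -> ~~ far E' W].
Proof.
move=> EE EE'; have [->|neE] := eqVneq E E'; first by constructor 1.
have [a aE _] := far_bottom EE; have [fa|fa] := boolP (far E' a).
  by constructor 1; apply: (far_in EE EE' neE aE fa).
by case: (far_out EE EE' neE aE fa); [constructor 2|constructor 3].
Qed.

Lemma up_edge W : W != rho -> exists E, [/\ E \in edges T, W \in E & far E W].
Proof.
have [p [pp + up]] := simple_path rho W; case/lastP: p pp up => [|p W'] pp up /=.
  by move=> ->; rewrite eqxx.
rewrite last_rcons => eW _; subst W'.
have Ep : [set last rho p; W] \in path_edges rho (rcons p W).
  by rewrite /path_edges -cats1 pairmap_cat mem_cat /= mem_head orbT.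
have EE := path_edges_sub pp Ep; exists [set last rho p; W]; split=> //.
  by rewrite !inE eqxx orbT.
by move: Ep; rewrite far_path // last_rcons far_root.
Qed.

Lemma up_edge_uniq W E E' : E \in edges T -> E' \in edges T -> W \in E -> W \in E' ->
  far E W -> far E' W -> E = E'.
Proof.
move=> EE EE' WE WE' fW fW'; apply/eqP/negPn/negP => neE.
have [a aE /negP[]] := far_top EE; have neE' : E' != E by rewrite eq_sym.
apply: (far_in EE' EE neE' WE' fW).
by rewrite (far_on_edge EE neE aE WE).
Qed.

End Trees.

(** * Ends beyond the vertices and edges of a tree rooted at an end *)
Section RootedTrees.
Local Open Scope set_scope.
Variables (N : nat) (T : mgraph N) (treeT : is_tree T) (i0 : 'I_N).
Implicit Types (E : {set vert T}) (W a b c : vert T) (i j : 'I_N).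
Let far := (far (foot T i0)).

Definition down_edges W := [set E in edges T | (W \in E) && ~~ far E W].

Definition down_ends W := [set i | (foot T i == W) && (i != i0)].

(** Exactly one of the at least three edges and ends at W leads to the root. *)
Lemma down_valence W : (2 <= #|down_edges W| + #|down_ends W|)%N.
Proof.
case: treeT => _ _ _ /(_ W); rewrite /valence.
set A := [set E in edges T | W \in E]; set B := [set i | foot T i == W].
have [eW|neW] := eqVneq W (foot T i0).
  have -> : down_edges W = A.
    by apply/setP=> E; rewrite !inE eW /far far_root andbT.
  have : i0 \in B by rewrite inE eW.
  rewrite (cardsD1 i0 B) => ->; rewrite addnCA add1n ltnS.
  suff -> : B :\ i0 = down_ends W by [].
  by apply/setP=> i; rewrite !inE andbC.
have [E [EE WE fW]] := up_edge treeT neW.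
have -> : down_ends W = B.
  apply/setP=> i; rewrite !inE; case: eqP => //= fi; apply: contraNneq neW => e.
  by rewrite -fi e.
have : E \in A by rewrite inE EE.
rewrite (cardsD1 E A) => ->; rewrite add1n addSn ltnS.
suff -> : A :\ E = down_edges W by [].
apply/setP=> E'; rewrite !inE; have [->|ne] := eqVneq E' E; first by rewrite /far fW !andbF.
have [EE'|//] := boolP (E' \in edges T); have [WE'|//] := boolP (W \in E').
rewrite /=; symmetry; apply: contraNN ne => fW'; apply/eqP.
exact: (up_edge_uniq treeT EE' EE WE' WE fW' fW).
Qed.

(** Walk away from the root; by [down_valence] the walk can only stop at an end. *)
Lemma far_has_end E : E \in edges T -> exists i, far E (foot T i).
Proof.
have [n] := ubnP #|[set W | far E W]|; elim: n E => // n IH E; rewrite ltnS => len EE.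
have [W WE fW] := far_bottom treeT (foot T i0) EE.
have := down_valence W.
have [e|[i]] := set_0Vmem (down_ends W); last first.
  by rewrite inE => /andP[/eqP fi _] _; exists i; rewrite fi.
rewrite e cards0 addn0 => /ltnW/card_gt0P[E1].
rewrite inE => /and3P[EE1 WE1 nf1].
have ne1 : E1 != E by apply: contraNneq nf1 => ->.
have sub := far_in treeT EE1 EE ne1 WE1 fW.
have [|i fi] := IH E1 _ EE1; last by exists i; apply: sub.
apply: leq_trans len; apply: proper_card; apply/properP; split.
  by apply/subsetP=> x; rewrite !inE; apply: sub.
by exists W; rewrite !inE.
Qed.

Lemma down_disjoint W E1 E2 : E1 \in down_edges W -> E2 \in down_edges W -> E1 != E2 ->
  forall x, far E1 x -> ~~ far E2 x.
Proof.
rewrite !inE => /and3P[EE1 WE1 nf1] /and3P[EE2 WE2 nf2] ne.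
have [sub|//] := far_out treeT EE1 EE2 ne WE1 nf2.
have [b bE2 /sub] := far_bottom treeT (foot T i0) EE2.
by rewrite (far_on_edge treeT _ EE2 _ bE2 WE2) 1?eq_sym // -/far (negPf nf1).
Qed.

(** Follow two different downward branches at W to ends i and j.  The edges
    separating both from the root are those separating W from it, so W can be
    recovered from the ends. *)
Lemma ends_meet W : exists i j, [/\ i != j, i != i0, j != i0,
  forall E, E \in edges T -> far E W -> far E (foot T i) && far E (foot T j) &
  forall E, E \in edges T -> far E (foot T i) -> far E (foot T j) -> far E W].
Proof.
have sub E1 i : E1 \in down_edges W -> far E1 (foot T i) ->
    forall E, E \in edges T -> far E W -> far E (foot T i).
  rewrite inE => /and3P[EE1 WE1 nf1] fi E EE fW.
  apply: (far_in treeT EE1 EE _ WE1 fW) => //.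
  by apply: contraNneq nf1 => ->.
have nroot E i : far E (foot T i) -> i != i0.
  by apply: contraTneq => ->; rewrite /far far_root.
have val := down_valence W.
have [ed0|[i iW]] := set_0Vmem (down_ends W).
  move: val; rewrite ed0 cards0 addn0 => /card_gt1P[E1 [E2 [d1 d2 ne]]].
  have [/[dup] d1' /[1!inE] /and3P[EE1 WE1 nf1]] := (d1).
  have [/[dup] d2' /[1!inE] /and3P[EE2 WE2 nf2]] := (d2).
  have [i fi] := far_has_end EE1; have [j fj] := far_has_end EE2.
  have dis := down_disjoint d1 d2 ne.
  exists i, j; split; [|exact: nroot fi|exact: nroot fj|..].
  - by apply: contraTneq fj => <-; apply: dis.
  - by move=> E EE fW; rewrite (sub E1 i d1 fi E EE fW) (sub E2 j d2 fj E EE fW).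
  move=> E EE fEi fEj; have [//|nfW] := boolP (far E W).
  have nj1 : ~~ far E1 (foot T j) by apply: contraTN fj; apply: dis.
  have [eE|neE] := eqVneq E1 E; first by rewrite -eE (negPf nj1) in fEj.
  have [sub1|/(_ _ fi)] := far_out treeT EE1 EE neE WE1 nfW; last by rewrite -/far fEi.
  by case/negP: nj1; apply: sub1.
move: (iW); rewrite inE => /andP[/eqP fi ii0].
have [dn0|[E1 d1]] := set_0Vmem (down_edges W).
  move: val; rewrite dn0 cards0 add0n => /card_gt1P[i1 [i2 []]].
  rewrite !inE => /andP[/eqP f1 n1] /andP[/eqP f2 n2] ne.
  by exists i1, i2; split=> // E EE; rewrite f1 f2 // => ->.
have /[1!inE] /and3P[EE1 WE1 nf1] := d1.
have [j fj] := far_has_end EE1.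
exists i, j; split; rewrite ?(nroot _ _ fj) //.
- by apply: contraTneq fj => <-; rewrite fi.
- by move=> E EE fW; rewrite fi fW (sub E1 j d1 fj E EE fW).
- by move=> E EE; rewrite fi.
Qed.

End RootedTrees.

(** * The tree family of a tree *)
Section EndSplits.
Local Open Scope set_scope.
Variables (N : nat) (T : mgraph N) (treeT : is_tree T) (i0 : 'I_N).
Implicit Types (E : {set vert T}) (W a b c : vert T) (i j : 'I_N).
Let sep := (far (foot T i0)).

Definition endset E := [set i | far (foot T i0) E (foot T i)].

Definition end_splits := [set endset E | E in edges T].

(** By [ends_meet] the bottom vertex of E is determined by two ends beyond E. *)
Lemma endsetS E E' : E \in edges T -> E' \in edges T -> endset E \subset endset E' ->
  forall W, sep E W -> sep E' W.
Proof.
move=> EE EE' /subsetP sub; have [->//|ne] := eqVneq E E'.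
have [b bE fb] := far_bottom treeT (foot T i0) EE.
have [i [j [_ _ _ below meet]]] := ends_meet treeT i0 b.
have /andP[fi fj] := below E EE fb.
apply: (far_in treeT EE EE' ne bE); apply: meet => //.
  by have := sub i; rewrite !inE; apply.
by have := sub j; rewrite !inE; apply.
Qed.

Lemma endset_inj : {in edges T &, injective endset}.
Proof.
move=> E E' EE EE' e; apply/eqP/negPn/negP => ne.
have h : forall W, sep E W = sep E' W.
  by move=> W; apply/idP/idP; apply: endsetS; rewrite // e.
have [b bE fb] := far_bottom treeT (foot T i0) EE.
have [a aE /negP[]] := far_top treeT (foot T i0) EE.
change (sep E a); rewrite h /sep (far_on_edge treeT (foot T i0) EE ne aE bE).
by rewrite -/(sep E' b) -h.
Qed.

Lemma far_endset W E0 E : E0 \in edges T -> E \in edges T -> W \in E0 -> sep E0 W ->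
  sep E W = (endset E0 \subset endset E).
Proof.
move=> EE0 EE WE0 f0; apply/idP/idP=> [fW|sub]; last exact: (endsetS EE0 EE sub).
have [->//|ne] := eqVneq E0 E; apply/subsetP=> i; rewrite !inE.
exact: (far_in treeT EE0 EE ne WE0 fW).
Qed.

Lemma end_splits_family : tree_family [set~ i0] end_splits.
Proof.
apply/andP; split.
  apply/laminarP=> _ _ /imsetP[E EE ->] /imsetP[E' EE' ->]; rewrite /nested.
  case: (far_nested treeT (foot T i0) EE EE') => h.
  - by apply/or3P/Or31; apply/subsetP=> i; rewrite !inE; apply: h.
  - by apply/or3P/Or32; apply/subsetP=> i; rewrite !inE; apply: h.
  - by apply/or3P/Or33/pred0P=> i /=; rewrite !inE; apply/negP=> /andP[/h/negP].
apply/forall_inP=> _ /imsetP[E EE ->].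
have [b bE fb] := far_bottom treeT (foot T i0) EE.
have [i [j [ne _ _ below _]]] := ends_meet treeT i0 b.
have /andP[fi fj] := below E EE fb.
have [i1 [j1 [ne1 i10 j10 _ meet]]] := ends_meet treeT i0 (foot T i0).
apply/and3P; split.
- by apply/subsetP=> k; rewrite !inE; apply: contraTneq => ->; rewrite far_root.
- by apply/card_gt1P; exists i, j; rewrite !inE.
apply: contraFN (far_root (foot T i0) E) => /eqP/setP e; apply: meet => //.
  by have := e i1; rewrite !inE i10.
by have := e j1; rewrite !inE j10.
Qed.

Lemma sum_end_splits (V : nmodType) (g : {set 'I_N} -> V) :
  \sum_(I in end_splits) g I = \sum_(E in edges T) g (endset E).
Proof. by rewrite big_imset //=; apply: endset_inj. Qed.

End EndSplits.

(** * A tree is determined by its family *)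
Section TreeIso.
Local Open Scope set_scope.
Variables (N : nat) (T T' : mgraph N) (treeT : is_tree T) (treeT' : is_tree T').
Variables (i0 : 'I_N) (s : {perm 'I_N}).
Hypothesis s_splits : end_splits T' i0 = [set s @: I | I : {set _} in end_splits T i0].
Let sep := far (foot T i0).
Let sep' := far (foot T' i0).
Let matched (E : {set vert T}) (E' : {set vert T'}) := endset i0 E' = (s @: endset i0 E).

(** The root goes to the root, and any other vertex to the bottom vertex of the edge
    corresponding to the edge above it. *)
Lemma tree_map_exists : exists f : vert T -> vert T',
  forall W E E', E \in edges T -> E' \in edges T' -> matched E E' -> sep' E' (f W) = sep E W.
Proof.
pose P W W' := forall E E', E \in edges T -> E' \in edges T' -> matched E E' ->
  sep' E' W' = sep E W.
suff h W : exists W', P W W' by have [f hf] := choice h; exists f => W E E'; apply: hf.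
have [->|neW] := eqVneq W (foot T i0).
  by exists (foot T' i0) => E E' _ _ _; rewrite /sep /sep' !far_root.
have [E0 [EE0 WE0 f0]] := up_edge treeT neW.
have /imsetP[E0' EE0' m0] : (s @: endset i0 E0) \in end_splits T' i0.
  by rewrite s_splits; do 2 apply: imset_f.
have [W' WE' f'] := far_bottom treeT' (foot T' i0) EE0'.
exists W' => E E' EE EE' m.
rewrite /sep' (far_endset treeT' EE0' EE' WE' f') /sep (far_endset treeT EE0 EE WE0 f0).
rewrite m -m0; apply/idP/idP=> [|/imsetS-> //].
move=> /subsetP sub; apply/subsetP=> i iE0.
by have /imsetP[j jE /perm_inj->] := sub (s i) (imset_f s iE0).
Qed.

Lemma tree_map : exists f : vert T -> vert T',
  [/\ forall W E E', E \in edges T -> E' \in edges T' -> matched E E' -> sep' E' (f W) = sep E W,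
      forall E E', E \in edges T -> E' \in edges T' -> matched E E' -> (f @: E) = E',
      forall E, E \in edges T -> (f @: E) \in edges T' /\ matched E (f @: E) &
      forall i, foot T' (s i) = f (foot T i)].
Proof.
have [f hf] := tree_map_exists.
have hE E E' : E \in edges T -> E' \in edges T' -> matched E E' -> (f @: E) = E'.
  move=> EE EE' m; have [a [b [neab eE]]] := edgeP treeT EE.
  rewrite eE imsetU1 imset_set1; apply: (edge_far treeT' (rho := foot T' i0)) => // E1' EE1'.
  have : endset i0 E1' \in end_splits T' i0 by apply: imset_f.
  rewrite s_splits => /imsetP[_ /imsetP[E1 EE1 ->] m1].
  rewrite -!/(sep' _ _) !(hf _ _ _ EE1 EE1' m1) /sep (far_xor treeT) -?eE //.
  apply/eqP/eqP=> e.
    by apply: (endset_inj treeT' (i0 := i0)) => //; rewrite m1 m e.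
  apply: (endset_inj treeT (i0 := i0)) => //; apply: (imset_inj (@perm_inj _ s)).
  by rewrite -m -m1 e.
exists f; split=> // [E EE|i].
  have : (s @: endset i0 E) \in end_splits T' i0.
    by rewrite s_splits; do 2 apply: imset_f.
  by case/imsetP=> E' EE' m; rewrite (hE E E') //; split.
apply: (far_inj treeT' (rho := foot T' i0)) => E' EE'.
have : endset i0 E' \in end_splits T' i0 by apply: imset_f.
rewrite s_splits => /imsetP[_ /imsetP[E EE ->] m].
rewrite -!/(sep' _ _) (hf _ _ _ EE EE' m).
have := (erefl (s i \in endset i0 E')); rewrite [in RHS]m (mem_imset _ _ (@perm_inj _ s)).
by rewrite !inE.
Qed.

End TreeIso.

Lemma imset_permK (S : finType) (s : {perm S}) (A : {set S}) : ((s^-1)%g @: (s @: A) = A)%SET.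
Proof. by rewrite -imset_comp -[RHS]imset_id; apply: eq_imset => i /=; rewrite permK. Qed.

(** The maps given by [tree_map] for s and its inverse are mutually inverse, since
    vertices are determined by the edges separating them from the root. *)
Lemma tree_iso (N : nat) (T T' : mgraph N) (i0 : 'I_N) (s : {perm 'I_N}) :
    is_tree T -> is_tree T' ->
    end_splits T' i0 = [set s @: I | I : {set _} in end_splits T i0]%SET ->
  exists f : vert T -> vert T',
  [/\ bijective f,
      forall E : {set vert T}, ((f @: E)%SET \in edges T') = (E \in edges T),
      forall E, E \in edges T -> endset i0 (f @: E)%SET = (s @: endset i0 E)%SET,
      forall W E, E \in edges T -> far (foot T' i0) (f @: E)%SET (f W) = far (foot T i0) E W &
      forall i, foot T' (s i) = f (foot T i)].
Proof.
move=> treeT treeT' sT.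
have sT' : end_splits T i0 = [set (s^-1)%g @: I | I : {set _} in end_splits T' i0]%SET.
  by rewrite sT -imset_comp -[LHS]imset_id; apply: eq_imset => I /=; rewrite imset_permK.
have [f [f1 f2 f3 f4]] := tree_map treeT treeT' sT.
have [g [g1 g2 g3 g4]] := tree_map treeT' treeT sT'.
have fK : cancel f g.
  move=> W; apply: (far_inj treeT (rho := foot T i0)) => E EE.
  have [EE' m] := f3 E EE.
  rewrite (g1 (f W) (f @: E)%SET E) ?(f1 W E) //.
  by rewrite m imset_permK.
have gK : cancel g f.
  move=> W; apply: (far_inj treeT' (rho := foot T' i0)) => E EE.
  have [EE' m] := g3 E EE.
  rewrite (f1 (g W) (g @: E)%SET E) ?(g1 W E) //.
  by rewrite m -{1}[s]invgK imset_permK.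
exists f; split=> //.
- by exists g.
- move=> E; apply/idP/idP => [/g3[]|/f3[]//].
  by rewrite -imset_comp (eq_imset _ fK) imset_id.
- by move=> E /f3[].
- by move=> W E EE; have [EE' m] := f3 E EE; apply: f1.
Qed.

(** * Evaluation as a linear map of lengths and root position *)
Section Curves.
Variables (R : realType) (r n : nat) (n_gt0 : (0 < n)%N) (Delta : seq 'rV[int]_r).
Notation N := (n + size Delta)%N.
Implicit Types (C : curve R n Delta) (I : {set 'I_N}).

Definition root_end : 'I_N := lshift (size Delta) (Ordinal n_gt0).

Definition edir I : 'rV[int]_r := \sum_(i in I) end_dir i.

Lemma end_dir_marked (i : 'I_n) : end_dir (lshift (size Delta) i) = 0 :> 'rV[int]_r.
Proof. by rewrite /end_dir -/(unsplit (inl i)) (unsplitK (inl i)). Qed.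

Lemma end_dir_unmarked (j : 'I_(size Delta)) : end_dir (rshift n j) = Delta`_j.
Proof. by rewrite /end_dir -/(unsplit (inr j)) (unsplitK (inr j)). Qed.

Lemma sum_end_dir : \sum_(v <- Delta) v = 0 -> \sum_(i < N) end_dir i = 0.
Proof.
move=> D0; rewrite big_split_ord /= big1 ?add0r => [|i _]; last exact: end_dir_marked.
by rewrite (eq_bigr _ (fun j _ => end_dir_unmarked j)) -[RHS]D0 (big_nth 0) big_mkord.
Qed.

Let toRr (x : 'rV[int]_r) : 'rV[R]_r := map_mx intr x.

Lemma map_intr_inj k l : injective (map_mx intr : 'M[int]_(k, l) -> 'M[R]_(k, l)).
Proof.
move=> A B /matrixP e; apply/matrixP=> i j; have := e i j; rewrite !mxE.
exact: intr_inj.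
Qed.

(** Add the balancing conditions over all vertices beyond E: each other edge beyond E
    occurs twice with opposite directions, so the direction of E at its lower vertex
    and the directions of the ends beyond E add up to 0. *)
Lemma pos_edge C (E : {set vert C}) (a b : vert C) :
    E \in edges C -> E = [set a; b]%SET ->
    ~~ far (foot C root_end) E a -> far (foot C root_end) E b ->
  pos b = pos a + len E *: toRr (edir (endset root_end E)).
Proof.
move=> EE eE fa fb; have treeC := curve_tree C; have [v [hv bal]] := curve_map C.
set rho := foot C root_end in fa fb.
have anti x y : [set x; y]%SET \in edges C -> v [set x; y]%SET x + v [set x; y]%SET y = 0.
  move=> xy; apply: (@map_intr_inj 1 r); rewrite map_mx0; apply: (scalerI (lt0r_neq0 (len_gt0 xy))).
  have := hv y x; rewrite set2C => /(_ xy) e; have := hv x y xy; rewrite {1}e.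
  rewrite -addrA -[X in X = _ -> _]addr0 => /addrI e0.
  by rewrite scaler0 map_mxD scalerDr addrC -e0.
have : \sum_(W | far rho E W) (\sum_(E' in edges C | W \in E') v E' W
               + \sum_(i | foot C i == W) end_dir i) = 0 by apply: big1 => W _; apply: bal.
rewrite big_split /= => sum0.
have s2 : \sum_(W | far rho E W) \sum_(i | foot C i == W) end_dir i = edir (endset root_end E).
  rewrite /edir (partition_big (foot C) (fun W => far rho E W)) /= => [|i]; last by rewrite inE.
  apply: eq_bigr => W fW; apply: eq_bigl => i; rewrite inE.
  by case: eqP => [->|]; rewrite ?andbF // andbT; apply/esym.
have s1 : \sum_(W | far rho E W) \sum_(E' in edges C | W \in E') v E' W = v E b.
  rewrite (exchange_big_dep (mem (edges C))) /= => [|W E' _ /andP[]//].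
  rewrite (bigD1 E) //= [X in _ + X]big1 ?addr0 => [|E' /andP[EE' neE]].
    rewrite (big_pred1 b) // => W; rewrite EE /= eE !inE.
    case: (eqVneq W b) => [->|neb]; first by rewrite -eE fb orbT.
    by case: eqP => [->|]; rewrite ?andbF // -eE (negPf fa).
  have [x [y [nexy eE']]] := edgeP treeC EE'.
  have fxy : far rho E x = far rho E y by apply: far_same; rewrite -eE'.
  case fx : (far rho E x); last first.
    apply: big1 => W; rewrite EE' /= eE' !inE => /andP[fW] /orP[] /eqP eW; move: fW.
      by rewrite eW fx.
    by rewrite eW -fxy fx.
  rewrite (bigD1 x) /= ?EE' ?fx ?eE' ?inE ?eqxx //.
  rewrite (big_pred1 y) => [|W]; first by apply: anti; rewrite -eE'.
  rewrite /= !inE; case: (eqVneq W y) => [->|ney].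
    by rewrite -fxy fx orbT eq_sym nexy.
  by rewrite orbF; case: eqP; rewrite ?andbF.
move: sum0; rewrite s1 s2 => sum0.
have := hv a b; rewrite -eE => /(_ EE) ->; congr (_ + _ *: map_mx _ _).
have := anti a b; rewrite -eE => /(_ EE) /eqP; rewrite addr_eq0 => /eqP ->.
by move/eqP: sum0; rewrite addr_eq0 => /eqP ->; rewrite opprK.
Qed.

Lemma pos_far C (W : vert C) : pos W = pos (foot C root_end) +
  \sum_(E in edges C | far (foot C root_end) E W) len E *: toRr (edir (endset root_end E)).
Proof.
have treeC := curve_tree C; set rho := foot C root_end.
pose g W := pos W - \sum_(E in edges C | far rho E W) len E *: toRr (edir (endset root_end E)).
have gab a b : [set a; b]%SET \in edges C -> ~~ far rho [set a; b]%SET a -> far rho [set a; b]%SET b ->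
    g a = g b.
  move=> ab fa fb; rewrite /g (pos_edge ab erefl fa fb).
  rewrite [X in _ = _ + _ - X](bigD1 [set a; b]%SET) ?ab //= opprD addrA addrK.
  congr (_ - _); apply: eq_bigl => E; have [EE|//] := boolP (E \in edges C).
  rewrite /=; have [->|ne] := eqVneq E [set a; b]%SET; first by rewrite (negPf fa) andbF.
  by rewrite andbT; apply: far_same; rewrite // eq_sym.
have e : g W = g rho.
  apply: (const_along_edges treeC) => a b ab.
  have := far_xor treeC rho [set a; b]%SET ab; rewrite eqxx.
  case fa : (far rho _ a) => /= fb; last by apply: gab; rewrite ?fa.
  by apply/esym; rewrite set2C in ab fa fb *; apply: gab; rewrite // set2C.
move: e; rewrite /g [X in _ = _ - X]big1 ?subr0 => [|E /andP[_]]; last by rewrite far_root.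
by move=> <-; rewrite subrK.
Qed.

(** The derivative of ev with respect to the length of an edge with the ends I beyond
    it: it moves the marked points in I in the direction of that edge. *)
Definition evu I : 'rV[int]_(n * r) :=
  mxvec (\matrix_(j < n) (if lshift (size Delta) j \in I then edir I else 0)).

(** The derivatives of ev with respect to the position of the root. *)
Definition evbase : seq 'rV[int]_(n * r) :=
  [seq mxvec (\matrix_(j < n) delta_mx 0 a) | a <- enum 'I_r].

Definition diagv (x : 'rV[R]_r) : 'rV[R]_(n * r) := mxvec (\matrix_(j < n) x).

Lemma size_evbase : size evbase = r.
Proof. by rewrite size_map -cardE card_ord. Qed.

Lemma diagvE x : diagv x = \sum_k x 0 (cast_ord size_evbase k) *: toR R evbase`_k.
Proof.
rewrite (reindex (cast_ord (esym size_evbase))) /=; last first.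
  by exists (cast_ord size_evbase) => k _; rewrite ?cast_ordK ?cast_ordKV.
apply: (canLR vec_mxK); rewrite linear_sum /=; apply/matrixP=> j a.
rewrite summxE mxE (bigD1 a) //= big1 ?addr0 => [|b neb].
  rewrite cast_ordKV (nth_map a) ?size_enum_ord ?ltn_ord // nth_ord_enum.
  by rewrite /toR linearZ /= -map_vec_mx mxvecK !mxE !eqxx mulr1.
rewrite cast_ordKV (nth_map b) ?size_enum_ord ?ltn_ord // nth_ord_enum.
by rewrite /toR linearZ /= -map_vec_mx mxvecK !mxE eqxx eq_sym (negPf neb) mulr0.
Qed.

Lemma diagvB x y : diagv (x - y) = diagv x - diagv y.
Proof.
by rewrite /diagv -linearB; congr mxvec; apply/row_matrixP=> j; rewrite linearB /= !rowK.
Qed.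

Lemma diagv0 : diagv 0 = 0.
Proof. by rewrite -[0 in LHS](subrr 0) diagvB subrr. Qed.

(** By [endset_inj] the sum has a single term for I in the family of C. *)
Definition split_len C I : R := \sum_(E in edges C | endset root_end E == I) len E.

Lemma split_lenE C (E : {set vert C}) : E \in edges C -> split_len C (endset root_end E) = len E.
Proof.
move=> EE; rewrite /split_len (big_pred1 E) // => E'.
have [EE'|nEE'] := boolP (E' \in edges C); last by apply/esym; apply: contraNF nEE' => /eqP->.
by apply/eqP/eqP=> [|->//]; apply: (endset_inj (curve_tree C)).
Qed.

Lemma split_len_gt0 C I : I \in end_splits C root_end -> 0 < split_len C I.
Proof. by case/imsetP=> E EE ->; rewrite split_lenE // len_gt0. Qed.

Lemma ev_solves C : mxvec (ev C) =
  \sum_(I in end_splits C root_end) split_len C I *: toR R (evu I) + diagv (pos (foot C root_end)).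
Proof.
rewrite (sum_end_splits (curve_tree C)).
under eq_bigr => E EE do rewrite split_lenE //.
apply: (canLR vec_mxK); rewrite linearD linear_sum /= mxvecK; apply/row_matrixP=> j.
rewrite linearD linear_sum /= /ev !rowK /marked_pos pos_far addrC; congr (_ + _).
rewrite big_mkcondr /=; apply: eq_bigr => E EE.
rewrite !linearZ /= -map_vec_mx mxvecK -map_row rowK inE.
by case: ifP => // _; rewrite map_mx0 scaler0.
Qed.

End Curves.

(** * The balancing relation at a wall *)
Section Balancing.
Variables (r n : nat) (n_gt0 : (0 < n)%N) (Delta : seq 'rV[int]_r).
Hypothesis r_gt0 : (0 < r)%N.
Hypothesis Delta_sum0 : \sum_(v <- Delta) v = 0.
Hypothesis dimE : (r + n + size Delta - 3 = n * r)%N.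
Notation N := (n + size Delta)%N.
Implicit Types (I : {set 'I_N}) (F : {set {set 'I_N}}).

Notation Omega := [set~ root_end n_gt0 Delta]%SET.

Lemma ends_ge3 : (3 <= N)%N.
Proof.
rewrite leqNgt; apply/negP=> lt3; have : (r <= n * r)%N by rewrite leq_pmull.
by rewrite -dimE; move: r_gt0 lt3; lia.
Qed.

Lemma card_Omega : #|Omega| = N.-1.
Proof. by rewrite cardsC1 card_ord. Qed.

Lemma eval_dim_gt0 : (0 < n * r)%N.
Proof. by rewrite muln_gt0 n_gt0. Qed.

Lemma family_size F : tree_family Omega F -> (#|F| + size (evbase r n) <= n * r)%N.
Proof.
have N3 := ends_ge3; have cO := card_Omega.
move=> fF; have O1 : (1 < #|Omega|)%N by rewrite cO; move: N3; lia.
have := tree_family_card O1 fF; rewrite size_evbase cO -dimE.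
by move: N3 r_gt0; clear; set f := #|F|; clearbody f; move: (size Delta) => d; lia.
Qed.

Lemma edir_Omega : edir Omega = 0 :> 'rV[int]_r.
Proof.
have := sum_end_dir n Delta_sum0; rewrite (bigD1 (root_end n_gt0 Delta)) //= end_dir_marked add0r => e.
by rewrite -[RHS]e; apply: eq_bigl => i; rewrite !inE.
Qed.

Lemma evu_cluster F I : cluster Omega F I -> I \in F \/ evu I = 0.
Proof.
case/or3P=> [->|/eqP->|/andP[/cards1P[i ->] _]]; [by left|right|right]; apply: (canLR vec_mxK);
  rewrite linear0; apply/matrixP=> j a; rewrite !mxE.
  by rewrite edir_Omega; case: ifP; rewrite mxE.
case: ifP; last by rewrite mxE.
by rewrite inE => /eqP<-; rewrite /edir big_set1 end_dir_marked mxE.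
Qed.

Lemma edirU (I J : {set 'I_N}) : [disjoint I & J]%B -> edir (I :|: J)%SET = edir I + edir J :> 'rV[int]_r.
Proof. by move=> dIJ; rewrite /edir -bigU //; apply: eq_bigl => i; rewrite !inE. Qed.

(** A marked point in A occurs in A :|: B, A :|: C on the left and in A, A :|: B :|: C
    on the right; both give 2 e_A + e_B + e_C.  The same holds for B and C. *)
Lemma evu_resolutions (A B C : {set 'I_N}) :
  [disjoint A & B]%B -> [disjoint A & C]%B -> [disjoint B & C]%B ->
  evu (A :|: B)%SET + evu (A :|: C)%SET + evu (B :|: C)%SET =
  evu A + evu B + evu C + evu (A :|: B :|: C)%SET :> 'rV[int]_(n * r).
Proof.
move=> dAB dAC dBC.
have dABC : [disjoint A :|: B & C]%B.
  by rewrite -setI_eq0 setIUl setU_eq0 !setI_eq0 dAC.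
rewrite /evu -!linearD; congr mxvec; apply/row_matrixP=> j; rewrite !linearD /= !rowK !inE.
rewrite !edirU //; have dis (I J : {set 'I_N}) x : [disjoint I & J]%B -> x \in I -> x \in J = false.
  by move=> /pred0P/(_ x) /= + xI; rewrite xI.
set x := lshift _ j.
have [xA|xA] := boolP (x \in A).
  rewrite (dis A B x dAB xA) (dis A C x dAC xA) /= !addr0.
  by apply/rowP=> k; rewrite !mxE; ring.
have [xB|xB] := boolP (x \in B).
  rewrite (dis B C x dBC xB) /= !addr0 !add0r.
  by apply/rowP=> k; rewrite !mxE; ring.
have [xC|xC] := boolP (x \in C); rewrite /= ?addr0 ?add0r //.
by apply/rowP=> k; rewrite !mxE; ring.
Qed.

Lemma nondeg_trivalent F :
  nondeg (evbase r n) (@evu r n Delta) (tree_family Omega) F -> trivalent Omega F.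
Proof.
move=> nd; have sz := nondeg_size family_size nd; have N3 := ends_ge3; have /andP[fF _] := nd.
rewrite /trivalent fF card_Omega /=; move: sz r_gt0 N3; rewrite size_evbase -dimE; clear.
by set f := #|F|; clearbody f; move: (size Delta) => d; lia.
Qed.

(** Apply the linear form of the wall to [evu_resolutions]: it kills the vectors of
    the wall, and the vectors of clusters are among these or 0. *)
Lemma evu_balanced F I : nondeg (evbase r n) (@evu r n Delta) (tree_family Omega) F -> I \in F ->
  \sum_(J | (J \notin F :\ I)%SET && tree_family Omega (J |: F :\ I)%SET)
     wall_det (evbase r n) (@evu r n Delta) (F :\ I)%SET J = 0.
Proof.
move=> nd IF; have sz := nondeg_size family_size nd; have triF := nondeg_trivalent nd.
have [A [B [C [[cA cB cC cABC] [dAB dAC dBC] unq res]]]] := trivalent_resolutions triF IF.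
rewrite (eq_bigl (mem [:: A :|: B; A :|: C; B :|: C]%SET) _ res) -big_uniq //=.
rewrite !big_cons big_nil addr0 /wall_det -!(detformE eval_dim_gt0).
set f := detform _ _; have fE x : (x *m f) 0 0 = sdet (x :: gens (evbase r n) (@evu r n Delta) (F :\ I)%SET).
  exact: detformE.
have f0 K : cluster Omega (F :\ I)%SET K -> (evu K *m f) 0 0 = 0.
  move=> /evu_cluster[KF|->]; last by rewrite mul0mx mxE.
  rewrite fE (sdet_mem eval_dim_gt0) ?mem_gens // size_gens; apply: leq_trans (eq_leq sz).
  by rewrite [X in (_ < X + _)%N](cardsD1 I F) IF.
transitivity (((evu (A :|: B)%SET + evu (A :|: C)%SET + evu (B :|: C)%SET) *m f) 0 0).
  by rewrite !mulmxDl !mxE addrA.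
by rewrite evu_resolutions // !mulmxDl [LHS]mxE [X in X + _]mxE [X in X + _ + _]mxE !f0 // !addr0.
Qed.

End Balancing.

(** * Realization of tree families by curves

    The vertices are the members of F and [Omega], the latter being the vertex of
    the root end; each member is joined to the smallest member above it, and an end
    sits at the smallest member containing it. *)
Section Realization.
Local Open Scope set_scope.
Variables (R : realType) (r n : nat) (n_gt0 : (0 < n)%N) (Delta : seq 'rV[int]_r).
Hypothesis r_gt0 : (0 < r)%N.
Hypothesis Delta_sum0 : \sum_(v <- Delta) v = 0.
Hypothesis dimE : (r + n + size Delta - 3 = n * r)%N.
Notation N := (n + size Delta)%N.
Notation i0 := (root_end n_gt0 Delta).
Notation Omega := [set~ i0].
Variables (F : {set {set 'I_N}}) (l : {set 'I_N} -> R) (p : 'rV[R]_r).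
Hypothesis famF : tree_family Omega F.
Hypothesis l_gt0 : forall I, I \in F -> 0 < l I.
Implicit Types (I K : {set 'I_N}) (i j : 'I_N).

Notation nodes := (Omega |: F).

Let Omega_gt1 : (1 < #|Omega|)%N.
Proof. by have := ends_ge3 n_gt0 r_gt0 dimE; rewrite card_Omega; lia. Qed.

Let OmegaF : Omega \notin F.
Proof. by apply/negP; have [_ h] := tree_familyP famF; move=> /h[_ _]; rewrite eqxx. Qed.

Let node_sub K : K \in nodes -> K \subset Omega.
Proof. by have [_ h] := tree_familyP famF; case/setU1P=> [->|/h[]]. Qed.

Let node_gt1 K : K \in nodes -> (1 < #|K|)%N.
Proof. by have [_ h] := tree_familyP famF; case/setU1P=> [->|/h[]]. Qed.

Let node_cmp K K' i : K \in nodes -> K' \in nodes -> i \in K -> i \in K' ->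
  (K \subset K') || (K' \subset K).
Proof.
have [lamF h] := tree_familyP famF.
case/setU1P=> [->|KF] /[dup] K'n /setU1P[->|K'F] iK iK'; rewrite ?subxx //.
- by rewrite (node_sub K'n) orbT.
- by have [->] := h K KF.
- exact: nested_meet (lamF K K' KF K'F) iK iK'.
Qed.

Let node_proper K : K \in F -> K \proper Omega.
Proof. by have [_ h] := tree_familyP famF; move=> /h[s _ ne]; rewrite properEneq ne. Qed.

Definition least_node (Q : pred {set 'I_N}) : {set 'I_N} :=
  [arg min_(K < Omega | (K \in nodes) && Q K) #|K|].

Let least_nodeP (Q : pred {set 'I_N}) i : Q Omega -> (forall K, Q K -> i \in K) ->
  [/\ least_node Q \in nodes, Q (least_node Q) &
    forall K, K \in nodes -> Q K -> least_node Q \subset K].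
Proof.
move=> QO Qi; rewrite /least_node; case: arg_minnP => [|K0 /andP[K0n QK0] minK].
  by rewrite setU11.
split=> // K Kn QK; have /orP[//|s] := node_cmp K0n Kn (Qi _ QK0) (Qi _ QK).
have -> : K = K0; last exact: subxx.
by apply/eqP; rewrite eqEcard s minK // Kn.
Qed.

Definition parent I := least_node (fun K => I \proper K).

Definition holder i := if i == i0 then Omega else least_node (fun K => i \in K).

Let parentP I : I \in F ->
  [/\ parent I \in nodes, I \proper parent I & forall K, K \in nodes -> I \proper K -> parent I \subset K].
Proof.
move=> IF; have /ltnW/card_gt0P[i iI] := node_gt1 (setU1r _ IF).
apply: (@least_nodeP _ i); first exact: node_proper.
by move=> K /proper_sub/subsetP; apply.
Qed.

Let holderP i : i != i0 ->
  [/\ holder i \in nodes, i \in holder i & forall K, K \in nodes -> i \in K -> holder i \subset K].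
Proof.
move=> ni; rewrite /holder (negPf ni); apply: (@least_nodeP _ i) => //.
by rewrite !inE.
Qed.

Definition node : finType := {K : {set 'I_N} | K \in nodes}.
Implicit Types (a b c W : node).

Definition root_node : node := exist _ Omega (setU11 Omega F).

Definition to_node K : node := insubd root_node K.

Definition up a : node := to_node (parent (val a)).

Definition real_graph : mgraph N :=
  @MGraph N node [set [set a; up a] | a : node & val a \in F] (fun i => to_node (holder i)).

Let to_nodeK K : K \in nodes -> val (to_node K) = K.
Proof. by move=> Kn; rewrite /to_node val_insubd Kn. Qed.

Let val_up a : val a \in F -> val (up a) = parent (val a).
Proof. by move=> aF; rewrite /up to_nodeK //; have [] := parentP aF. Qed.

Let up_proper a : val a \in F -> val a \proper val (up a).
Proof. by move=> aF; rewrite val_up //; have [] := parentP aF. Qed.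

Let up_least a b : val a \in F -> val a \proper val b -> val (up a) \subset val b.
Proof. by move=> aF ab; rewrite val_up //; have [_ _] := parentP aF; apply => //; apply: valP. Qed.

Let node_F a : (val a \in F) = (a != root_node).
Proof.
have -> : (a == root_node) = (val a == Omega) by [].
have [->|ne] := eqVneq (val a) Omega; first exact/negbTE.
by have := valP a; rewrite in_setU1 (negPf ne).
Qed.

Let up_edge_inj a b : val a \in F -> val b \in F -> [set a; up a] = [set b; up b] -> a = b.
Proof.
move=> aF bF e; have : a \in [set b; up b] by rewrite -e !inE eqxx.
have : b \in [set a; up a] by rewrite e !inE eqxx.
rewrite !inE => /orP[/eqP->//|/eqP eb] /orP[/eqP//|/eqP ea].
have := up_proper aF; rewrite -eb ea => /proper_sub s.
by have := up_proper bF; rewrite properE s andbF.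
Qed.

Let edgesP a b : reflect ((val a \in F /\ b = up a) \/ (val b \in F /\ a = up b))
  ([set a; b] \in edges real_graph).
Proof.
apply: (iffP imsetP) => [[c + e]|[[aF ->]|[bF ->]]]; last 2 first.
- by exists a; rewrite ?inE.
- by exists b; rewrite ?inE // set2C.
rewrite inE => cF.
have : c \in [set a; b] by rewrite e !inE eqxx.
have : up c \in [set a; b] by rewrite e !inE eqxx orbT.
have ne : c == up c = false.
  by apply: contraTF (up_proper cF) => /eqP <-; rewrite properxx.
rewrite !inE => /orP[] /eqP e1 /orP[] /eqP e2.
- by move: ne; rewrite e1 -e2 eqxx.
- by right; rewrite -e1 -e2.
- by left; rewrite -e1 -e2.
- by move: ne; rewrite e1 -e2 eqxx.
Qed.

Let up_adj a : val a \in F -> adj (T := real_graph) a (up a).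
Proof. by move=> aF; apply/edgesP; left. Qed.

Let adj_sym : symmetric (adj (T := real_graph)).
Proof. by move=> a b; rewrite /adj /= set2C. Qed.

Let connect_root a : connect (adj (T := real_graph)) a root_node.
Proof.
have [k] := ubnP (N - #|val a|); elim: k a => // k IH a; rewrite ltnS => le.
have [->|ne] := eqVneq a root_node; first exact: connect0.
rewrite -node_F in ne; apply: connect_trans (connect1 (up_adj ne)) (IH _ _).
have lt := proper_card (up_proper ne).
have := max_card (mem (val (up a))); rewrite card_ord => le'.
apply: leq_trans le; apply: ltn_sub2l => //; exact: leq_trans lt le'.
Qed.

(** A vertex of a cycle whose set is smallest has only its parent as a neighbor in
    the cycle, but it needs two neighbors. *)
Let real_cycles (c : seq node) : ucycle (adj (T := real_graph)) c -> (size c < 3)%N.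
Proof.
move=> uc; rewrite ltnNge; apply/negP=> szc.
have [c0 c0c] : exists c0, c0 \in c by case: c szc {uc} => // c0 c _; exists c0; rewrite mem_head.
have [a ac mina] := @arg_minnP _ c0 (fun a => a \in c) (fun a => #|val a|) c0c.
have [k c' ec] := rot_to ac.
have : ucycle (adj (T := real_graph)) (a :: c') by rewrite -ec rot_ucycle.
have {szc} : (2 <= size c')%N by move: szc; rewrite -(size_rot k) ec.
have {}mina b : b \in c' -> adj (T := real_graph) a b -> b = up a.
  move=> bc /edgesP[[_ //]|[bF ea]].
  have : (#|val a| <= #|val b|)%N by apply: mina; rewrite -(mem_rot k) ec inE bc orbT.
  by rewrite leqNgt ea proper_card // up_proper.
case: c' mina {ec} => // x [//|y c'] mina _ /andP[/= /andP[ax]].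
rewrite rcons_path => /andP[_ /andP[_ la]] /andP[_ /andP[nx _]].
have ex : x = up a by apply: mina; rewrite ?mem_head.
have ey : last y c' = up a.
  apply: mina; first by rewrite inE mem_last orbT.
  by rewrite adj_sym.
by case/negP: nx; rewrite ex -ey mem_last.
Qed.

Let holder_node i : val (to_node (holder i)) = holder i.
Proof.
apply: to_nodeK; have [->|/holderP[]//] := eqVneq i i0.
by rewrite /holder eqxx setU11.
Qed.

Let footE i W : (to_node (holder i) == W) = (holder i == val W).
Proof. by rewrite -[in RHS]holder_node val_eqE. Qed.

Let child W a := (val a \in F) && (up a == W).

Let child_exists W i : i \in val W -> holder i != val W -> exists2 a, child W a & i \in val a.
Proof.
move=> iW neW; have ni : i != i0.
  by have := subsetP (node_sub (valP W)) i iW; rewrite !inE.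
have [hn ih hmin] := holderP ni.
(* The child is the largest node strictly below W that contains i. *)
pose Q a := (i \in val a) && (val a \proper val W).
have Qh : Q (to_node (holder i)).
  by rewrite /Q holder_node ih properEneq neW (hmin _ (valP W) iW).
have [a /andP[ia aW] maxa] := @arg_maxnP _ (to_node (holder i)) Q (fun a => #|val a|) Qh.
have aF : val a \in F.
  rewrite node_F; apply: contraTneq aW => -> /=.
  by apply/negP=> /proper_sub_trans/(_ (node_sub (valP W))); rewrite properxx.
exists a => //; rewrite /child aF /= -val_eqE /=.
have sW : val (up a) \subset val W by apply: up_least.
rewrite eqEproper sW /=; apply/negP=> pW.
have : Q (up a) by rewrite /Q pW (subsetP (proper_sub (up_proper aF))).
by move=> /maxa; apply/negP; rewrite -ltnNge proper_card // up_proper.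
Qed.

Let child_proper W a : child W a -> val a \proper val W.
Proof. by case/andP=> aF /eqP<-; apply: up_proper. Qed.

Let child_uniq W a b i : child W a -> child W b -> i \in val a -> i \in val b -> a = b.
Proof.
move=> ca cb ia ib; apply/eqP; rewrite -val_eqE /=; apply/negPn/negP=> ne.
have key x y : child W x -> child W y -> val x \subset val y -> val x != val y -> False.
  move=> cx /child_proper py s nexy.
  have /andP[xF /eqP ux] := cx.
  have : val (up x) \subset val y by apply: up_least => //; rewrite properEneq nexy.
  by rewrite ux => s'; move: py; rewrite properE s' andbF.
by have /orP[s|s] := node_cmp (valP a) (valP b) ia ib; [apply: (key a b)|apply: (key b a)]; rewrite // eq_sym.
Qed.

(** The set of a vertex is the disjoint union of the sets of its children and of the
    ends at the vertex; weighted with the directions this is balancing. *)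
Let holder_count W i : i != i0 ->
  (i \in val W : nat) = ((holder i == val W) + \sum_(a | child W a) (i \in val a : nat))%N.
Proof.
move=> ni; have [hn ih hmin] := holderP ni.
have [iW|niW] := boolP (i \in val W); last first.
  rewrite big1 ?addn0 => [|a /child_proper/proper_sub/subsetP s].
    by case: eqP niW => // <-; rewrite ih.
  by apply/eqP; rewrite eqb0; apply: contra niW; apply: s.
have [eW|neW] := eqVneq (holder i) (val W).
  rewrite big1 // => a /[dup] ca /child_proper pa; apply/eqP; rewrite eqb0.
  apply/negP=> /(hmin _ (valP a)); rewrite eW => s.
  by move: pa; rewrite properE s andbF.
have [a ca ia] := child_exists iW neW; rewrite add0n (bigD1 a) //= ia big1 // => b /andP[cb neb].
by apply/eqP; rewrite eqb0; apply: contra neb => ib; rewrite (child_uniq cb ca ib ia).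
Qed.

(** The set of W has two elements, and each of its children misses an element of
    it. *)
Let two_children_or_ends W : (2 <= #|[set a | child W a]| + #|[set i | (holder i == val W) && (i != i0)]|)%N.
Proof.
set A := [set a | _]; set B := [set i | _].
have inW i : i \in val W -> i != i0.
  by move=> /(subsetP (node_sub (valP W))); rewrite !inE.
have [x [y [xW yW nexy]]] := card_gt1P (node_gt1 (valP W)).
have [hx|nhx] := eqVneq (holder x) (val W).
  have xB : x \in B by rewrite inE hx eqxx inW.
  have [hy|nhy] := eqVneq (holder y) (val W).
    have yB : y \in B by rewrite inE hy eqxx inW.
    by apply: leq_trans (leq_addl _ _); apply/card_gt1P; exists x, y.
  have [a ca _] := child_exists yW nhy.
  by apply: (@leq_add 1 1); apply/card_gt0P; [exists a; rewrite inE|exists x].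
have [a ca xa] := child_exists xW nhx.
have [z zW za] : exists2 z, z \in val W & z \notin val a.
  by have /properP[_ [z]] := child_proper ca; exists z.
have [hz|nhz] := eqVneq (holder z) (val W).
  by apply: (@leq_add 1 1); apply/card_gt0P; [exists a|exists z]; rewrite inE ?hz ?eqxx ?inW.
have [b cb zb] := child_exists zW nhz.
apply: leq_trans (leq_addr _ _); apply/card_gt1P; exists a, b; rewrite !inE; split=> //.
by apply: contraNneq za => ->.
Qed.

Let real_valence W : (3 <= valence (T := real_graph) W)%N.
Proof.
rewrite /valence; set EW := [set E in _ | _]; set IW := [set i | _].
have two := two_children_or_ends W; set A := [set a | _] in two; set B := [set i | _] in two.
have sB : B = IW :\ i0.
  by apply/setP=> i; rewrite !inE /= footE andbC.
have cA : #|A| = #|[set [set a; up a] | a in A]|.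
  rewrite card_in_imset // => a b; rewrite !inE => /andP[aF _] /andP[bF _].
  exact: up_edge_inj.
have sA : [set [set a; up a] | a in A] \subset EW.
  apply/subsetP=> _ /imsetP[a /[1!inE] /andP[aF /eqP ua] ->].
  by rewrite !inE ua eqxx orbT andbT; apply/imsetP; exists a; rewrite ?inE ?ua.
have [eW|neW] := eqVneq W root_node.
  have : i0 \in IW by rewrite inE /= footE /holder eqxx eW.
  rewrite (cardsD1 i0 IW) => ->; rewrite addnCA add1n ltnS -sB.
  by apply: leq_trans two _; rewrite leq_add2r cA subset_leq_card.
have i0W : i0 \notin IW.
  by rewrite inE /= footE /holder eqxx; apply: contraNN neW => /eqP e; apply/eqP/val_inj.
have EWu : [set W; up W] \in EW.
  rewrite !inE eqxx andbT; apply/imsetP; exists W; rewrite ?inE //.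
  by rewrite node_F.
rewrite (cardsD1 [set W; up W] EW) EWu add1n addSn ltnS.
apply: leq_trans two _; rewrite sB (setDidPl _) ?leq_add2r; last by rewrite disjoint_sym disjoints1.
rewrite cA subset_leq_card //; apply/subsetP=> E EA; rewrite in_setD1 (subsetP sA) // andbT.
case/imsetP: EA => a /[1!inE] /andP[aF /eqP ua] ->; apply/eqP=> e.
have WF : val W \in F by rewrite node_F.
have := up_edge_inj aF WF e => eaW; subst a.
by have := up_proper WF; rewrite ua properxx.
Qed.

Lemma real_tree : is_tree real_graph.
Proof.
split=> [E /imsetP[a /[1!inE] aF ->]|a b|c|W].
- rewrite cards2; suff -> : a != up a by [].
  by apply: contraTneq (up_proper aF) => e; rewrite -e properxx.
- apply: connect_trans (connect_root a) _.
  by rewrite (sym_connect_sym adj_sym); apply: connect_root.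
- exact: real_cycles.
- exact: real_valence.
Qed.

Let foot_root : foot real_graph i0 = root_node.
Proof. by apply/eqP; rewrite /= footE /holder !eqxx. Qed.

Let real_far a b : val a \in F ->
  far (foot real_graph i0) [set a; up a] b = (val b \subset val a).
Proof.
move=> aF; apply: (far_unique real_tree (chi := fun b : node => val b \subset val a)).
- by rewrite foot_root; apply/negbTE; have /andP[] := node_proper aF.
- have key c : val c \in F ->
      (val c \subset val a) (+) (val (up c) \subset val a) = ([set c; up c] == [set a; up a]).
    move=> cF; have [->|ne] := eqVneq c a.
      by rewrite subxx eqxx; have /andP[_ /negPf->] := up_proper aF.
    have -> : ([set c; up c] == [set a; up a]) = false.
      by apply: contraNF ne => /eqP/up_edge_inj ->.
    have [s|ns] := boolP (val (up c) \subset val a).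
      by rewrite (subset_trans (proper_sub (up_proper cF)) s).
    rewrite addbF; apply: contraNF ns => s; apply: up_least => //.
    by rewrite properEneq s val_eqE ne.
  by move=> c d /edgesP[[cF ->]|[dF ->]]; [exact: key|rewrite addbC set2C; exact: key].
Qed.

Let real_endset a : val a \in F -> endset (T := real_graph) i0 [set a; up a] = val a.
Proof.
move=> aF; apply/setP=> i; rewrite inE (real_far _ aF) /= holder_node.
have [->|ni] := eqVneq i i0.
  rewrite /holder eqxx; have /andP[s /negPf->] := node_proper aF.
  by apply/esym/negP=> /(subsetP s); rewrite !inE eqxx.
have [hn ih hmin] := holderP ni.
by apply/idP/idP=> [/subsetP/(_ i ih)//|]; apply: hmin; apply: valP.
Qed.

Let node_edge I : I \in F -> exists2 a : node, val a = I & val a \in F.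
Proof. by move=> IF; exists (to_node I); rewrite to_nodeK // inE IF orbT. Qed.

Let real_splits : end_splits real_graph i0 = F.
Proof.
apply/setP=> I; apply/imsetP/idP=> [[E /imsetP[a /[1!inE] aF ->] ->]|/node_edge[a <- aF]].
  by rewrite real_endset.
by exists [set a; up a]; rewrite ?real_endset //; apply/edgesP; left.
Qed.

(** The endpoint of an edge that is farther from the root. *)
Definition lower_node (E : {set node}) : node :=
  odflt root_node [pick a : node | (val a \in F) && (E == [set a; up a])].

Let lower_nodeE a : val a \in F -> lower_node [set a; up a] = a.
Proof.
move=> aF; rewrite /lower_node; case: pickP => [b /andP[bF /eqP/up_edge_inj->] //|/(_ a)].
by rewrite aF eqxx.
Qed.

Definition real_len (E : {set node}) : R := l (val (lower_node E)).

(** The curve is integrated from the root along the edges above a vertex. *)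
Definition real_pos (a : node) : 'rV[R]_r :=
  p + \sum_(I in F | val a \subset I) l I *: map_mx intr (edir I).

Definition real_dir (E : {set node}) (W : node) : 'rV[int]_r :=
  if W == lower_node E then - edir (val (lower_node E)) else edir (val (lower_node E)).

Let real_len_gt0 E : E \in edges real_graph -> 0 < real_len E.
Proof. by case/imsetP=> a /[1!inE] aF ->; rewrite /real_len lower_nodeE // l_gt0. Qed.

Let up_neq a : val a \in F -> up a == a = false.
Proof. by move=> aF; apply: contraTF (up_proper aF) => /eqP->; rewrite properxx. Qed.

Let real_pos_up a : val a \in F ->
  real_pos a = real_pos (up a) + l (val a) *: map_mx intr (edir (val a)).
Proof.
move=> aF; rewrite /real_pos -addrA; congr (_ + _); rewrite (bigD1 (val a)) /=; last first.
  by rewrite aF subxx.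
rewrite addrC; congr (_ + _); apply: eq_bigl => I; have [IF|//] := boolP (I \in F).
have [b eb bF] := node_edge IF; rewrite -eb /=; apply/andP/idP=> [[s ne]|s].
  by apply: up_least; rewrite // properEneq s andbT eq_sym.
split; first exact: subset_trans (proper_sub (up_proper aF)) s.
by apply: contraTneq s => ->; have /andP[] := up_proper aF.
Qed.

Let real_balance W : \sum_(E in edges real_graph | W \in E) real_dir E W
  + \sum_(i | foot real_graph i == W) end_dir i = 0.
Proof.
have -> : \sum_(E in edges real_graph | W \in E) real_dir E W =
    \sum_(a | (val a \in F) && (W \in [set a; up a])) real_dir [set a; up a] W.
  rewrite big_mkcondr big_imset => [|a b /[!inE]] /=; last exact: up_edge_inj.
  by rewrite [RHS]big_mkcondr; apply: eq_bigl => a; rewrite inE.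
have -> : \sum_(a | (val a \in F) && (W \in [set a; up a])) real_dir [set a; up a] W =
    \sum_(a | child W a) edir (val a) - edir (val W).
  rewrite (bigID (fun a => a == W)) /= addrC; congr (_ + _).
    apply: eq_big => [a|a /andP[/andP[aF _] ne]]; last by rewrite /real_dir lower_nodeE // eq_sym (negPf ne).
    rewrite !inE /child; have [aF|//] := boolP (val a \in F); rewrite /= (eq_sym W a).
    have [eW|ne] := eqVneq a W; last by rewrite andbT eq_sym.
    by rewrite andbF -eW up_neq.
  have [WF|nWF] := boolP (val W \in F).
    rewrite (big_pred1 W) => [|a]; first by rewrite /real_dir lower_nodeE // eqxx.
    by have [->|ne] := eqVneq a W; rewrite /= ?andbF ?(negPf ne) ?andbT ?WF ?inE ?eqxx.
  rewrite big_pred0 => [|a]; last first.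
    by have [->|ne] := eqVneq a W; rewrite /= ?andbF ?(negPf nWF).
  move: nWF; rewrite node_F negbK => /eqP->.
  by rewrite (edir_Omega n_gt0 Delta_sum0) oppr0.
have count i : i != i0 -> end_dir i *+ (i \in val W) =
    end_dir i *+ (holder i == val W) + \sum_(a | child W a) end_dir i *+ (i \in val a) :> 'rV[int]_r.
  by move=> ni; rewrite (holder_count W ni) mulrnDr sumrMnr.
have edirE I : edir I = \sum_(i < N) end_dir i *+ (i \in I) :> 'rV[int]_r.
  by rewrite /edir big_mkcond; apply: eq_bigr => i _; case: ifP.
have eW : edir (val W) = \sum_(i < N) end_dir i *+ (holder i == val W) + \sum_(a | child W a) edir (val a)
    :> 'rV[int]_r.
  rewrite edirE (eq_bigr _ (fun a _ => edirE (val a))) exchange_big /= -big_split /=.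
  apply: eq_bigr => i _; have [->|ni] := eqVneq i i0; last exact: count.
  rewrite end_dir_marked !mul0rn add0r big1 // => a _; exact: mul0rn.
rewrite eW [X in _ + X]big_mkcond opprD addrCA subrr addr0 addrC -sumrB big1 // => i _; rewrite /= footE.
by case: ifP => _; rewrite ?subrr ?subr0.
Qed.

Let real_is_map : is_tropical_map (T := real_graph) real_len real_pos.
Proof.
exists real_dir; split=> [a b /edgesP[[aF ->]|[bF ->]]|W]; last exact: real_balance.
  rewrite /real_dir /real_len lower_nodeE // eqxx [in RHS]real_pos_up // map_mxN scalerN.
  by rewrite addrK.
by rewrite set2C /real_dir /real_len lower_nodeE // up_neq // real_pos_up.
Qed.

Lemma realization : exists C : curve R n Delta,
  [/\ end_splits C i0 = F, forall I, I \in F -> split_len n_gt0 C I = l I &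
      pos (foot C i0) = p].
Proof.
exists (Curve real_tree real_len_gt0 real_is_map); split=> [|I IF|].
- exact: real_splits.
- have [a <- aF] := node_edge IF; rewrite -[X in split_len _ _ X](real_endset aF) split_lenE.
    by rewrite /= /real_len lower_nodeE.
  by apply/edgesP; left.
rewrite [foot _ _]foot_root /= /real_pos big1 ?addr0 // => I /andP[IF].
by have /andP[_ /negPf->] := node_proper IF.
Qed.

End Realization.

(** * Indices of subgroups *)
Section Index.
Variable U : zmodType.
Implicit Types (L : set U).

Definition is_subgroup L := L 0 /\ forall x y, L x -> L y -> L (x - y).

Lemma is_subgroupN L x : is_subgroup L -> L x -> L (- x).
Proof. by case=> L0 LB Lx; rewrite -sub0r; apply: LB. Qed.

Lemma is_subgroupD L x y : is_subgroup L -> L x -> L y -> L (x + y).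
Proof. by move=> gL Lx Ly; rewrite -[y]opprK; apply: gL.2 => //; apply: is_subgroupN. Qed.

(** The k cosets of L' in L are coded by the elements of a finite type K.  Unlike
    [subgroup_index], this also says that the index is finite. *)
Definition has_index L L' k := exists (K : finType) (f : U -> K),
  [/\ forall x y, L x -> L y -> f x = f y <-> L' (y - x),
      forall c, exists2 x, L x & f x = c & #|K| = k].

Lemma has_index_eq L L' k : is_subgroup L' -> has_index L L' k -> subgroup_index L L' = k.
Proof.
move=> gL' [K [f [fE fS <-]]]; rewrite /subgroup_index.
have [g gS] : {g : K -> U & forall c, L (g c) /\ f (g c) = c}.
  by apply: (@choice _ _ (fun c x => L x /\ f x = c)) => c; have [x Lx fx] := fS c; exists x.
pose coset c := [set y | L' (y - g c)].
have -> : [set [set y | L' (y - x)] | x in L] = [set coset c | c in [set: K]].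
  apply/classical_sets.seteqP; split=> [_ [x Lx <-]|_ [c _ <-]].
    exists (f x) => //; have [Lg fg] := gS (f x).
    have /(fE _ _ Lg Lx) h := fg.
    apply/classical_sets.seteqP; split=> y /= Ly.
      by have := gL'.2 _ _ Ly h; rewrite opprB addrA subrK.
    by have := is_subgroupD gL' Ly h; rewrite addrA subrK.
  by exists (g c) => //; have [] := gS c.
rewrite fset_set_image; last exact: finite_finset.
rewrite card_imfset => [|c c' /classical_sets.seteqP[_ /(_ (g c'))]] /=; last first.
  rewrite /coset /= subrr => /(_ gL'.1); have [Lc fc] := gS c; have [Lc' fc'] := gS c'.
  by move=> /(fE _ _ Lc Lc'); rewrite fc fc'.
have -> : fset_set [set: K] = [fset x | x in enum K]%fset.
  apply/fsetP=> x; rewrite in_fset_set; last exact: finite_finset.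
  by rewrite mem_set // !in_fset mem_enum.
by rewrite -[LHS]/(#|` _|) card_fseq undup_id ?enum_uniq // -cardE.
Qed.

(** Codes of L modulo L'' restrict to L' and can be grouped into the classes modulo
    L'; a class is represented by one of its codes, picked in a canonical way. *)
Lemma has_index_tower L L' L'' k : is_subgroup L -> is_subgroup L' -> is_subgroup L'' ->
    (forall x, L'' x -> L' x) -> (forall x, L' x -> L x) -> has_index L L'' k ->
  exists a b, [/\ has_index L L' a, has_index L' L'' b & k = (a * b)%N].
Proof.
move=> gL gL' gL'' s' s [K [f [fE fS <-]]].
pose PK c := `[< exists2 x, L' x & f x = c >].
pose K' : finType := {c : K | PK c}.
have [c1 c1P] : {c1 : K | PK c1}.
  by exists (f 0); apply/asboolP; exists 0 => //; apply: gL'.1.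
pose f' x : K' := insubd (exist _ c1 c1P) (f x).
have f'E x : L' x -> val (f' x) = f x.
  by move=> Lx; rewrite val_insubd; case: ifP => // /negP[]; apply/asboolP; exists x.
have ind' : has_index L' L'' #|{: K'}|.
  exists K', f'; split=> // [x y Lx Ly|[c cP]].
    rewrite -(fE x y (s _ Lx) (s _ Ly)) -!f'E //; split=> [->//|]; exact: val_inj.
  have [x Lx fx] := asboolW cP; exists x => //; apply: val_inj; by rewrite f'E.
pose rep x := [pick c : K | `[< exists y, [/\ L y, f y = c & L' (y - x)] >]].
have repE x y : L x -> L y -> rep x = rep y <-> L' (y - x).
  move=> Lx Ly; split=> [|Lxy]; last first.
    apply: eq_pick => c; apply: asbool_equiv_eq; split=> -[z [Lz fz Lzx]]; exists z; split=> //.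
      by have := gL'.2 _ _ Lzx Lxy; rewrite opprB addrA subrK.
    by have := is_subgroupD gL' Lzx Lxy; rewrite addrA subrK.
  rewrite /rep; case: pickP => [c /asboolP[z [Lz fz Lzx]]|/(_ (f x))/asboolP[]]; last first.
    by exists x; rewrite subrr; split=> //; apply: gL'.1.
  case: pickP => // c' /asboolP[z' [Lz' fz' Lzy']] [ecc].
  have : L' (z' - z) by apply: s'; apply/fE; rewrite // fz fz'.
  move=> h; have := gL'.2 _ _ (is_subgroupD gL' h Lzx) Lzy'.
  by rewrite [z' - z + _]addrA subrK opprB [z' - x + _]addrC addrA subrK.
(* The class of x modulo L' is coded by rep x. *)
pose Q (o : option K) := `[< exists2 x, L x & rep x = o >].
pose K2 : finType := {o : option K | Q o}.
have [o1 o1P] : {o1 : option K | Q o1}.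
  by exists (rep 0); apply/asboolP; exists 0 => //; apply: gL.1.
pose f2 x : K2 := insubd (exist _ o1 o1P) (rep x).
have f2E x : L x -> val (f2 x) = rep x.
  by move=> Lx; rewrite val_insubd; case: ifP => // /negP[]; apply/asboolP; exists x.
have f2_iff x y : L x -> L y -> f2 x = f2 y <-> L' (y - x).
  by move=> Lx Ly; rewrite -(repE x y) // -!f2E //; split=> [->//|]; apply: val_inj.
have f2_onto (c : K2) : exists x, L x /\ f2 x = c.
  case: c => o oP; have [x Lx rx] := asboolW oP; exists x; split=> //.
  by apply: val_inj; rewrite f2E.
have f'_iff x y : L' x -> L' y -> f' x = f' y <-> L'' (y - x).
  move=> Lx Ly; rewrite -(fE x y (s _ Lx) (s _ Ly)) -!f'E //; split=> [->//|]; exact: val_inj.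
have f'_onto (c : K') : exists x, L' x /\ f' x = c.
  case: c => c cP; have [x Lx rx] := asboolW cP; exists x; split=> //.
  by apply: val_inj; rewrite f'E.
have [g2 g2P] := choice f2_onto; have [g' g'P] := choice f'_onto.
exists #|{: K2}|, #|{: K'}|; split=> //.
  by exists K2, f2; split=> // c; have [x []] := f2_onto c; exists x.
rewrite -card_prod; symmetry.
pose h (c : K2 * K') := f (g2 c.1 + g' c.2).
suff /bij_eq_card : bijective h by [].
apply: inj_card_bij.
  move=> [c d] [c' d']; rewrite /h /= => /fE.
  have [Lc fc] := g2P c; have [Ld fd] := g'P d; have [Lc' fc'] := g2P c'; have [Ld' fd'] := g'P d'.
  move=> /(_ (is_subgroupD gL Lc (s _ Ld)) (is_subgroupD gL Lc' (s _ Ld'))).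
  rewrite opprD addrACA => h1.
  have ec : c = c'.
    rewrite -fc -fc'; apply/f2_iff => //.
    have := gL'.2 _ _ (s' _ h1) (gL'.2 _ _ Ld' Ld).
    by rewrite addrK.
  subst c'; congr (_, _); rewrite -fd -fd'; apply/f'_iff => //.
  by move: h1; rewrite subrr add0r.
have [r rP] : {r : K -> U & forall c, L (r c) /\ f (r c) = c}.
  by apply: (@choice _ _ (fun c x => L x /\ f x = c)) => c; have [x Lx fx] := fS c; exists x.
pose q c : K2 * K' := (f2 (r c), f' (r c - g2 (f2 (r c)))).
apply: (@leq_card _ _ q) => c c' [e1].
have [Lc fc] := rP c; have [Lc' fc'] := rP c'.
have [Lg fg] := g2P (f2 (r c)); have [Lg' fg'] := g2P (f2 (r c')).
have h1 := (f2_iff _ _ Lg Lc).1 fg; have h1' := (f2_iff _ _ Lg' Lc').1 fg'.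
move=> /(f'_iff _ _ h1 h1').
rewrite e1 opprB addrA subrK => h2; rewrite -fc -fc'; exact/fE.
Qed.

End Index.

(** The map psi induces an isomorphism from L / L' onto M / M'. *)
Lemma has_index_morph (U V : zmodType) (L L' : set U) (M M' : set V) (psi : U -> V) k :
    (forall x, L x -> M (psi x)) ->
    (forall z, M z -> exists2 x, L x & M' (z - psi x)) ->
    (forall x y, L x -> L y -> M' (psi y - psi x) <-> L' (y - x)) -> is_subgroup M' ->
    is_subgroup M ->
  has_index M M' k -> has_index L L' k.
Proof.
move=> LM onto LL' gM' gM [K [f [fE fS cK]]]; exists K, (f \o psi); split=> //.
  by move=> x y Lx Ly; rewrite -LL' //=; apply: fE; apply: LM.
move=> c; have [z Mz fz] := fS c; have [x Lx h] := onto z Mz.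
by exists x => //=; rewrite -fz; apply/fE => //; apply: LM.
Qed.

(** In Smith normal form the quotient is a product of cyclic groups Z / d_j. *)
Lemma index_det m (M : 'M[int]_m) : \det M != 0 ->
  has_index [set: 'rV[int]_m] [set y | exists x, y = x *m M] `|\det M|%N.
Proof.
have [L uL [Q uQ [d _ ->]]] := int_Smith_normal_form M.
set D := \matrix_(_, _) _.
have eD : D = diag_mx (\row_(j < m) d`_j).
  by apply/matrixP=> i j; rewrite !mxE.
have detD : \det D = \prod_(j < m) d`_j.
  by rewrite eD det_diag; apply: eq_bigr => j _; rewrite mxE.
have abs_unit (A : 'M[int]_m) : A \in unitmx -> `|\det A|%N = 1%N.
  move=> uA; have := congr1 absz (congr1 determinant (mulmxV uA)).
  by rewrite det_mulmx det1 abszM => /eqP; rewrite muln_eq1 => /andP[/eqP].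
have detM : `|\det (L *m D *m Q)|%N = (\prod_(j < m) absz (d`_j)%R)%N.
  rewrite !det_mulmx !abszM (abs_unit L uL) (abs_unit Q uQ) mul1n muln1 detD.
  by rewrite (big_morph absz abszM (erefl _)).
rewrite detM; move/eqP => dM.
have d0 (j : 'I_m) : d`_j != 0.
  apply/eqP=> dj; apply: dM; apply/eqP; rewrite -absz_eq0 detM; apply/eqP.
  by rewrite (bigD1 j) //= dj mul0n.
pose K : finType := {dffun forall j : 'I_m, 'I_(absz (d`_j)%R)}.
have modlt (j : 'I_m) (a : int) : (absz (a %% d`_j)%Z < absz (d`_j)%R)%N.
  by rewrite -ltz_nat !abszE ger0_norm ?modz_ge0 ?d0 // ltz_mod ?d0.
pose f (x : 'rV[int]_m) : K := [ffun j : 'I_m => Ordinal (modlt j ((x *m invmx Q) 0 j))].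
exists K, f; split=> [x y _ _|c|].
- have -> : f x = f y <-> forall j : 'I_m, (d`_j %| (((y - x) *m invmx Q) 0 j)%R)%Z.
    split=> [/ffunP e j|e].
      have := congr1 val (e j); rewrite !ffunE /= => /(congr1 Posz).
      rewrite !abszE !ger0_norm ?modz_ge0 ?d0 // => /esym/eqP.
      by rewrite eqz_mod_dvd mulmxBl !mxE.
    apply/ffunP=> j; rewrite !ffunE; apply: val_inj => /=; congr absz.
    by apply/esym/eqP; rewrite eqz_mod_dvd; have := e j; rewrite mulmxBl !mxE.
  split=> [h|[z e] j]; last first.
    by rewrite e !mulmxA mulmxK // eD mul_mx_diag !mxE dvdz_mull.
  pose X := (y - x) *m invmx Q; pose w := \row_j ((X 0 j)%R %/ d`_j)%Z.
  exists (w *m invmx L); rewrite !mulmxA mulmxKV //.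
  rewrite -[LHS](mulmxKV uQ) -/X; congr (_ *m _); have hX j : (d`_j %| (X 0 j)%R)%Z by apply: h.
  by clearbody X; apply/rowP=> j; rewrite eD mul_mx_diag !mxE divzK.
- exists ((\row_j (c j : nat)%:Z) *m Q) => //; apply/ffunP=> j; apply: val_inj.
  rewrite ffunE /= mulmxK // mxE -modz_abs modz_small ?absz_nat //.
  by rewrite ltz_nat ltn_ord.
- rewrite card_dep_ffun foldrE big_map big_enum /=.
  by apply: eq_bigr => j _; rewrite card_ord.
Qed.

(** * Distance vectors and the rays v_I *)
Section QSpace.
Variables (R : realType) (N : nat).
Implicit Types (I : {set 'I_N}).

Definition splitv I : 'rV[R]_(npairs N) := \row_k ((pfst k \in I) != (psnd k \in I))%:R.

Lemma splitvC I : splitv (~: I)%SET = splitv I.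
Proof. by apply/rowP=> k; rewrite !mxE !inE; do 2 case: (_ \in I). Qed.

Lemma dist_vec_splits (T : mgraph N) (i0 : 'I_N) (l : {set vert T} -> R) : is_tree T ->
  dist_vec l = \sum_(E in edges T) l E *: splitv (endset i0 E).
Proof.
move=> treeT; apply/rowP=> k; rewrite mxE /end_dist (tree_path_length treeT (foot T i0)) summxE.
rewrite big_mkcondr /=; apply: eq_bigr => E _; rewrite !mxE !inE negb_eqb.
by case: (_ (+) _); rewrite ?mulr1 ?mulr0.
Qed.

Lemma split_tree_is_tree I : (1 < #|I| < N.-1)%N -> is_tree (split_tree I).
Proof.
case/andP=> I1 IN.
have adjE a b : adj (T := split_tree I) a b = (a != b).
  rewrite /adj /= in_set1; apply/eqP/idP=> [e|ne].
    by have := cardsT bool; rewrite -e card_bool cards2; case: (a != b).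
  by apply/setP=> c; rewrite !inE; case: a b c ne => [] [] [].
split.
- by move=> E /set1P->; rewrite cardsT card_bool.
- move=> a b; have [->|ne] := eqVneq a b; first exact: connect0.
  by apply: connect1; rewrite adjE.
- move=> c /andP[_ uc]; rewrite ltnS -(card_uniqP uc); apply: leq_trans (max_card _) _.
  by rewrite card_bool.
move=> W; rewrite /valence /=.
have -> : [set E in [set [set: bool]] | W \in E]%SET = [set [set: bool]]%SET.
  by apply/setP=> E; rewrite !inE; case: eqP => // ->; rewrite inE.
rewrite cards1 add1n ltnS; case: W.
  have -> : [set i | (i \in I) == true]%SET = I by apply/setP=> i; rewrite inE eqb_id.
  by [].
have -> : [set i | (i \in I) == false]%SET = (~: I)%SET.
  by apply/setP=> i; rewrite !inE; case: (i \in I).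
by rewrite cardsCs setCK card_ord; move: IN; set c := #|I|; clearbody c; lia.
Qed.

Lemma vI_split I : (1 < #|I| < N.-1)%N -> vI R I = splitv I *m Qproj R N.
Proof.
move=> szI; have treeI := split_tree_is_tree szI; rewrite /vI /phi; congr (_ *m _).
have /andP[/ltnW/card_gt0P[i0 i0I] _] := szI.
rewrite (dist_vec_splits i0 _ treeI) /= big_set1 scale1r -[RHS]splitvC; congr splitv.
apply/setP=> i; rewrite !inE.
have farE : far (T := split_tree I) (foot (split_tree I) i0) [set: bool]%SET =1 negb.
  apply: (far_unique treeI); rewrite ?set11 /= ?i0I // => a b /set1P e.
  have := cardsT bool; rewrite -[in X in X -> _]e cards2 card_bool e eqxx.
  by case: a b {e} => [] [].
by rewrite farE /=.
Qed.

Lemma splits_size I (i0 : 'I_N) : I \subset [set~ i0]%SET -> (1 < #|I|)%N ->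
  I != [set~ i0]%SET -> (1 < #|I| < N.-1)%N.
Proof.
move=> sI I1 ne; rewrite I1 /=; have := proper_card (_ : I \proper [set~ i0]%SET).
by rewrite properEneq ne cardsC1 card_ord; apply.
Qed.

Lemma phi_splits (T : mgraph N) (i0 : 'I_N) (l : {set vert T} -> R) : is_tree T ->
  phi l = \sum_(E in edges T) l E *: vI R (endset i0 E).
Proof.
move=> treeT; rewrite /phi (dist_vec_splits i0 _ treeT) mulmx_suml; apply: eq_bigr => E EE.
have [_ h] := tree_familyP (end_splits_family treeT i0).
have [s I1 ne] := h _ (imset_f _ EE).
by rewrite vI_split ?(splits_size s I1 ne) // scalemxAl.
Qed.

(** The coordinate of a distance vector at the unordered pair {a, b}, and 0 if
    a = b. *)
Definition pair_coord (d : 'rV[R]_(npairs N)) (a b : 'I_N) : R :=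
  \sum_k d 0 k *+ [|| (pfst k == a) && (psnd k == b) | (pfst k == b) && (psnd k == a)].

Lemma pair_coord_linear c d d' a b :
  pair_coord (c *: d + d') a b = c * pair_coord d a b + pair_coord d' a b.
Proof.
rewrite /pair_coord mulr_sumr -big_split /=; apply: eq_bigr => k _.
by rewrite !mxE mulrnDl mulrnAr.
Qed.

Lemma pair_coordE (f : 'I_N -> 'I_N -> R) a b : (forall a b, f a b = f b a) ->
  pair_coord (\row_k f (pfst k) (psnd k)) a b = if a == b then 0 else f a b.
Proof.
move=> fC; have lt (k : 'I_(npairs N)) : (pfst k < psnd k)%N := valP (enum_val k).
rewrite /pair_coord; wlog leab : a b / (a <= b)%N.
  move=> hw; have [le|/ltnW le] := leqP a b; first exact: hw.
  rewrite eq_sym (fC a b) -hw //; apply: eq_bigr => k _; congr (_ *+ _).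
  by rewrite orbC.
have [<-|neab] := eqVneq a b.
  rewrite big1 // => k _; rewrite orbb; case: andP => // -[/eqP e1 /eqP e2].
  by have := lt k; rewrite e1 e2 ltnn.
have ltab : (a < b)%N by rewrite ltn_neqAle leab andbT val_eqE.
pose u : upair N := exist _ (a, b) ltab.
rewrite (bigD1 (enum_rank u)) //= big1 ?addr0 => [|k nek].
  by rewrite mxE /pfst /psnd enum_rankK /= !eqxx mulr1n.
case: orP => //= -[/andP[/eqP e1 /eqP e2]|/andP[/eqP e1 /eqP e2]]; last first.
  by have := lt k; rewrite e1 e2 ltnNge leab.
case/eqP: nek; rewrite -(enum_valK k); congr enum_rank; apply: val_inj => /=.
by rewrite -e1 -e2; exact: surjective_pairing.
Qed.

End QSpace.

(** * The matrix of the evaluation map *)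
Section EvMatrix.
Variables (R : realType) (r n : nat) (n_gt0 : (0 < n)%N) (Delta : seq 'rV[int]_r).
Hypothesis r_gt0 : (0 < r)%N.
Hypothesis Delta_sum0 : \sum_(v <- Delta) v = 0.
Hypothesis dimE : (r + n + size Delta - 3 = n * r)%N.
Notation N := (n + size Delta)%N.
Notation i0 := (root_end n_gt0 Delta).
Notation Omega := [set~ i0]%SET.

Let dirR (i : 'I_N) : 'rV[R]_r := map_mx intr (end_dir i).

(** An explicit linear formula for h(x_j) - h(x_0) from the distances d:
    1/2 sum_i (d(0,i) - d(j,i)) v(x_i).  The edge of I contributes nothing unless it
    separates j from the root; then d(0,i) - d(j,i) is its length for i in I and
    minus its length otherwise, and the directions of the other ends sum to -e_I. *)
Definition gromov (d : 'rV[R]_(npairs N)) : 'rV[R]_(n * r) := mxvec (\matrix_(j < n)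
  (2^-1 *: \sum_i (pair_coord d i0 i - pair_coord d (lshift _ j) i) *: dirR i)).

Lemma gromov_linear : linear gromov.
Proof.
move=> c d d'; rewrite /gromov -linearP; congr mxvec; apply/row_matrixP=> j.
rewrite linearP /= !rowK scalerA mulrC -scalerA -scalerDr; congr (_ *: _).
rewrite scaler_sumr -big_split /=; apply: eq_bigr => i _.
rewrite scalerA -scalerDl !pair_coord_linear; congr (_ *: _); ring.
Qed.

HB.instance Definition _ := GRing.isLinear.Build R _ _ _ gromov gromov_linear.

Let sum_dirR : \sum_i dirR i = 0.
Proof. by rewrite -map_mx_sum sum_end_dir // map_mx0. Qed.

(** For d = Phi a the coefficient is a_0 - a_j for all i but 0 and j, whose directions
    vanish, and the directions sum to 0. *)
Lemma gromov_Phi a : gromov (Phi a) = 0.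
Proof.
apply: (canLR vec_mxK); rewrite linear0; apply/row_matrixP=> j; rewrite rowK row0.
pose f x y := a 0 x + a 0 y.
have fC x y : f x y = f y x by rewrite /f addrC.
have eP : Phi a = \row_k f (pfst k) (psnd k) by [].
rewrite eP (eq_bigr (fun i => (a 0 i0 - a 0 (lshift _ j)) *: dirR i)) => [|i _].
  by rewrite -scaler_sumr sum_dirR !scaler0.
rewrite !pair_coordE //; case: eqVneq => [<-|_].
  by rewrite /dirR end_dir_marked map_mx0 !scaler0.
case: eqVneq => [<-|_]; first by rewrite /dirR end_dir_marked map_mx0 !scaler0.
by rewrite /f; congr (_ *: _); ring.
Qed.

Lemma gromov_splitv (I : {set 'I_N}) : I \subset Omega -> gromov (splitv R I) = toR R (evu I).
Proof.
move=> /subsetP sI; have i0I : i0 \notin I by apply/negP=> /sI; rewrite !inE eqxx.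
rewrite /toR map_mxvec; congr mxvec; apply/row_matrixP=> j; rewrite -map_row !rowK.
pose f x y : R := ((x \in I) != (y \in I))%:R.
have fC x y : f x y = f y x by rewrite /f eq_sym.
have eP : splitv R I = \row_k f (pfst k) (psnd k) by [].
rewrite eP; set x := lshift _ j.
have fxx y : f y y = 0 by rewrite /f eqxx.
have step i : (pair_coord (\row_k f (pfst k) (psnd k)) i0 i - pair_coord (\row_k f (pfst k) (psnd k)) x i)
    = (i \in I)%:R - ((x \in I) != (i \in I))%:R.
  have pc a : pair_coord (\row_k f (pfst k) (psnd k)) a i = f a i.
    by rewrite pair_coordE //; case: eqVneq => [->|//]; rewrite fxx.
  by rewrite !pc /f (negPf i0I); case: (i \in I).
rewrite (eq_bigr _ (fun i _ => congr1 (fun c => c *: dirR i) (step i))).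
have [xI|xI] := boolP (x \in I); last first.
  rewrite map_mx0 big1 ?scaler0 // => i _.
  by case: (i \in I); rewrite /= subrr scale0r.
rewrite (eq_bigr (fun i => 2 *: ((i \in I)%:R *: dirR i) - dirR i)) => [|i _]; last first.
  rewrite negb_eqb; case: (i \in I) => /=.
    by rewrite subr0 !scale1r scaler_nat mulr2n addrK.
  by rewrite scale0r scaler0 !sub0r scaleN1r.
rewrite sumrB sum_dirR subr0 -scaler_sumr scalerA mulVf ?scale1r ?pnatr_eq0 //.
rewrite /edir map_mx_sum [RHS]big_mkcond /=; apply: eq_bigr => i _.
by case: ifP; rewrite ?scale1r ?scale0r.
Qed.

Definition diag_mx_r : 'M[R]_(r, n * r) := \matrix_a diagv n (delta_mx 0 a).

Lemma mul_diag_mx_r p : p *m diag_mx_r = diagv n p.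
Proof.
rewrite mulmx_sum_row; apply: (can_inj vec_mxK); rewrite linear_sum /= mxvecK.
apply/row_matrixP=> j; rewrite linear_sum rowK [RHS]row_sum_delta; apply: eq_bigr => a _.
by rewrite rowK !linearZ /= mxvecK rowK.
Qed.

(** A map vanishing on the image of A factors through the cokernel of A. *)
Lemma coker_factor (F : fieldType) a b c (A : 'M[F]_(a, b)) (D : 'M[F]_(b, c)) : A *m D = 0 ->
  D = cokermx A *m (row_ebase A *m D).
Proof.
move=> AD0; have pid0 : pid_mx (\rank A) *m (row_ebase A *m D) = 0 :> 'M_(a, c).
  apply: (can_inj (mulKmx (col_ebase_unit A))).
  by rewrite mulmx0 !mulmxA mulmx_ebase.
rewrite /cokermx -mulmxA /copid_mx mulmxBl mul1mx.
have -> : pid_mx (\rank A) = pid_mx (\rank A) *m (pid_mx (\rank A) : 'M_(a, b)) :> 'M[F]_b.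
  by rewrite mul_pid_mx minnn (minn_idPr (rank_leq_row A)).
by rewrite -mulmxA pid0 mulmx0 subr0 mulKmx ?row_ebase_unit.
Qed.

(** A matrix as required exists: [gromov] vanishes on the image of [Phi], so it
    descends to Q_N, and together with the diagonal it computes ev. *)
Lemma ev_mx_spec (C : curve R n Delta) : coords n_gt0 C *m ev_mx R n_gt0 Delta = mxvec (ev C).
Proof.
have PhiG : lin1_mx (@Phi R N) *m lin1_mx gromov = 0.
  apply/row_matrixP=> i; rewrite row_mul row0.
  have -> : row i (lin1_mx (@Phi R N)) = Phi (delta_mx 0 i) by apply/rowP=> k; rewrite !mxE.
  by rewrite mul_rV_lin1; apply: gromov_Phi.
pose L0 := col_mx (row_ebase (lin1_mx (@Phi R N)) *m lin1_mx gromov) diag_mx_r.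
rewrite /ev_mx; apply: (xgetPex 0 (P := [set L | forall C : curve R n Delta,
  coords n_gt0 C *m L = mxvec (ev C)])); exists L0 => {}C.
have treeC := curve_tree C.
rewrite /coords mul_row_col mul_diag_mx_r /phi /Qproj -mulmxA -coker_factor // mul_rV_lin1 /=.
rewrite (ev_solves n_gt0) (dist_vec_splits i0 _ treeC) linear_sum (sum_end_splits treeC) /=.
congr (_ + _); apply: eq_bigr => E EE; rewrite linearZ /= gromov_splitv ?split_lenE //.
by have [_ h] := tree_familyP (end_splits_family treeC i0); have [] := h _ (imset_f _ EE).
Qed.

Lemma phi_end_splits (C : curve R n Delta) :
  phi (len (c := C)) = \sum_(I in end_splits C i0) split_len n_gt0 C I *: vI R I.
Proof.
have treeC := curve_tree C; rewrite (phi_splits i0 _ treeC) (sum_end_splits treeC).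
by apply: eq_bigr => E EE; rewrite split_lenE.
Qed.

Lemma ev_mx_diag p : row_mx 0 p *m ev_mx R n_gt0 Delta = diagv n p.
Proof.
have fam0 : tree_family Omega set0.
  by apply/andP; split; [apply/laminarP=> I J|apply/forall_inP=> I]; rewrite inE.
have [|C [sC _ pC]] := @realization R r n n_gt0 Delta r_gt0 Delta_sum0 dimE set0 (fun=> 1) p fam0.
  by move=> I; rewrite inE.
have := ev_mx_spec C; rewrite /coords phi_end_splits (ev_solves n_gt0) sC !big_set0 add0r pC => <-.
by rewrite -pC.
Qed.

(** Although the matrix is only specified on points coming from curves, its value at
    v_I is known: the one-edge curve with root at 0 has these coordinates. *)
Lemma ev_mx_vI (I : {set 'I_N}) : I \subset Omega -> (1 < #|I|)%N -> I != Omega ->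
  row_mx (vI R I) 0 *m ev_mx R n_gt0 Delta = toR R (evu I).
Proof.
move=> sI I1 neI; have famI : tree_family Omega [set I]%SET.
  apply/andP; split; first by apply/laminarP=> J K /set1P-> /set1P->; apply: nestedxx.
  by apply/forall_inP=> J /set1P->; rewrite sI I1.
have [//|C [sC lC pC]] := @realization R r n n_gt0 Delta r_gt0 Delta_sum0 dimE _ (fun=> 1) 0 famI.
have := ev_mx_spec C; rewrite /coords phi_end_splits (ev_solves n_gt0) sC !big_set1 pC.
by rewrite lC ?set11 // !scale1r diagv0 addr0 -[marked_pos _ _]/(pos (foot C i0)) pC.
Qed.

End EvMatrix.

(** * Integral and real spans *)
Section Spans.
Variables (R : realType) (d : nat).
Implicit Types (A P : set 'rV[R]_d).

Lemma is_subgroupMz (U : zmodType) (P : set U) x (c : int) : is_subgroup P -> P x -> P (x *~ c).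
Proof.
move=> gP Px; have posP k : P (x *+ k).
  by elim: k => [|k IH]; [rewrite mulr0n; apply: gP.1|rewrite mulrS; apply: is_subgroupD].
by case: c => k; [apply: posP|rewrite NegzE mulrNz; apply: is_subgroupN => //; apply: posP].
Qed.

Lemma is_subgroup_sum (U : zmodType) (P : set U) (I : Type) (s : seq I) (p : pred I) (f : I -> U) :
  is_subgroup P -> (forall i, p i -> P (f i)) -> P (\sum_(i <- s | p i) f i).
Proof.
by move=> gP h; apply: (big_ind P) => //; [apply: gP.1|move=> *; apply: is_subgroupD].
Qed.

Lemma zspan_ind A P : is_subgroup P -> (forall x, A x -> P x) -> forall x, zspan A x -> P x.
Proof.
move=> gP AP _ [k [c [a [Aa ->]]]]; apply: is_subgroup_sum => // i _.
by apply: is_subgroupMz; rewrite // ; apply: AP.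
Qed.

Lemma zspan_gen A x : A x -> zspan A x.
Proof. by move=> Ax; exists 1, (fun=> 1), (fun=> x); split=> //; rewrite big_ord1. Qed.

Lemma zspan_subgroup A : is_subgroup (zspan A).
Proof.
split; first by exists 0, (fun=> 0), (fun=> 0); rewrite big_ord0; split=> // -[].
move=> _ _ [k [c [a [Aa ->]]]] [k' [c' [a' [Aa' ->]]]].
exists (k + k')%N.
exists (fun i => match fintype.split i with inl j => c j | inr j => - c' j end).
exists (fun i => match fintype.split i with inl j => a j | inr j => a' j end).
split; first by move=> i; case: fintype.split.
rewrite big_split_ord /= -sumrN; congr (_ + _); apply: eq_bigr => i _.
  by rewrite -/(unsplit (inl i)) (unsplitK (inl i)).
by rewrite -/(unsplit (inr i)) (unsplitK (inr i)) mulrNz.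
Qed.

Lemma linspan_gen A x : A x -> linspan A x.
Proof. by move=> Ax; exists 1, (fun=> 1), (fun=> x); split=> //; rewrite big_ord1 scale1r. Qed.

Lemma linspan_comb A c x y : linspan A x -> linspan A y -> linspan A (c *: x + y).
Proof.
move=> [k [e [a [Aa ->]]]] [k' [e' [a' [Aa' ->]]]].
exists (k + k')%N.
exists (fun i => match fintype.split i with inl j => c * e j | inr j => e' j end).
exists (fun i => match fintype.split i with inl j => a j | inr j => a' j end).
split; first by move=> i; case: fintype.split.
rewrite big_split_ord /= scaler_sumr; congr (_ + _); apply: eq_bigr => i _.
  by rewrite -/(unsplit (inl i)) (unsplitK (inl i)) scalerA.
by rewrite -/(unsplit (inr i)) (unsplitK (inr i)).
Qed.

Lemma linspan0 A : linspan A 0.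
Proof. by exists 0, (fun=> 0), (fun=> 0); rewrite big_ord0; split=> // -[]. Qed.

Lemma linspan_ind A P : P 0 -> (forall c x y, P x -> P y -> P (c *: x + y)) ->
  (forall x, A x -> P x) -> forall x, linspan A x -> P x.
Proof.
move=> P0 PZD AP _ [k [c [a [Aa ->]]]]; elim/big_ind: _ => // [x y Px Py|i _].
  by rewrite -[x]scale1r; apply: PZD.
by rewrite -[_ *: _]addr0; apply: PZD => //; apply: AP.
Qed.

Lemma zlattice_subgroup : is_subgroup (@zlattice R d).
Proof.
split; first by exists 0; rewrite // map_mx0.
by move=> _ _ [x _ <-] [y _ <-]; exists (x - y); rewrite // map_mxB.
Qed.

End Spans.

(** * The multiplicity of a curve is a determinant *)
Section Multiplicity.
Variables (R : realType) (r n : nat) (n_gt0 : (0 < n)%N) (Delta : seq 'rV[int]_r).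
Hypothesis r_gt0 : (0 < r)%N.
Hypothesis Delta_sum0 : \sum_(v <- Delta) v = 0.
Hypothesis dimE : (r + n + size Delta - 3 = n * r)%N.
Notation N := (n + size Delta)%N.
Notation i0 := (root_end n_gt0 Delta).
Notation Omega := [set~ i0]%SET.
Notation base := (evbase r n).
Notation u := (@evu r n Delta).
Notation L := (ev_mx R n_gt0 Delta).
Variable C : curve R n Delta.
Let treeC := curve_tree C.
Let F := end_splits C i0.
Hypothesis ndF : nondeg base u (tree_family Omega) F.

Let famF I : I \in F -> [/\ I \subset Omega, (1 < #|I|)%N & I != Omega].
Proof. by have [_ h] := tree_familyP (end_splits_family treeC i0); apply: h. Qed.

Let famsz (F' : {set {set 'I_N}}) : tree_family Omega F' -> (#|F'| + size base <= n * r)%N.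
Proof. exact: family_size. Qed.

Let sizeF : (#|F| + size base)%N = (n * r)%N.
Proof. exact: (nondeg_size famsz ndF). Qed.

Definition vI_comb (c : {set 'I_N} -> R) : 'rV[R]_(npairs N) := \sum_(I in F) c I *: vI R I.

Let vI_combD a c c' : vI_comb (fun I => a * c I + c' I) = a *: vI_comb c + vI_comb c'.
Proof.
rewrite /vI_comb scaler_sumr -big_split /=; apply: eq_bigr => I _.
by rewrite scalerDl scalerA.
Qed.

Let type_cone_comb c : (forall I, I \in F -> 0 <= c I) -> @type_cone R _ C (vI_comb c).
Proof.
move=> c0; exists (fun E => c (endset i0 E)) => [E EE|]; first exact/c0/imset_f.
by rewrite (phi_splits i0 _ treeC) /vI_comb (sum_end_splits treeC).
Qed.

Let type_cone_combE q : @type_cone R _ C q -> exists c, q = vI_comb c.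
Proof.
case=> l _ <-; rewrite (phi_splits i0 _ treeC).
exists (fun I => \sum_(E in edges C | endset i0 E == I) l E).
rewrite /vI_comb (sum_end_splits treeC); apply: eq_bigr => E EE; congr (_ *: _).
rewrite (big_pred1 E) // => E'; have [EE'|nEE'] := boolP (E' \in edges C).
  by apply/eqP/eqP=> [|->//]; apply: (endset_inj treeC).
by apply/esym; apply: contraNF nEE' => /eqP->.
Qed.

Let vI_comb1 I : I \in F -> vI R I = vI_comb (fun J => (J == I)%:R).
Proof.
move=> IF; rewrite /vI_comb (bigD1 I) //= eqxx scale1r big1 ?addr0 // => J /andP[_ /negPf->].
by rewrite scale0r.
Qed.

Let vI_comb0 : vI_comb (fun=> 0) = 0.
Proof. by rewrite /vI_comb big1 // => I _; rewrite scale0r. Qed.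

Let type_cone_vI I : I \in F -> @type_cone R _ C (vI R I).
Proof. by move=> /vI_comb1->; apply: type_cone_comb => J _; rewrite ler0n. Qed.

Let type_cone0 : @type_cone R _ C 0.
Proof. by rewrite -vI_comb0; apply: type_cone_comb. Qed.

Let linspan_type_cone q : linspan (@type_cone R _ C) q <-> exists c, q = vI_comb c.
Proof.
split.
  apply: (linspan_ind (P := fun q => exists c, q = vI_comb c)) => [|a x y [c ->] [c' ->]|].
  - by exists (fun=> 0); rewrite vI_comb0.
  - by exists (fun I => a * c I + c' I); rewrite vI_combD.
  - exact: type_cone_combE.
case=> c ->; rewrite /vI_comb; apply: (big_ind (linspan (@type_cone R _ C))).
- exact: linspan0.
- by move=> x y hx hy; rewrite -[x]scale1r; apply: linspan_comb.
move=> I IF; rewrite -[_ *: _]addr0; apply: linspan_comb; last exact: linspan0.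
by apply: linspan_gen; apply: type_cone_vI.
Qed.

Let side_split (E : {set vert C}) (W : vert C) :
  side E W = if far (foot C i0) E W then endset i0 E else (~: endset i0 E)%SET.
Proof.
have e x : connect (joined E) W x = (far (foot C i0) E W == far (foot C i0) E x).
  have h : far W E =1 (fun x => far (foot C i0) E W (+) far (foot C i0) E x).
    apply: (far_unique treeC) => [|a b ab]; first by rewrite addbb.
    rewrite -(far_xor treeC (foot C i0) E ab).
    by case: (far _ E W) (far _ E a) (far _ E b) => [] [] [].
  by apply: negb_inj; rewrite -/(far W E x) h negb_eqb.
apply/setP=> i; rewrite inE -[connect _ _ _]/(connect (joined E) W (foot C i)) e.
by case: (far _ E W); rewrite !inE eq_sym ?eqb_id // eqbF_neg.
Qed.

Let vI_compl (I : {set 'I_N}) : I \subset Omega -> (1 < #|I|)%N -> I != Omega -> vI R (~: I)%SET = vI R I.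
Proof.
move=> sI I1 ne; have sz := splits_size sI I1 ne.
rewrite !vI_split ?splitvC //; rewrite cardsCs setCK card_ord.
have := subset_leq_card sI; move: sz; rewrite cardsC1 card_ord; set c := #|I|; clearbody c; lia.
Qed.

Let raylatticeE q : @type_raylattice R _ C q <-> exists z : {set 'I_N} -> int, q = vI_comb (fun I => (z I)%:~R).
Proof.
split.
  apply: (zspan_ind (P := fun q => exists z : {set 'I_N} -> int, q = vI_comb (fun I => (z I)%:~R))).
    split; first by exists (fun=> 0); rewrite /vI_comb big1 // => I _; rewrite scale0r.
    move=> x y [z ->] [z' ->]; exists (fun I => z I - z' I).
    by rewrite /vI_comb -sumrB; apply: eq_bigr => I _; rewrite intrB scalerBl.
  move=> _ [E [W [EE _ ->]]]; have IF : endset i0 E \in F by apply: imset_f.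
  have [sI I1 ne] := famF IF.
  exists (fun J => (J == endset i0 E)%:Z); rewrite side_split.
  rewrite (_ : vI _ _ = vI R (endset i0 E)); last by case: ifP => // _; rewrite vI_compl.
  exact: vI_comb1.
case=> z ->; rewrite /vI_comb; apply: is_subgroup_sum => [|I /imsetP[E EE ->]].
  exact: zspan_subgroup.
rewrite scaler_int; apply: is_subgroupMz; first exact: zspan_subgroup.
apply: zspan_gen; have [W WE fW] := far_bottom treeC (foot C i0) EE.
by exists E, W; rewrite side_split fW.
Qed.

(** The part of ev that depends on the lengths only. *)
Let rho (q : 'rV[R]_(npairs N)) : 'rV[R]_(n * r) := row_mx q 0 *m L.

Let rho_row q x : row_mx q x *m L = rho q + diagv n x.
Proof.
rewrite /rho -(ev_mx_diag n_gt0 r_gt0 Delta_sum0 dimE) -mulmxDl.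
by rewrite add_row_mx addr0 add0r.
Qed.

Let rhoB x y : rho (x - y) = rho x - rho y.
Proof. by rewrite /rho -mulmxBl opp_row_mx add_row_mx oppr0 addr0. Qed.

Let rhoD x y : rho (x + y) = rho x + rho y.
Proof. by rewrite /rho -mulmxDl add_row_mx addr0. Qed.

Let rhoZ a x : rho (a *: x) = a *: rho x.
Proof. by rewrite /rho scalemxAl scale_row_mx scaler0. Qed.

Let rho0 : rho 0 = 0.
Proof. by rewrite /rho row_mx0 mul0mx. Qed.

Let rho_comb c : rho (vI_comb c) = \sum_(I in F) c I *: toR R (u I).
Proof.
rewrite /vI_comb (big_morph rho rhoD rho0); apply: eq_bigr => I /famF[sI I1 ne].
by rewrite rhoZ /rho (ev_mx_vI R r_gt0 Delta_sum0 dimE).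
Qed.

(** [Lam] is the lattice generated by the vectors u_I and the diagonal ones, and [B']
    is its copy in R^(nr). *)
Let M := seq_mx (gens base u F).
Let Lam : set 'rV[int]_(n * r) := [set y | exists x, y = x *m M].
Let B' := [set toR R y | y in Lam].

Let Lam_subgroup : is_subgroup Lam.
Proof.
split; first by exists 0; rewrite mul0mx.
by move=> _ _ [x ->] [y ->]; exists (x - y); rewrite mulmxBl.
Qed.

Let toRB x y : toR R (x - y) = toR R x - toR R y :> 'rV[R]_(n * r).
Proof. exact: map_mxB. Qed.

Let B'_subgroup : is_subgroup B'.
Proof.
split; first by exists 0; [apply: Lam_subgroup.1|rewrite /toR map_mx0].
move=> _ _ [x Lx <-] [y Ly <-]; exists (x - y); last by rewrite toRB.
exact: Lam_subgroup.2.
Qed.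

Let Lam_gen x : x \in gens base u F -> Lam x.
Proof.
move=> xg; have szg : size (gens base u F) = (n * r)%N by rewrite size_gens.
have lt : (index x (gens base u F) < n * r)%N.
  by apply: leq_trans (eq_leq szg); rewrite index_mem.
exists (delta_mx 0 (Ordinal lt)); rewrite -rowE; apply/rowP=> j; rewrite !mxE.
by rewrite /= nth_index.
Qed.

Let diag_int (p : 'rV[int]_r) : B' (diagv n (map_mx intr p)).
Proof.
rewrite diagvE; apply: is_subgroup_sum => // k _; rewrite mxE scaler_int.
apply: is_subgroupMz => //; exists base`_k => //; apply: Lam_gen.
by rewrite mem_cat mem_nth ?orbT.
Qed.

Let vI_comb_int (z : {set 'I_N} -> int) : B' (rho (vI_comb (fun I => (z I)%:~R))).
Proof.
rewrite rho_comb; apply: is_subgroup_sum => // I IF; rewrite scaler_int.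
by apply: is_subgroupMz => //; exists (u I) => //; apply: Lam_gen; apply: mem_gens.
Qed.

Let B'E x : B' x -> exists (z : {set 'I_N} -> int) (p : 'rV[int]_r),
  x = rho (vI_comb (fun I => (z I)%:~R)) + diagv n (map_mx intr p).
Proof.
case=> _ [w ->] <-; rewrite /toR map_mxM.
have := mul_gens u (map_mx intr w : 'rV[R]_(n * r)) sizeF; rewrite /solves => ->.
pose wi i : int := if insub i is Some k then w 0 k else 0.
have wE i : row_entry (map_mx intr w : 'rV[R]_(n * r)) i = (wi i)%:~R.
  by rewrite /row_entry /wi; case: insub => [k|//]; rewrite mxE.
exists (fun I => wi (index I (enum F))).
exists (\row_a wi (#|F| + cast_ord (esym (size_evbase r n)) a)%N).
rewrite rho_comb diagvE; congr (_ + _); first by apply: eq_bigr => I _; rewrite wE.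
by apply: eq_bigr => k _; rewrite !mxE wE.
Qed.

(** Modulo the diagonal, the u_I are linearly independent by Cramer's rule. *)
Let vI_comb_indep c z p : rho (vI_comb c) = rho (vI_comb z) + diagv n p -> vI_comb c = vI_comb z.
Proof.
rewrite !rho_comb => e; apply: eq_bigr => I IF; congr (_ *: _).
have s1 : solves u F c (fun k : 'I_(size base) => 0) (rho (vI_comb c)).
  by rewrite /solves rho_comb [X in _ + X]big1 ?addr0 // => k _; rewrite scale0r.
have s2 : solves u F z (fun k : 'I_(size base) => p 0 (cast_ord (size_evbase r n) k)) (rho (vI_comb c)).
  by rewrite /solves rho_comb e diagvE.
have m_gt0 := eval_dim_gt0 n_gt0 r_gt0.
rewrite -(coordE m_gt0 famsz ndF IF s1).
exact: (coordE m_gt0 famsz ndF IF s2).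
Qed.

(** [W] is the lattice of the cone of C and [ray] the one generated by its rays; [A]
    is the lattice Z^(nr) and [B] the image of the lattice points of the cone. *)
Let W := @LambdaN R N `&` linspan (@type_cone R _ C).
Let ray := @type_raylattice R _ C.
Let A := @zlattice R (n * r).
Let B := [set x *m L | x in @fan_lattice R _ r `&` linspan (curve_cone C)].

Let linspan_curve_cone q x : linspan (curve_cone C) (row_mx q x) <-> linspan (@type_cone R _ C) q.
Proof.
split=> [h|h].
  rewrite -(row_mxKl q x); move: h; apply: (linspan_ind (P := fun y => linspan (@type_cone R _ C) (lsubmx y))).
  - by rewrite linear0; apply: linspan0.
  - by move=> c y z hy hz; rewrite linearP; apply: linspan_comb.
  - by move=> _ [q' q'T [x' _ <-]]; rewrite row_mxKl; apply: linspan_gen.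
have -> : row_mx q x = 1 *: row_mx q 0 + row_mx 0 x.
  by rewrite scale1r add_row_mx addr0 add0r.
apply: linspan_comb.
  move: h; apply: (linspan_ind (P := fun q => linspan (curve_cone C) (row_mx q 0))).
  - by rewrite row_mx0; apply: linspan0.
  - move=> c y z hy hz; have -> : row_mx (c *: y + z) (0 : 'rV[R]_r) = c *: row_mx y 0 + row_mx z 0.
      by rewrite scale_row_mx add_row_mx scaler0 addr0.
    exact: linspan_comb.
  - by move=> y yT; apply: linspan_gen; exists y => //; exists 0.
by apply: linspan_gen; exists 0 => //; exists x.
Qed.

Let BE y : B y <-> exists2 q, W q & exists p : 'rV[int]_r, y = rho q + diagv n (map_mx intr p).
Proof.
split.
  case=> x [[q qL [z [p _ <-] <-]] /linspan_curve_cone qT] <-.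
  by exists q => //; exists p; rewrite rho_row.
case=> q [qL qT] [p ->]; exists (row_mx q (map_mx intr p)); last by rewrite rho_row.
split; last exact/linspan_curve_cone.
by exists q => //; exists (map_mx intr p) => //; exists p.
Qed.

Let W_subgroup : is_subgroup W.
Proof.
split; first by split; [apply: (zspan_subgroup _).1|apply: linspan0].
move=> x y [Lx Tx] [Ly Ty]; split; first exact: (zspan_subgroup _).2.
by rewrite addrC -scaleN1r; apply: linspan_comb.
Qed.

Let B_subgroup : is_subgroup B.
Proof.
split.
  apply/BE; exists 0; first exact: W_subgroup.1.
  by exists 0; rewrite map_mx0 rho0 add0r diagv0.
move=> _ _ /BE[q Wq [p ->]] /BE[q' Wq' [p' ->]]; apply/BE; exists (q - q').
  exact: W_subgroup.2.
by exists (p - p'); rewrite rhoB map_mxB diagvB opprD addrACA.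
Qed.

Let rho_lattice q : @LambdaN R N q -> A (rho q).
Proof.
apply: (zspan_ind (P := fun q => A (rho q))).
  split; first by rewrite rho0; apply: (zlattice_subgroup R (n * r)).1.
  by move=> x y Ax Ay; rewrite rhoB; apply: (zlattice_subgroup R (n * r)).2.
have inO (I : {set 'I_N}) : i0 \notin I -> I \subset Omega.
  by move=> nI; apply/subsetP=> i iI; rewrite !inE; apply: contraNneq nI => <-.
have neO (I : {set 'I_N}) : (#|I| < N.-1)%N -> I != Omega.
  by apply: contraTneq => ->; rewrite cardsC1 card_ord ltnn.
have h (I : {set 'I_N}) : i0 \notin I -> (1 < #|I| < N.-1)%N -> A (rho (vI R I)).
  move=> nI /andP[I1 I2]; rewrite /rho (ev_mx_vI R r_gt0 Delta_sum0 dimE) ?inO ?neO //.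
  by exists (u I).
move=> _ [I /= szI <-]; have [iI|/h] := boolP (i0 \in I); last exact.
have szC : (1 < #|(~: I)%SET| < N.-1)%N.
  by move: szI; rewrite [#|(~: I)%SET|]cardsCs setCK card_ord; set c := #|I|; clearbody c; lia.
have nC : i0 \notin (~: I)%SET by rewrite inE negbK.
have /andP[C1 C2] := szC; rewrite -(setCK I) vI_compl ?inO ?neO //.
exact: h.
Qed.

Let ray_W q : ray q -> W q.
Proof.
case/raylatticeE=> z ->; split; last by apply/linspan_type_cone; exists (fun I => (z I)%:~R).
rewrite /vI_comb; apply: is_subgroup_sum => [|I IF]; first exact: zspan_subgroup.
rewrite scaler_int; apply: is_subgroupMz; first exact: zspan_subgroup.
have [sI I1 ne] := famF IF; apply: zspan_gen; exists I => //=.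
exact: splits_size sI I1 ne.
Qed.

Let B'_B x : B' x -> B x.
Proof.
case/B'E=> z [p ->]; apply/BE; exists (vI_comb (fun I => (z I)%:~R)); last by exists p.
by apply: ray_W; apply/raylatticeE; exists z.
Qed.

Let B'_A x : B' x -> A x.
Proof. by case=> y _ <-; exists y. Qed.

Let B_A x : B x -> A x.
Proof.
case/BE=> q [qL _] [p ->]; apply: is_subgroupD (rho_lattice qL) (B'_A (diag_int p)).
exact: zlattice_subgroup.
Qed.

Let index_AB' : has_index A B' `|sdet (gens base u F)|%N.
Proof.
have [_ d0] := andP ndF.
pose psi (x : 'rV[R]_(n * r)) : 'rV[int]_(n * r) := xget 0 [set z | toR R z = x].
have psiK z : psi (toR R z) = z.
  apply: (@map_intr_inj R); rewrite -/(toR R _) -/(toR R z).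
  exact: (xgetPex 0 (P := [set z' | toR R z' = toR R z]) (ex_intro _ z erefl)).
apply: (has_index_morph (M := [set: 'rV[int]_(n * r)]) (M' := Lam) (psi := psi)) => //.
- by move=> z _; exists (toR R z); [exists z|rewrite psiK subrr; apply: Lam_subgroup.1].
- move=> _ _ [x _ <-] [y _ <-]; rewrite -/(toR R x) -/(toR R y) !psiK -toRB.
  split=> [h|[w Lw /map_intr_inj <- //]]; by exists (y - x).
- exact: index_det d0.
Qed.

(** In the chain B' < B < A the index of B in A is the second factor of the
    multiplicity.  Evaluation induces an isomorphism from W / ray onto B / B', so the
    index of B' in B is the weight.  The product is the index of B' in A. *)
Lemma mult_ev_det : mult_ev n_gt0 C = `|sdet (gens base u F)|%N.
Proof.
have gA : is_subgroup A := zlattice_subgroup R (n * r).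
have gR : is_subgroup ray := zspan_subgroup _.
have [a [b [iAB iBB' ->]]] := has_index_tower gA B_subgroup B'_subgroup B'_B B_A index_AB'.
have iWr : has_index W ray b.
  apply: (has_index_morph (M := B) (M' := B') (psi := rho)) iBB' => //.
  - by move=> q Wq; apply/BE; exists q => //; exists 0; rewrite map_mx0 diagv0 addr0.
  - move=> _ /BE[q Wq [p ->]]; exists q => //.
    by rewrite addrC addrA addNr add0r; apply: diag_int.
  move=> x y Wx Wy; rewrite -rhoB; split; last first.
    by case/raylatticeE=> z ->; apply: vI_comb_int.
  have [_ /linspan_type_cone[c ->]] := W_subgroup.2 _ _ Wy Wx.
  by case/B'E=> z [p e]; apply/raylatticeE; exists z; apply: vI_comb_indep e.
by rewrite /mult_ev /type_weight (has_index_eq gR iWr) (has_index_eq B_subgroup iAB) mulnC.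
Qed.

(** The span of the cone of C contains the vectors v_I and those of R^r; their images
    under ev are independent, so the nr vectors are a basis of it. *)
Lemma nondeg_in_maximal_cone : in_maximal_cone C.
Proof.
rewrite /in_maximal_cone /setdim addnA dimE.
pose Gs : seq 'rV[R]_(npairs N + r) :=
  [seq row_mx (vI R K) 0 | K <- enum F] ++ map (fun a : 'I_r => row_mx 0 (delta_mx 0 a)) (enum 'I_r).
pose G : 'M[R]_(n * r, npairs N + r) := \matrix_k Gs`_k.
have szGs : size Gs = (n * r)%N.
  by rewrite /Gs size_cat 2!size_map -?enumT size_enum_ord -cardE; have := sizeF; rewrite size_evbase.
have GL : G *m L = map_mx intr M.
  apply/row_matrixP=> k; rewrite row_mul rowK -map_row rowK -/(toR R _).
  rewrite /gens !nth_cat 2!size_map -cardE; case: ltnP => [lt|ge].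
    pose I0 : {set 'I_N} := finset.set0.
    rewrite !(nth_map I0) -?cardE //; set I := nth _ _ _.
    have [sI I1 ne] : [/\ I \subset Omega, (1 < #|I|)%N & I != Omega].
      by apply: famF; rewrite -mem_enum mem_nth // -cardE.
    exact: ev_mx_vI.
  have lt : (k - #|F| < r)%N.
    have := ltn_ord k; rewrite -[X in (_ < X)%N -> _]sizeF size_evbase ltn_subLR //.
  have nthE (V : zmodType) (f : 'I_r -> V) : (map f (enum 'I_r))`_(k - #|F|) = f (Ordinal lt).
    rewrite (nth_map (Ordinal lt)) ?size_enum_ord //; congr f.
    exact: (nth_ord_enum (Ordinal lt) (Ordinal lt)).
  rewrite (nthE _ (fun a => row_mx 0 (delta_mx 0 a))) (ev_mx_diag n_gt0 r_gt0 Delta_sum0 dimE).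
  rewrite /evbase nthE /toR map_mxvec; congr mxvec.
  by apply/row_matrixP=> j; rewrite -map_row !rowK map_delta_mx.
have freeG : row_free G.
  have /andP[_ d0] := ndF.
  have : row_free (G *m L) by rewrite GL row_free_unit unitmxE det_map_mx unitfE intr_eq0.
  rewrite /row_free => /eqP e; rewrite eqn_leq rank_leq_row /=.
  by rewrite -[X in (X <= _)%N]e; apply: mxrankM_maxl.
have G_sub k : (row_mx (vI R k) 0 <= G)%MS \/ k \notin F.
  have [kF|] := boolP (k \in F); [left|by right].
  have kG : row_mx (vI R k) 0 \in Gs.
    by rewrite mem_cat (map_f (fun I : {set 'I_N} => row_mx (vI R I) 0)) ?mem_enum.
  have lt : (index (row_mx (vI R k) 0) Gs < n * r)%N.
    by apply: leq_trans (eq_leq szGs); rewrite index_mem.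
  by have := row_sub (Ordinal lt) G; rewrite rowK /= nth_index.
have D_sub (a : 'I_r) : (row_mx (0 : 'rV[R]_(npairs N)) (delta_mx 0 a) <= G)%MS.
  have : row_mx (0 : 'rV[R]_(npairs N)) (delta_mx 0 a) \in Gs.
    by rewrite mem_cat orbC (map_f (fun a : 'I_r => row_mx 0 (delta_mx 0 a))) ?mem_enum.
  move: (row_mx _ _) => y yG; have lt : (index y Gs < n * r)%N.
    by apply: leq_trans (eq_leq szGs); rewrite index_mem.
  by have := row_sub (Ordinal lt) G; rewrite rowK /= nth_index.
have cone_sub y : curve_cone C y -> (y <= G)%MS.
  case=> q /type_cone_combE[c ->] [x _ <-].
  have -> : row_mx (vI_comb c) x = \sum_(I in F) c I *: row_mx (vI R I) 0 +
      \sum_a x 0 a *: row_mx 0 (delta_mx 0 a).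
    have h1 : \sum_(I in F) c I *: row_mx (vI R I) (0 : 'rV[R]_r) = row_mx (vI_comb c) 0.
      rewrite (big_morph (fun q => row_mx q (0 : 'rV[R]_r)) (id1 := 0) (op1 := +%R)) ?row_mx0 //.
        by apply: eq_bigr => I _; rewrite scale_row_mx scaler0.
      by move=> y1 y2; rewrite add_row_mx addr0.
    have h2 : \sum_a x 0 a *: row_mx (0 : 'rV[R]_(npairs N)) (delta_mx 0 a) = row_mx 0 x.
      rewrite [in RHS](row_sum_delta x).
      rewrite (big_morph (fun q => row_mx (0 : 'rV[R]_(npairs N)) q) (id1 := 0) (op1 := +%R)) ?row_mx0 //.
        by apply: eq_bigr => a _; rewrite scale_row_mx scaler0.
      by move=> y1 y2; rewrite add_row_mx addr0.
    by rewrite h1 h2 add_row_mx addr0 add0r.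
  apply: addmx_sub; apply: summx_sub => i hi; apply: scalemx_sub; last exact: D_sub.
  by case: (G_sub i) => //; rewrite hi.
apply/eqP; rewrite eqn_leq; apply/andP; split.
  apply/bigmax_leqP=> k /asboolP[Bk [freeB coneB]].
  have : (Bk <= G)%MS by apply/row_subP=> i; apply: cone_sub.
  by move=> /mxrankS; rewrite (eqP freeB) => /leq_trans; apply; apply: rank_leq_row.
have ltm : (n * r < (npairs N + r).+1)%N by rewrite ltnS -(eqP freeG) rank_leq_col.
apply: (@leq_bigmax_cond _ _ (fun k : 'I_(npairs N + r).+1 => k : nat) (Ordinal ltm)).
apply/asboolP; exists G; split=> // i; rewrite rowK.
have : Gs`_i \in Gs by rewrite mem_nth // szGs.
rewrite {2}/Gs mem_cat => /orP[/mapP[I]|/mapP[a _ ->]]; last by exists 0 => //; exists (delta_mx 0 a).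
rewrite mem_enum => IF ->; exists (vI R I); last by exists 0.
exact: type_cone_vI.
Qed.

End Multiplicity.

(** * The fan of faces of a hyperplane arrangement *)
Section ArrangementFan.
Variables (R : realType) (d : nat) (fs : seq 'cV[int]_d).
Hypothesis fs_neq0 : forall f, f \in fs -> f != 0.
Notation K := (size fs).
Notation signs := {ffun 'I_K -> option bool}.
Implicit Types (s t : signs) (x y p : 'rV[R]_d).

Let form (i : 'I_K) : 'cV[R]_d := map_mx intr (fs`_i).

Let sform (o : option bool) (i : 'I_K) : 'cV[int]_d :=
  match o with None => 0 | Some b => if b then fs`_i else - fs`_i end.

(** A cell is given by one of the signs >= 0, <= 0 and = 0 for each form. *)
Definition cell s : set 'rV[R]_d := [set x | forall i,
  if s i is Some b then is_true (0 <= dot (map_mx intr (sform (s i) i)) x) else dot (form i) x = 0].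

Let eqs s : 'M[int]_(d, K) := \matrix_(a, i) (if s i is None then fs`_i a 0 else 0).
Let ineqs s : 'M[int]_(d, K) := \matrix_(a, i) sform (s i) i a 0.

Let col_dot (A : 'M[int]_(d, K)) (f : 'cV[int]_d) x i : (forall a, A a i = f a 0) ->
  (x *m map_mx intr A) 0 i = dot (map_mx intr f) x.
Proof. by move=> h; rewrite /dot !mxE; apply: eq_bigr => a _; rewrite !mxE h. Qed.

Let dot0 x : dot (map_mx intr (0 : 'cV[int]_d)) x = 0.
Proof. by rewrite map_mx0 /dot mulmx0 mxE. Qed.

Let cellE s : cell s = cone_of (eqs s) (ineqs s).
Proof.
have ineqE x i : (x *m map_mx intr (ineqs s)) 0 i = dot (map_mx intr (sform (s i) i)) x.
  by apply: col_dot => a; rewrite mxE.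
apply/classical_sets.seteqP; split=> x; rewrite /cell /cone_of /=.
  move=> h; split=> [|i]; last first.
    by rewrite ineqE; have := h i; case: (s i) => [b|] //=; rewrite dot0.
  apply/rowP=> i; rewrite [RHS]mxE; have := h i; case e : (s i) => [b|] /= hi.
    by rewrite (col_dot (f := 0)) ?dot0 // => a; rewrite !mxE e.
  by rewrite (col_dot (f := fs`_i)) // => a; rewrite !mxE e.
move=> [h1 h2] i; have := h2 i; rewrite ineqE; case e : (s i) => [b|] //= _.
have /rowP/(_ i) := h1; rewrite [RHS]mxE (col_dot (f := fs`_i)) // => a.
by rewrite mxE e.
Qed.

(** Some of the inequalities are turned into equations. *)
Let refines s' s := forall i, s' i = s i \/ s' i = None.

Let sform_zero s x i : (forall i, if s i is Some b then is_true (0 <= dot (map_mx intr (sform (s i) i)) x)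
    else dot (form i) x = 0) ->
  dot (map_mx intr (sform (s i) i)) x = 0 <-> dot (form i) x = 0.
Proof.
move=> /(_ i); case: (s i) => [[]|] /=; [by []| |by rewrite dot0].
by move=> _; rewrite map_mxN dotNl; split=> [/eqP|->]; rewrite ?oppr0 // oppr_eq0 => /eqP.
Qed.

Let refines_cell s' s x : refines s' s -> cell s' x -> cell s x.
Proof.
move=> ref h i; have := h i; case: (ref i) => ->; first by [].
case: (s i) => [b|] //= e; have : dot (map_mx intr (sform (Some b) i)) x = 0.
  by case: b; rewrite /= ?map_mxN ?dotNl [dot _ _]e ?oppr0.
by move=> /= ->.
Qed.

Let refines_face s' s : refines s' s -> is_face (cell s') (cell s).
Proof.
move=> ref; exists K, K, (eqs s), (ineqs s), [set i | s' i == None]%SET; split; first exact: cellE.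
have ineqE x i : (x *m map_mx intr (ineqs s)) 0 i = dot (map_mx intr (sform (s i) i)) x.
  by apply: col_dot => a; rewrite mxE.
apply/classical_sets.seteqP; split=> x /=.
  move=> h; have hs := refines_cell ref h; split=> // i; rewrite inE => /eqP e.
  by rewrite ineqE; apply/(sform_zero _ hs); have := h i; rewrite e.
case=> h h0 i; have := h i; case: (ref i) => e; first by rewrite e.
rewrite e => _; apply/(sform_zero _ h); rewrite -ineqE; apply: h0.
by rewrite inE e.
Qed.

Definition arrangement : set (set 'rV[R]_d) :=
  [set cell s | s in [set s : signs | exists i, s i = None]].

(** A face tau may come from another presentation of the cell than the one by signs.
    Let s' have the sign = 0 at the forms vanishing on tau, and let y in tau be a
    point where all other forms are nonzero.  If x is in the cell of s', then so is
    y - e x for a small e > 0.  Any inequality which the face turns into an equation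
    vanishes at y and is nonnegative at x and y - e x, hence vanishes at x. *)
Let face_cell s tau : is_face tau (cell s) -> exists2 s', refines s' s & tau = cell s'.
Proof.
case=> p [q [F [G [S [sE tE]]]]].
have tau_sub x : tau x -> cell s x by rewrite tE => -[].
have tau0 : tau 0.
  by rewrite tE sE; split; [split=> [|j]|move=> j _]; rewrite mul0mx ?mxE.
have tauD x y : tau x -> tau y -> tau (x + y).
  rewrite tE sE => -[[x1 x2] x3] [[y1 y2] y3]; split; first split.
  - by rewrite mulmxDl x1 y1 addr0.
  - by move=> j; rewrite mulmxDl mxE addr_ge0.
  - by move=> j jS; rewrite mulmxDl mxE x3 ?y3 ?addr0.
(* The forms vanishing on tau become equations. *)
pose s' : signs := [ffun i => if `[< forall x, tau x -> dot (form i) x = 0 >] then None else s i].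
have ref : refines s' s by move=> i; rewrite ffunE; case: ifP; [right|left].
exists s' => //.
have wit i : exists x, tau x /\ (s' i != None -> dot (form i) x != 0).
  have [/asboolP h|/asboolPn] := boolP `[< forall x, tau x -> dot (form i) x = 0 >].
    by exists 0; split=> //; rewrite ffunE; case: asboolP.
  by move=> /existsNP[x /not_implyP[tx /eqP nx]]; exists x.
(* The sum of the witnesses is a relative interior point of tau. *)
have [w wP] := choice wit; pose y := \sum_i w i.
have tauy : tau y by apply: big_ind => // i _; have [] := wP i.
have y_pos i : s' i != None -> 0 < dot (map_mx intr (sform (s' i) i)) y.
  move=> ne; have es : s' i = s i by case: (ref i) => // e; rewrite e eqxx in ne.
  have ge0 x : tau x -> 0 <= dot (map_mx intr (sform (s' i) i)) x.
    by move=> /tau_sub/(_ i); rewrite -es; case: (s' i) ne.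
  rewrite /y dot_sum (bigD1 i) //= ltr_wpDr //.
    by apply: sumr_ge0 => j _; apply: ge0; have [] := wP j.
  have [tw nw] := wP i; rewrite lt_def ge0 // andbT.
  have := nw ne; apply: contra_neq => e0; apply/(sform_zero _ (tau_sub _ tw)).
  by rewrite -es.
apply/classical_sets.seteqP; split=> x.
  move=> tx i; have := tau_sub _ tx i; rewrite ffunE; case: asboolP => [h _|//].
  exact: h.
move=> cx; have sx := refines_cell ref cx.
have [i|e e0 he] := @small_scale R _ [seq i <- enum 'I_K | s' i != None]
   (fun i => dot (map_mx intr (sform (s' i) i)) y) (fun i => - dot (map_mx intr (sform (s' i) i)) x).
  by rewrite mem_filter => /andP[/y_pos].
have cz : cell s (y - e *: x).
  apply: (refines_cell ref) => i; have [ne|nn] := boolP (s' i != None); last first.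
    move/negPn/eqP: nn => nn; have := cx i; have : dot (form i) y = 0.
      have := tau_sub _ tauy i; rewrite ffunE in nn; move: nn; case: asboolP => [h _ _|_ -> //].
      exact: h.
    by rewrite nn => y0 x0; rewrite dotB dotZ y0 x0 mulr0 subr0.
  have /he : i \in [seq i <- enum 'I_K | s' i != None] by rewrite mem_filter ne mem_enum.
  by case: (s' i) ne => [b|//] _; rewrite dotB dotZ mulrN => /ltW.
rewrite tE; split=> // j jS.
have gy : (y *m map_mx intr G) 0 j = 0 by move: tauy; rewrite tE => -[_]; apply.
have : 0 <= ((y - e *: x) *m map_mx intr G) 0 j by move: cz; rewrite sE => -[_]; apply.
have : 0 <= (x *m map_mx intr G) 0 j by move: sx; rewrite sE => -[_]; apply.
rewrite mulmxBl -scalemxAl [X in _ -> 0 <= X -> _]mxE gy add0r [in X in _ -> 0 <= X -> _]mxE [in X in _ -> 0 <= X -> _]mxE.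
move=> g0; rewrite oppr_ge0 pmulr_rle0 // => g1; apply/eqP; by rewrite eq_le g0 g1.
Qed.

Lemma arrangement_fan : is_fan arrangement.
Proof.
split.
- by apply: finite_image; apply: finite_finset.
- by move=> _ [s _ <-]; rewrite cellE; exists K, K, (eqs s), (ineqs s).
- move=> _ tau [s [i si] <-] /face_cell[s' ref ->]; exists s' => //.
  by exists i; case: (ref i) => ->.
move=> _ _ [s _ <-] [t _ <-].
pose st : signs := [ffun i => if s i == t i then s i else None].
have refs : refines st s by move=> i; rewrite ffunE; case: eqP; [left|right].
have reft : refines st t by move=> i; rewrite ffunE; case: eqP => [->|]; [left|right].
suff -> : cell s `&` cell t = cell st by split; apply: refines_face.
apply/classical_sets.seteqP; split=> x; last by move=> h; split; [apply: refines_cell refs h|apply: refines_cell reft h].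
case=> hs ht i; have := hs i; have := ht i; rewrite ffunE.
case: (s i) (t i) => [b|] [c|] //=; rewrite ?eqxx //.
have [->|ne] := eqVneq (Some b) (Some c); first by case: c.
have : c = ~~ b by case: b c ne => [] [].
move=> -> {ne}; case: b => /=; rewrite map_mxN dotNl oppr_ge0 => h1 h2;
  by apply/eqP; rewrite eq_le h1 h2.
Qed.

(** d independent vectors cannot lie in a hyperplane. *)
Lemma arrangement_dim sigma : arrangement sigma -> (setdim sigma < d)%N.
Proof.
case=> s [i si] <-; have fi : fs`_i != 0 by apply: fs_neq0; apply: mem_nth.
have d_gt0 : (0 < d)%N.
  rewrite lt0n; apply: contraNneq fi => d0; apply/eqP/colP=> a.
  by have := ltn_ord a; rewrite [X in (_ < X)%N]d0.
rewrite /setdim -[X in (_ < X)%N](prednK d_gt0) ltnS; apply/bigmax_leqP=> k /asboolP[B [freeB cB]].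
rewrite -ltnS (prednK d_gt0) ltn_neqAle -ltnS ltn_ord andbT; apply/eqP=> ek.
have Bf : B *m form i = 0.
  apply/row_matrixP=> j; rewrite row_mul linear0; have := cB j i; rewrite si => e.
  by apply/rowP=> a; rewrite (ord1 a) [RHS]mxE; apply: e.
have fullB : row_full B by rewrite /row_full (eqP freeB) ek.
have fi0 : form i = 0.
  by have /row_fullP[B1 eB1] := fullB; rewrite -[form i]mul1mx -eB1 -mulmxA Bf mulmx0.
case/eqP: fi; apply/colP=> a; have /colP/(_ a) := fi0.
by rewrite !mxE => /eqP; rewrite intr_eq0 => /eqP.
Qed.

Lemma arrangement_support x :
  fan_support arrangement x <-> exists2 f, f \in fs & dot (map_mx intr f) x = 0.
Proof.
split=> [[_ [s [i si] <-] /(_ i)]|[f ff fx]].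
  by rewrite si => e; exists fs`_i => //; apply: mem_nth.
pose s : signs := [ffun i => if dot (form i) x == 0 then None else Some (0 < dot (form i) x)].
have lti : (index f fs < K)%N by rewrite index_mem.
exists (cell s).
  exists s => //; exists (Ordinal lti); rewrite ffunE /form /= nth_index // fx eqxx //.
move=> i; rewrite ffunE; case: eqP => // /eqP ne; case: ltP => [/ltW//|le] /=.
by rewrite map_mxN dotNl oppr_ge0.
Qed.

End ArrangementFan.

(** In Smith normal form some diagonal entry vanishes. *)
Lemma det0_kernel m (M : 'M[int]_m) : \det M = 0 -> exists2 f : 'cV[int]_m, f != 0 & M *m f = 0.
Proof.
have [L uL [Q uQ [d _ ->]]] := int_Smith_normal_form M.
set D := \matrix_(_, _) _.
have eD : D = diag_mx (\row_(j < m) d`_j) by apply/matrixP=> i j; rewrite !mxE.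
have detN0 (A : 'M[int]_m) : A \in unitmx -> \det A != 0.
  by rewrite unitmxE; apply: contraTneq => ->; rewrite unitr0.
move/eqP; rewrite !det_mulmx !mulf_eq0 (negPf (detN0 L uL)) (negPf (detN0 Q uQ)) orbF /=.
rewrite eD det_diag prodf_seq_eq0 => /hasP[j _]; rewrite mxE => /eqP dj.
exists (invmx Q *m delta_mx j 0).
  apply: contraTneq isT => /(congr1 (mulmx Q)); rewrite mulKVmx // mulmx0.
  by move=> /colP/(_ j); rewrite !mxE !eqxx.
rewrite -!mulmxA mulKVmx // -colE.
suff -> : col j (diag_mx (\row_(j < m) d`_j)) = 0 by rewrite mulmx0.
by apply/colP=> i; rewrite !mxE; case: eqP => [->|_]; rewrite ?mulr0n // mulr1n.
Qed.

(** * Relabelings and the number of unlabeled curves *)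
Section Assembly.
Variables (R : realType) (r n : nat) (n_gt0 : (0 < n)%N) (Delta : seq 'rV[int]_r).
Hypothesis r_gt0 : (0 < r)%N.
Hypothesis Delta_neq0 : forall v, v \in Delta -> v != 0.
Hypothesis Delta_sum0 : \sum_(v <- Delta) v = 0.
Hypothesis dimE : (r + n + size Delta - 3 = n * r)%N.
Notation N := (n + size Delta)%N.
Notation i0 := (root_end n_gt0 Delta).
Notation Omega := [set~ i0]%SET.
Notation base := (evbase r n).
Notation u := (@evu r n Delta).
Notation m_gt0 := (eval_dim_gt0 n_gt0 r_gt0).
Notation relab := (relabelings n Delta).
Notation shift s F := [set s @: (K : {set 'I_N}) | K in F]%SET.
Implicit Types (s : {perm 'I_N}) (K : {set 'I_N}) (F : {set {set 'I_N}}) (C : curve R n Delta).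
Let nd := nondeg base u (tree_family Omega).

Let famsz F : tree_family Omega F -> (#|F| + size base <= n * r)%N.
Proof. exact: family_size. Qed.

Lemma relab_marked s j : s \in relab -> s (lshift _ j) = lshift _ j.
Proof. by rewrite inE => /andP[/forallP/(_ j)/eqP]. Qed.

Lemma relab_dir s i : s \in relab -> end_dir (s i) = end_dir i :> 'rV[int]_r.
Proof. by rewrite inE => /andP[_ /forallP/(_ i)/eqP]. Qed.

Lemma relab_root s : s \in relab -> s i0 = i0.
Proof. exact: relab_marked. Qed.

Lemma edir_relab s K : s \in relab -> edir (s @: K)%SET = edir K :> 'rV[int]_r.
Proof.
move=> sG; rewrite /edir big_imset; last by move=> ? ? _ _; apply: perm_inj.
by apply: eq_bigr => i _; rewrite relab_dir.
Qed.

Lemma evu_relab s K : s \in relab -> u (s @: K)%SET = u K.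
Proof.
move=> sG; rewrite /evu; congr mxvec; apply/row_matrixP=> j; rewrite !rowK edir_relab //.
by rewrite -{1}(relab_marked j sG) (mem_imset _ _ (@perm_inj _ s)).
Qed.

Lemma relab_group : group_set relab.
Proof.
apply/group_setP; split; first by rewrite inE; apply/andP; split; apply/forallP=> i; rewrite perm1.
move=> s t sG tG; rewrite inE; apply/andP; split; apply/forallP=> i; rewrite permM.
  by rewrite !relab_marked.
by rewrite !relab_dir.
Qed.

Let G := Group relab_group.

Lemma tree_family_relab s F : s \in relab -> tree_family Omega F -> tree_family Omega (shift s F).
Proof.
move=> sG /tree_familyP[lamF h].
have sO : (s @: Omega)%SET = Omega.
  apply/setP=> i; rewrite -{1}(permKV s i) (mem_imset _ _ (@perm_inj _ s)) !inE.
  by rewrite -(inj_eq (@perm_inj _ s)) permKV relab_root.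
apply/andP; split.
  apply/laminarP=> _ _ /imsetP[A AF ->] /imsetP[B BF ->].
  case/or3P: (lamF A B AF BF) => [sAB|sBA|dAB]; apply/or3P.
  - by apply/Or31/imsetS.
  - by apply/Or32/imsetS.
  apply/Or33/pred0P=> i /=; rewrite -(permKV s i) !(mem_imset _ _ (@perm_inj _ s)).
  by have /pred0P/(_ (s^-1 i)%g) := dAB.
apply/forall_inP=> _ /imsetP[A AF ->]; have [sA A1 neA] := h A AF.
rewrite card_imset ?A1; last exact: perm_inj.
by rewrite -sO imsetS // (inj_eq (imset_inj (@perm_inj _ s))) neA.
Qed.

Lemma absdet_relab s F : s \in relab -> (#|F| + size base)%N = (n * r)%N ->
  `|sdet (gens base u (shift s F))|%N = `|sdet (gens base u F)|%N.
Proof.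
move=> sG szF; symmetry; apply: sdet_perm; first by rewrite size_gens.
rewrite /gens perm_cat2r perm_sym.
have -> : [seq u K | K <- enum F] = [seq u K | K <- [seq (s @: K)%SET | K : {set 'I_N} <- enum F]].
  by rewrite -map_comp; apply: eq_map => K /=; rewrite evu_relab.
apply: perm_map; apply: uniq_perm; rewrite ?enum_uniq //.
  by rewrite map_inj_uniq ?enum_uniq //; apply/imset_inj/perm_inj.
move=> K; rewrite mem_enum; apply/imsetP/mapP=> [[A AF ->]|[A AF ->]]; exists A => //.
  by rewrite mem_enum.
by move: AF; rewrite mem_enum.
Qed.

Lemma nondeg_relab s F : s \in relab -> nd F -> nd (shift s F).
Proof.
move=> sG ndF; have /andP[fF d0] := ndF; rewrite /nd /nondeg tree_family_relab //=.
by rewrite -absz_eq0 absdet_relab ?absz_eq0 //; apply: (nondeg_size famsz ndF).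
Qed.

(** If s fixes F, it fixes each member: a member I and its image have the same
    vector u, so if they were distinct, the determinant would be 0.  Suppose that s
    moves an end i.  No member separates i from s i, so {i, s i} is a cluster by
    maximality.  It contains no marked end, so u vanishes on it, and it cannot be a
    member.  Hence it consists of all ends but the root, and balancing gives
    2 v(x_i) = 0, contradicting that degrees have no zero vectors. *)
Lemma nondeg_relab_free s F : s \in relab -> nd F -> shift s F = F -> s = 1%g.
Proof.
move=> sG ndF eF; have /andP[fF _] := ndF; have szF := nondeg_size famsz ndF.
have sK K : K \in F -> (s @: K)%SET = K.
  move=> KF; apply/eqP/negPn/negP => ne.
  have sKF : (s @: K)%SET \in F by rewrite -eF imset_f.
  case/negP: (nondeg_wall_det famsz ndF sKF); apply/eqP; rewrite /wall_det evu_relab // sdet_mem ?m_gt0 //.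
    by apply: mem_gens; rewrite !inE eq_sym ne.
  by rewrite size_gens; apply: (card_wall famsz ndF sKF).
have triF := nondeg_trivalent r_gt0 dimE ndF.
apply/permP=> i; rewrite perm1; apply/eqP/negPn/negP => nei.
have nmark j : i != lshift _ j by apply: contraNneq nei => ->; rewrite relab_marked.
have nmarks j : s i != lshift _ j.
  by apply: contraNneq nei => e; apply/eqP; apply: (@perm_inj _ s); rewrite e relab_marked.
pose K := [set i; s i]%SET.
(* K contains no marked end. *)
have uK : u K = 0.
  apply: (can_inj vec_mxK); rewrite mxvecK linear0; apply/row_matrixP=> j; rewrite rowK row0.
  by rewrite !inE ![lshift _ _ == _]eq_sym (negPf (nmark j)) (negPf (nmarks j)).
have cK : cluster Omega F K.
  apply: trivalent_maximal => //.
  - by apply/subsetP=> k; rewrite !inE => /orP[] /eqP->; [apply: nmark|apply: nmarks].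
  - by apply/set0Pn; exists i; rewrite !inE eqxx.
  move=> A AF; have e : (s i \in A) = (i \in A).
    by rewrite -{1}(sK A AF) (mem_imset _ _ (@perm_inj _ s)).
  apply/or3P; have [iA|iA] := boolP (i \in A).
    by apply/Or31/subsetP=> k; rewrite !inE => /orP[] /eqP->; rewrite ?e.
  by apply/Or33/pred0P=> k /=; rewrite !inE; apply/negP=> /andP[/orP[] /eqP->]; rewrite ?e (negPf iA).
case/or3P: cK => [KF|/eqP KO|/andP[/eqP]]; last by rewrite cards2 eq_sym nei.
  case/negP: (nondeg_wall_det famsz ndF KF); apply/eqP; rewrite /wall_det uK -(detformE m_gt0).
  by rewrite mul0mx mxE.
have := edir_Omega n_gt0 Delta_sum0; rewrite -KO /edir big_setU1 ?inE 1?eq_sym //= big_set1 relab_dir //.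
case: (split_ordP i) nmark => [j -> /(_ j)|j -> _]; first by rewrite eqxx.
rewrite end_dir_unmarked => e; case/eqP: (Delta_neq0 (mem_nth 0 (ltn_ord j))).
by apply/rowP=> k; have /rowP/(_ k) := e; rewrite !mxE -mulr2n => /eqP; rewrite mulrn_eq0 => /eqP.
Qed.

(** The tree families of the labeled curves through X. *)
Definition solutions (X : 'rV[R]_(n * r)) : {set {set {set 'I_N}}} :=
  [set F | nd F && [forall K in F, 0 < coord m_gt0 base u F K X]]%SET.

Lemma solutionsP F X : reflect (nd F /\ exists c p, (forall K, K \in F -> 0 < c K) /\ solves (base := base) u F c p X)
  (F \in solutions X).
Proof.
rewrite inE; apply: (iffP andP) => -[ndF h]; split=> //.
  have [c [p sX]] := nondeg_solve famsz X ndF; exists c, p; split=> // K KF.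
  by rewrite -(coordE m_gt0 famsz ndF KF sX); apply: (forall_inP h).
case: h => c [p [c0 sX]]; apply/forall_inP=> K KF.
by rewrite (coordE m_gt0 famsz ndF KF sX) c0.
Qed.

Lemma sum_relab s F (c : {set 'I_N} -> R) :
  s \in relab -> \sum_(K in shift s F) c K *: toR R (u K) = \sum_(K in F) c (s @: K)%SET *: toR R (u K).
Proof.
move=> sG; rewrite big_imset /=; last by move=> ? ? _ _; apply/imset_inj/perm_inj.
by apply: eq_bigr => K _; rewrite evu_relab.
Qed.

Lemma solutions_relab s F X : s \in relab -> F \in solutions X -> shift s F \in solutions X.
Proof.
move=> sG /solutionsP[ndF [c [p [c0 sX]]]]; apply/solutionsP; split; first exact: nondeg_relab.
exists (fun K => c ((s^-1)%g @: K)%SET), p.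
have sK K : ((s^-1)%g @: (s @: K))%SET = K by apply: imset_permK.
split=> [_ /imsetP[K KF ->]|]; first by rewrite sK c0.
rewrite /solves sum_relab // [LHS]sX; congr (_ + _).
by apply: eq_bigr => K _; rewrite sK.
Qed.

Lemma curve_solves C : solves (base := base) u (end_splits C i0) (split_len n_gt0 C)
  (fun k => pos (foot C i0) 0 (cast_ord (size_evbase r n) k)) (mxvec (ev C)).
Proof. by rewrite /solves -diagvE; apply: ev_solves. Qed.

Lemma curve_solution C : nd (end_splits C i0) -> end_splits C i0 \in solutions (mxvec (ev C)).
Proof.
move=> ndC; apply/solutionsP; split=> //; do 2 eexists; split; last exact: curve_solves.
by move=> K; apply: split_len_gt0.
Qed.

Lemma solution_curve F (P : 'M[R]_(n, r)) : F \in solutions (mxvec P) ->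
  exists C, end_splits C i0 = F /\ ev C = P.
Proof.
move=> /solutionsP[ndF [c [p [c0 sX]]]]; have /andP[fF _] := ndF.
pose q : 'rV[R]_r := \row_a p (cast_ord (esym (size_evbase r n)) a).
have [C [sC lC pC]] := realization r_gt0 Delta_sum0 dimE q fF c0.
exists C; split=> //; apply: (can_inj mxvecK); rewrite (ev_solves n_gt0) sC pC sX diagvE.
congr (_ + _); first by apply: eq_bigr => K KF; rewrite lC.
by apply: eq_bigr => k _; rewrite mxE cast_ordK.
Qed.

Lemma iso_end_splits s C C' : s \in relab -> iso_upto s C C' ->
  end_splits C' i0 = shift s (end_splits C i0).
Proof.
move=> sG [f bf [fE _ fi _]]; have [g fK gK] := bf.
have treeC := curve_tree C; have treeC' := curve_tree C'.
have farE E W : E \in edges C -> far (foot C' i0) (f @: E)%SET (f W) = far (foot C i0) E W.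
  move=> EE; symmetry.
  apply: (far_unique treeC (chi := fun W => far (foot C' i0) (f @: E)%SET (f W))) => // [|a b ab].
    by rewrite -fi relab_root // far_root.
  have eab : [set f a; f b]%SET = (f @: [set a; b])%SET by rewrite imsetU1 imset_set1.
  rewrite (far_xor treeC') ?fE // eab ?fE //.
  by rewrite (inj_eq (imset_inj (can_inj fK))).
have endE E : E \in edges C -> endset i0 (f @: E)%SET = (s @: endset i0 E)%SET.
  move=> EE; apply/setP=> i; rewrite -(permKV s i) (mem_imset _ _ (@perm_inj _ s)) !inE.
  by rewrite fi farE.
apply/setP=> K; apply/imsetP/imsetP=> [[E' EE' ->]|[_ /imsetP[E EE ->] ->]]; last first.
  by exists (f @: E)%SET; rewrite ?fE ?endE.
have eE' : E' = (f @: (g @: E'))%SET.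
  by rewrite -imset_comp -[LHS]imset_id; apply: eq_imset => a /=; rewrite gK.
have gE : (g @: E')%SET \in edges C by rewrite -fE -eE'.
by exists (endset i0 (g @: E')%SET); [apply: imset_f|rewrite {1}eE' endE].
Qed.

(** The family determines the tree, and by Cramer's rule the point determines the
    lengths and the position of the root. *)
Lemma end_splits_iso s C C' : s \in relab -> nd (end_splits C i0) -> ev C = ev C' ->
  end_splits C' i0 = shift s (end_splits C i0) -> iso_upto s C C'.
Proof.
move=> sG ndC eP sC'; have treeC := curve_tree C; have treeC' := curve_tree C'.
have [f [bf f1 f2 f3 f4]] := tree_iso treeC treeC' sC'.
have lenE K : K \in end_splits C i0 -> split_len n_gt0 C' (s @: K)%SET = split_len n_gt0 C K.
  move=> KF; rewrite -(coordE m_gt0 famsz ndC KF (curve_solves C)).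
  apply/esym; apply: (coordE (p := fun k => pos (foot C' i0) 0 (cast_ord (size_evbase r n) k))
     (c := fun K => split_len n_gt0 C' (s @: K)%SET) m_gt0 famsz ndC KF).
  by rewrite eP /solves -sum_relab // -sC' [LHS]curve_solves.
have posE : pos (foot C i0) = pos (foot C' i0).
  have := ev_solves n_gt0 C; rewrite eP (ev_solves n_gt0) sC' sum_relab //.
  rewrite (eq_bigr _ (fun K KF => congr1 (fun c => c *: toR R (u K)) (lenE K KF))).
  move=> /addrI/(congr1 vec_mx); rewrite !mxvecK => /row_matrixP/(_ (Ordinal n_gt0)).
  by rewrite !rowK.
have lenf E : E \in edges C -> len (f @: E)%SET = len E.
  move=> EE; rewrite -(split_lenE n_gt0 EE) -lenE ?imset_f // -f2 // split_lenE //.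
  by rewrite f1.
exists f => //; split=> // W.
rewrite (pos_far n_gt0 (f W)) (pos_far n_gt0 W) posE; congr (_ + _).
have -> : edges C' = [set (f @: (E : {set vert C}))%SET | E in edges C]%SET.
  have [g fK gK] := bf; apply/setP=> E'; apply/idP/imsetP=> [EE'|[E EE ->]]; last by rewrite f1.
  have eE' : E' = (f @: (g @: E'))%SET.
    by rewrite -imset_comp -[LHS]imset_id; apply: eq_imset => a /=; rewrite gK.
  by exists (g @: E')%SET => //; rewrite -f1 -eE'.
rewrite big_mkcondr big_imset /=; last by move=> ? ? _ _; apply/imset_inj/(bij_inj bf).
rewrite [RHS]big_mkcondr; apply: eq_bigr => E EE.
by rewrite f3 // lenf // f2 // edir_relab.
Qed.

Let to : {action {perm 'I_N} &-> {set {set 'I_N}}} := ('P^*^*)%act.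

Let toE F s : to F s = shift s F.
Proof. by []. Qed.

Lemma solutions_acts X : [acts G, on solutions X | to].
Proof.
apply/actsP=> s sG F; apply/idP/idP=> h; last exact: solutions_relab.
by rewrite -(actK to s F); apply: solutions_relab h; apply: (@groupVr _ G).
Qed.

(** The action is free and preserves the determinants, so each orbit contributes |G|
    times the term of its representative. *)
Lemma sum_solutions X :
  (\sum_(F in solutions X) `|sdet (gens base u F)| =
   #|G| * \sum_(F in orbit_transversal to G (solutions X)) `|sdet (gens base u F)|)%N.
Proof.
have [_ subX injX repX] := orbit_transversalP (solutions_acts X).
set T := orbit_transversal _ _ _ in subX injX repX *.
have TS F : F \in T -> F \in solutions X by apply: (subsetP subX).
have absE F s : F \in T -> s \in G -> `|sdet (gens base u (to F s))|%N = `|sdet (gens base u F)|%N.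
  move=> /TS; rewrite inE => /andP[ndF _] sG; apply: absdet_relab => //.
  exact: (nondeg_size famsz ndF).
have freeT F s t : F \in T -> s \in G -> t \in G -> to F s = to F t -> s = t.
  move=> /TS; rewrite inE => /andP[ndF _] sG tG e.
  have := nondeg_relab_free (groupM sG (groupVr tG)) ndF.
  rewrite -toE actM e actK => /(_ erefl) e1.
  by apply/eqP; rewrite eq_mulgV1; apply/eqP.
(* Freeness: every solution is the image of a unique pair of a representative and
   a relabeling. *)
transitivity (\sum_(p | (p.1 \in T) && (p.2 \in G)) `|sdet (gens base u (to p.1 p.2))|)%N.
  rewrite [RHS](partition_big (fun p => to p.1 p.2) (mem (solutions X))) /=; last first.
    by move=> p /andP[/TS pT pG]; apply: solutions_relab.
  apply: eq_bigr => F FS; have [s sG sT] := repX F FS.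
  rewrite (big_pred1 (to F s, (s^-1)%g)) => [|[F' t]] /=; first by rewrite actK.
  rewrite xpair_eqE; apply/andP/andP=> [[/andP[F'T tG] /eqP e]|[/eqP-> /eqP->]].
    have eF' : F' = to F s.
      have : to F s \in orbit to G F'.
        by rewrite -e -actM; apply: mem_orbit; apply: groupM.
      by rewrite (injX F' _ F'T sT) => /eqP.
    split; apply/eqP => //; apply: (freeT F') => //; first exact: groupVr.
    by transitivity F => //; rewrite eF' actK.
  by split; [rewrite sT; apply: (@groupVr _ G)|rewrite actK].
rewrite -(pair_big (mem T) (mem G) (fun F s => `|sdet (gens base u (to F s))|%N)) /= big_distrr /=.
by apply: eq_bigr => F FT; rewrite (eq_bigr _ (fun s sG => absE F s FT sG)) sum_nat_const.
Qed.

Lemma count_curves (P : 'M[R]_(n, r)) :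
    (forall C, ev C = P -> nd (end_splits C i0)) ->
  curve_count n_gt0 Delta P (weighted_count m_gt0 base u (tree_family Omega) (mxvec P) %/ #|G|).
Proof.
move=> ndP; split=> [C /ndP ndC|]; first exact: nondeg_in_maximal_cone ndC.
pose X := mxvec P; have [_ subX injX repX] := orbit_transversalP (solutions_acts X).
set T := orbit_transversal _ _ _ in subX injX repX *.
have [Cs CsP] : {Cs : 'I_#|T| -> curve R n Delta &
    forall a, end_splits (Cs a) i0 = enum_val a /\ ev (Cs a) = P}.
  apply: (@choice _ _ (fun a C => end_splits C i0 = enum_val a /\ ev C = P)) => a.
  by apply: solution_curve; apply: (subsetP subX); apply: enum_valP.
exists #|T|, Cs; split.
- by move=> a; have [] := CsP a.
- move=> a b [s sG /(iso_end_splits sG)]; have [-> _] := CsP a; have [-> _] := CsP b => e.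
  apply: enum_val_inj; apply/eqP; rewrite -(injX _ _ (enum_valP a) (enum_valP b)) e.
  exact: mem_orbit.
- move=> C eC; have ndC := ndP C eC.
  have CS : end_splits C i0 \in solutions X by rewrite /X -eC; apply: curve_solution.
  have [s sG sT] := repX _ CS.
  exists (enum_rank_in sT (to (end_splits C i0) s)); exists s => //.
  set a := enum_rank_in _ _; have [ea evC] := CsP a.
  by apply: end_splits_iso; rewrite // ?evC // ea enum_rankK_in.
have -> : weighted_count m_gt0 base u (tree_family Omega) (mxvec P) =
    (\sum_(F in solutions X) `|sdet (gens base u F)|)%N.
  rewrite /weighted_count [RHS](eq_bigl _ _ (fun F => in_set _ _)) [RHS]big_mkcondr /=.
  by apply: eq_bigr => F _; rewrite /contribution; case: ifP => _; rewrite ?muln1 ?muln0.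
rewrite sum_solutions mulKn ?cardG_gt0 // big_enum_val /=.
apply: eq_bigr => a _; have [ea evC] := CsP a.
by rewrite mult_ev_det // ea //; have := ndP _ evC; rewrite ea.
Qed.

End Assembly.

Theorem theorem5p1 (R : realType) (r n : nat) (Delta : seq 'rV[int]_r)
    (r_ge2 : (2 <= r)%N) (n_gt0 : (0 < n)%N)
    (Delta_neq0 : forall v, v \in Delta -> v != 0)
    (Delta_sum0 : \sum_(v <- Delta) v = 0)
    (dimE : (r + n + size Delta - 3 = n * r)%N) :
  exists Y0 : set (set 'rV[R]_(n * r)),
    [/\ is_fan Y0,
        forall sigma, Y0 sigma -> (setdim sigma < n * r)%N &
        exists d : nat, forall P : 'M[R]_(n, r),
          ~ fan_support Y0 (mxvec P) -> curve_count n_gt0 Delta P d].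
Proof.
have r_gt0 : (0 < r)%N by apply: leq_trans r_ge2.
have m_gt0 := eval_dim_gt0 n_gt0 r_gt0.
set N := (n + size Delta)%N; pose base := evbase r n; pose u := @evu r n Delta.
have kerP (F : {set {set 'I_N}}) : exists f : 'cV[int]_(n * r), sdet (gens base u F) = 0 ->
    f != 0 /\ seq_mx (gens base u F) *m f = 0.
  have [/det0_kernel[f f0 fF]|ne] := eqVneq (sdet (gens base u F)) 0; first by exists f.
  by exists 0 => e; rewrite e eqxx in ne.
(* The forms kf F vanish on the image of ev for the degenerate family F. *)
have [kf kfP] := choice kerP.
pose fs := [seq f <- [seq detform m_gt0 (gens base u F) | F : {set {set 'I_N}} <- enum {set {set 'I_N}}] | f != 0] ++
  [seq kf F | F : {set {set 'I_N}} <- [seq F <- enum {set {set 'I_N}} | sdet (gens base u F) == 0]].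
have fs0 f : f \in fs -> f != 0.
  rewrite mem_cat mem_filter => /orP[/andP[]//|/mapP[F]].
  by rewrite mem_filter => /andP[/eqP d0 _] ->; case: (kfP F d0).
exists (@arrangement R _ fs); split; first exact: arrangement_fan.
  exact: arrangement_dim.
pose off_fan (P : 'M[R]_(n, r)) := ~ fan_support (@arrangement R _ fs) (mxvec P).
have off_fan_walls P : off_fan P -> off_walls m_gt0 base u (mxvec P).
  move=> gP F F0; apply/eqP=> e; apply: gP; apply/arrangement_support.
  exists (detform m_gt0 (gens base u F)) => //.
  rewrite mem_cat mem_filter (map_f (fun F : {set {set 'I_N}} => detform m_gt0 (gens base u F))) ?mem_enum // andbT.
  by apply/orP; left; apply: contraNneq F0 => e0; rewrite /wallform e0 map_mx0.
have ndP P : off_fan P -> forall C : curve R n Delta, ev C = P ->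
    nondeg base u (tree_family [set~ root_end n_gt0 Delta]%SET) (end_splits C (root_end n_gt0 Delta)).
  move=> gP C eC; have fC := end_splits_family (curve_tree C) (root_end n_gt0 Delta).
  rewrite /nondeg fC /=; apply/eqP=> d0; apply: gP; apply/arrangement_support.
  set F := end_splits C _ in fC d0; have [f0 fF] := kfP F d0; exists (kf F).
    by rewrite mem_cat; apply/orP; right; apply: map_f; rewrite mem_filter d0 eqxx mem_enum.
  have szF := family_size r_gt0 dimE fC.
  have kill x : x \in gens base u F -> dot (map_mx intr (kf F)) (toR R x) = 0.
    move=> xF; rewrite /dot /toR -map_mxM; have lt : (index x (gens base u F) < n * r)%N.
      by apply: leq_trans szF; rewrite -(size_gens base u F) index_mem.
    have -> : x = row (Ordinal lt) (seq_mx (gens base u F)) by rewrite rowK nth_index.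
    by rewrite -row_mul fF row0 map_mx0 mxE.
  rewrite -eC (curve_solves n_gt0 C) dotD !dot_sum !big1 ?addr0 // => [k _|K KF].
    by rewrite dotZ kill ?mulr0 // mem_cat mem_nth ?orbT.
  by rewrite dotZ kill ?mulr0 // mem_gens.
(* The number is read off at any base point of the complement. *)
have [[P0 gP0]|none] := pselect (exists P, off_fan P); last first.
  by exists 0%N => P gP; case: none; exists P.
pose tot P := weighted_count m_gt0 base u (tree_family [set~ root_end n_gt0 Delta]%SET) (mxvec P : 'rV[R]_(n * r)).
exists (tot P0 %/ #|relabelings n Delta|)%N => P gP.
have -> : tot P0 = tot P.
  apply: weighted_count_const; [|exact: evu_balanced|exact: off_fan_walls|exact: off_fan_walls].
  by move=> F; apply: family_size.
exact: (count_curves r_gt0 Delta_neq0 Delta_sum0 dimE (ndP P gP)).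
Qed.
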